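(* We have $\mathbf{T}_{\boldsymbol\omega}(\Theta_{i,n})=\Theta_{i,n}$ for all $n\ge1$ and $i=1,2$.
   Context: Here $v$ is an indeterminate, $[n]=\frac{v^n-v^{-n}}{v-v^{-1}}$, $[A,B]_{v^a}=AB-v^aBA$ and $[A,B]=AB-BA$. Let $\mathbb{I}=\{0,1,2\}$, let $(c_{ij})_{i,j\in\mathbb{I}}$ be the Cartan matrix of affine type $A_2^{(1)}$ ($c_{ii}=2$, $c_{ij}=-1$ for $i\ne j$), and let $\tau$ be the involution of $\mathbb{I}$ with $\tau(0)=0$, $\tau(1)=2$, $\tau(2)=1$. The algebra $\widetilde{\mathbf U}^\imath$ is the $\mathbb{Q}(v)$-algebra generated by $B_i$ and invertible elements $\mathbb{K}_i$ ($i\in\mathbb{I}$), subject to: $\mathbb{K}_i\mathbb{K}_j=\mathbb{K}_j\mathbb{K}_i$ and $\mathbb{K}_iB_j=v^{c_{\tau i,j}-c_{ij}}B_j\mathbb{K}_i$ for $i,j\in\mathbb{I}$; $B_2B_1^2-[2]B_1B_2B_1+B_1^2B_2=-[2](v\mathbb{K}_1B_1+vB_1\mathbb{K}_2)$; $B_1B_2^2-[2]B_2B_1B_2+B_2^2B_1=-[2](v\mathbb{K}_2B_2+vB_2\mathbb{K}_1)$; $B_0B_i^2-[2]B_iB_0B_i+B_i^2B_0=0$ for $i=1,2$; $B_iB_0^2-[2]B_0B_iB_0+B_0^2B_i=-v^{-1}\mathbb{K}_0B_i$ for $i=1,2$. Braid group operators: $\mathbf{T}_0$ is the $\mathbb{Q}(v)$-algebra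 automorphism of $\widetilde{\mathbf U}^\imath$ with $\mathbf{T}_0(\mathbb{K}_0)=\mathbb{K}_0^{-1}$, $\mathbf{T}_0(\mathbb{K}_i)=\mathbb{K}_i\mathbb{K}_0$, $\mathbf{T}_0(B_0)=B_0\mathbb{K}_0^{-1}$, $\mathbf{T}_0(B_i)=[B_i,B_0]_v$ ($i=1,2$). $\mathbf{T}_1$ is the $\mathbb{Q}(v)$-algebra automorphism of $\widetilde{\mathbf U}^\imath$ with $\mathbf{T}_1(\mathbb{K}_1)=v^{-1}\mathbb{K}_2^{-1}$, $\mathbf{T}_1(\mathbb{K}_2)=v^{-1}\mathbb{K}_1^{-1}$, $\mathbf{T}_1(\mathbb{K}_0)=v^2\mathbb{K}_0\mathbb{K}_1^2\mathbb{K}_2^2$, $\mathbf{T}_1(B_1)=-v^{-2}B_1\mathbb{K}_2^{-1}$, $\mathbf{T}_1(B_2)=-v^{-2}B_2\mathbb{K}_1^{-1}$, $\mathbf{T}_1(B_0)=v\big[[[B_0,B_1]_v,B_2],[B_2,B_1]_v\big]-\big[B_0,[B_2,B_1]_{v^3}\big]\mathbb{K}_1+vB_0\mathbb{K}_1\mathbb{K}_2$. Set $\mathbf{T}_{\boldsymbol\omega}=\mathbf{T}_0\mathbf{T}_1$. Root vectors in $\widetilde{\mathbf U}^\imath$: fix signs $o(1),o(2)\in\{\pm1\}$ with $o(1)=-o(2)$; set $C=-v\mathbb{K}_0\mathbb{K}_1\mathbb{K}_2$. For $i\in\{1,2\}$, $k\in\mathbb{Z}$ put $B_{i,k}=o(i)^{k}\,\mathbf{T}_{\boldsymbol\omega}^{-k}(B_i)$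 and $D_{i,k}=-[B_{\tau i},B_{i,k}]_{v^{-1}}-[B_{i,k+1},B_{\tau i,-1}]_{v^{-1}}$. Put $\Theta_{i,0}=\frac1{v-v^{-1}}$ and inductively $\Theta_{i,1}=-o(i)\big([B_i,[B_{\tau i},B_0]_v]_{v^2}-vB_0\mathbb{K}_i\big)$, $\Theta_{i,2}=-vD_{i,0}C\mathbb{K}_{\tau i}^{-1}+v\Theta_{i,0}C-\Theta_{\tau i,0}C\mathbb{K}_{\tau i}^{-1}\mathbb{K}_i$, $\Theta_{i,m}=v\Theta_{i,m-2}C-vD_{i,m-2}C\mathbb{K}_{\tau i}^{-1}$ for $m\ge3$. *)

(* Defs.v *)
From HB Require Import structures.
From mathcomp Require Import all_boot all_order all_algebra.
From mathcomp Require Import boolp.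
From mathcomp Require Import finmap monalg.

Set Implicit Arguments.
Unset Strict Implicit.
Unset Printing Implicit Defensive.

Import GRing.Theory.
Local Open Scope ring_scope.
Local Open Scope quotient_scope.

Definition tau (i : 'I_3) : 'I_3 :=
  match val i with 1%N => 2 | 2%N => 1 | _ => 0 end.

Definition cartan (i j : 'I_3) : int := if i == j then 2 else -1.

(* [x, y]_a; the subscript a is the scalar itself, e.g. v ^+ 2 or v^-1. *)
Definition qcomm (F : fieldType) (A : algType F) (a : F) (x y : A) : A :=
  x * y - a *: (y * x).

Definition comm (F : fieldType) (A : algType F) (x y : A) : A :=
  x * y - y * x.

Section Relations.

Variables (F : fieldType) (v : F).

Definition qint (n : int) : F := (v ^ n - v ^ (- n)) / (v - v^-1).

Variables (A : algType F) (B K KV : 'I_3 -> A).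

(* The presentation, read in any algebra with elements B i, K i, KV i, where
   KV i plays the role of the inverse of K i. *)
Inductive defrel : A -> A -> Prop :=
| rel_KKV i : defrel (K i * KV i) 1
| rel_KVK i : defrel (KV i * K i) 1
| rel_KK i j : defrel (K i * K j) (K j * K i)
| rel_KB i j : defrel (K i * B j)
    (v ^ (cartan (tau i) j - cartan i j) *: (B j * K i))
| rel_B21 : defrel
    (B 2 * B 1 ^+ 2 - qint 2 *: (B 1 * B 2 * B 1) + B 1 ^+ 2 * B 2)
    (- (qint 2 *: (v *: (K 1 * B 1) + v *: (B 1 * K 2))))
| rel_B12 : defrel
    (B 1 * B 2 ^+ 2 - qint 2 *: (B 2 * B 1 * B 2) + B 2 ^+ 2 * B 1)
    (- (qint 2 *: (v *: (K 2 * B 2) + v *: (B 2 * K 1))))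
| rel_B0i i : i != 0 -> defrel
    (B 0 * B i ^+ 2 - qint 2 *: (B i * B 0 * B i) + B i ^+ 2 * B 0)
    0
| rel_Bi0 i : i != 0 -> defrel
    (B i * B 0 ^+ 2 - qint 2 *: (B 0 * B i * B 0) + B 0 ^+ 2 * B i)
    (- (v^-1 *: (K 0 * B i))).

Lemma defrel_aug (f : {lrmorphism A -> F | *%R}) :
  (forall i, f (B i) = 0) -> (forall i, f (K i) = 1) ->
  (forall i, f (KV i) = 1) -> forall x y, defrel x y -> f x = f y.
Proof.
move=> fB fK fV x y.
have fM a b : f (a * b) = f a * f b by exact: rmorphM.
have fD a b : f (a + b) = f a + f b by exact: rmorphD.
have fN a : f (- a) = - f a by exact: rmorphN.
have fZ c a : f (c *: a) = c * f a by exact: linearZ.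
have f0 : f 0 = 0 by exact: rmorph0.
have f1 : f 1 = 1 by exact: rmorph1.
case=> [i|i|i j|i j|||i _|i _];
  rewrite ?expr2 ?(fM, fD, fN, fZ) ?fB ?fK ?fV ?f0 ?f1;
  by rewrite ?(mulr0, mul0r, addr0, oppr0, mulr1).
Qed.

End Relations.

(* GKV i is the formal inverse of GK i. *)
Inductive gen := GB of 'I_3 | GK of 'I_3 | GKV of 'I_3.

Definition gen_code (g : gen) : 'I_3 + ('I_3 + 'I_3) :=
  match g with
  | GB i => inl i | GK i => inr (inl i) | GKV i => inr (inr i)
  end.

Definition gen_decode (s : 'I_3 + ('I_3 + 'I_3)) : gen :=
  match s with
  | inl i => GB i | inr (inl i) => GK i | inr (inr i) => GKV i
  end.

Lemma gen_codeK : cancel gen_code gen_decode.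
Proof. by case. Qed.

HB.instance Definition _ := Countable.copy gen (can_type gen_codeK).

Lemma malg_scalerAr (M : monomType) (R : comNzRingType) (k : R)
  (x y : {malg R[M]}) : k *: (x * y) = x * (k *: y).
Proof.
rewrite malgME scaler_sumr (malgMEw (fsubset_refl _) (msuppZ_le k y)).
apply: eq_bigr => m _; rewrite scaler_sumr; apply: eq_bigr => m' _.
by apply/malgP => n; rewrite !(mcoeffZ, mcoeffU) mulrnAr mulrCA.
Qed.

(* The free associative F-algebra on gen, as the monoid algebra of the free
   monoid on gen. *)
Definition freeU (F : fieldType) : Type := {malg F[{fmonom gen}]}.

HB.instance Definition _ (F : fieldType) := GRing.Lalgebra.on (freeU F).

HB.instance Definition _ (F : fieldType) :=
  GRing.Lalgebra_isAlgebra.Build F (freeU F)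
  (@malg_scalerAr {fmonom gen} F).

HB.lock Definition fgen (F : fieldType) (g : gen) : freeU F := mkmalgU (fmu g) 1.

Section Construction.

Variables (F : fieldType) (v : F).

Local Notation freeU := (freeU F).

Local Notation relU := (defrel v (fun i => fgen F (GB i)) (fun i => fgen F (GK i))
  (fun i => fgen F (GKV i))).

(* The two-sided ideal generated by the differences of both sides of the
   relations; closure under opposites follows from multiplication by -1. *)
Inductive relideal : freeU -> Prop :=
| relideal_rel x y : relU x y -> relideal (x - y)
| relideal0 : relideal 0
| relidealD x y : relideal x -> relideal y -> relideal (x + y)
| relidealMl x y : relideal y -> relideal (x * y)
| relidealMr x y : relideal x -> relideal (x * y).

Lemma relidealN x : relideal x -> relideal (- x).
Proof. by move=> Ix; rewrite -mulN1r; apply: relidealMl. Qed.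

Definition Ueq : rel freeU := fun x y => `[< relideal (x - y) >].

Lemma Ueq_refl : reflexive Ueq.
Proof. by move=> x; apply/asboolP; rewrite subrr; apply: relideal0. Qed.

Lemma Ueq_sym : symmetric Ueq.
Proof.
by move=> x y; apply/asboolP/asboolP => /relidealN; rewrite opprB.
Qed.

Lemma Ueq_trans : transitive Ueq.
Proof.
move=> y x z /asboolP Ixy /asboolP Iyz; apply/asboolP.
by rewrite -(subrK y x) -addrA; apply: relidealD.
Qed.

Canonical Ueq_equiv := EquivRel Ueq Ueq_refl Ueq_sym Ueq_trans.

Definition U : Type := {eq_quot Ueq}.

HB.instance Definition _ := Choice.on U.
HB.instance Definition _ := EqQuotient.on U.

Definition piU (x : freeU) : U := \pi_U x.

Lemma piUP x y : piU x = piU y <-> relideal (x - y).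
Proof.
split=> [/eqquotP /asboolP //|Ixy].
by apply/eqquotP/asboolP.
Qed.

Lemma piUK (x : U) : piU (repr x) = x.
Proof. exact: reprK. Qed.

Lemma reprU x : relideal (repr (piU x) - x).
Proof. by apply/piUP; rewrite piUK. Qed.

Section Ops.

Definition Uzero : U := piU 0.
Definition Uone : U := piU 1.
Definition Uopp : U -> U := locked (fun x => piU (- repr x)).
Definition Uadd : U -> U -> U := locked (fun x y => piU (repr x + repr y)).
Definition Umul : U -> U -> U := locked (fun x y => piU (repr x * repr y)).
Definition Uscale : F -> U -> U := locked (fun a x => piU (a *: repr x)).

Lemma piU_opp x : Uopp (piU x) = piU (- x).
Proof. by unlock Uopp; apply/piUP; rewrite -opprD; apply: relidealN (reprU x). Qed.

Lemma piU_add x y : Uadd (piU x) (piU y) = piU (x + y).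
Proof.
unlock Uadd; apply/piUP; rewrite opprD addrACA.
exact: relidealD (reprU x) (reprU y).
Qed.

Lemma piU_mul x y : Umul (piU x) (piU y) = piU (x * y).
Proof.
unlock Umul; apply/piUP; set x' := repr (piU x); set y' := repr (piU y).
have -> : x' * y' - x * y = (x' - x) * y' + x * (y' - y).
  by rewrite mulrBl mulrBr addrA subrK.
apply: relidealD; first exact: relidealMr (reprU x).
exact: relidealMl (reprU y).
Qed.

Lemma piU_scale a x : Uscale a (piU x) = piU (a *: x).
Proof.
unlock Uscale; apply/piUP; rewrite -scalerBr -[_ - x]mul1r scalerAl.
exact: relidealMl (reprU x).
Qed.

Lemma piU_ind (P : U -> Prop) : (forall x, P (piU x)) -> forall x, P x.
Proof. by move=> Px x; rewrite -(piUK x). Qed.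

Let piE := (piU_opp, piU_add, piU_mul, piU_scale).

Lemma UaddA : associative Uadd.
Proof.
by elim/piU_ind=> x; elim/piU_ind=> y; elim/piU_ind=> z; rewrite !piE addrA.
Qed.

Lemma UaddC : commutative Uadd.
Proof. by elim/piU_ind=> x; elim/piU_ind=> y; rewrite !piE addrC. Qed.

Lemma Uadd0 : left_id Uzero Uadd.
Proof. by elim/piU_ind=> x; rewrite !piE add0r. Qed.

Lemma UaddN : left_inverse Uzero Uopp Uadd.
Proof. by elim/piU_ind=> x; rewrite !piE addNr. Qed.

Lemma UmulA : associative Umul.
Proof.
by elim/piU_ind=> x; elim/piU_ind=> y; elim/piU_ind=> z; rewrite !piE mulrA.
Qed.

Lemma Umul1l : left_id Uone Umul.
Proof. by elim/piU_ind=> x; rewrite !piE mul1r. Qed.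

Lemma Umul1r : right_id Uone Umul.
Proof. by elim/piU_ind=> x; rewrite !piE mulr1. Qed.

Lemma UmulDl : left_distributive Umul Uadd.
Proof.
by elim/piU_ind=> x; elim/piU_ind=> y; elim/piU_ind=> z; rewrite !piE mulrDl.
Qed.

Lemma UmulDr : right_distributive Umul Uadd.
Proof.
by elim/piU_ind=> x; elim/piU_ind=> y; elim/piU_ind=> z; rewrite !piE mulrDr.
Qed.

(* The augmentation B_i |-> 0, K_i |-> 1 kills the relations, so U <> 0. *)
Definition aug_monom (m : {fmonom gen}) : F :=
  \prod_(g <- (m : seq gen)) (if g is GB _ then 0 else 1).

Lemma aug_monom_mmorphism : mmorphism aug_monom.
Proof.
split=> [x y|]; first by rewrite /aug_monom fmM big_cat.
by rewrite /aug_monom fm1 big_nil.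
Qed.

HB.instance Definition _ :=
  isMultiplicative.Build {fmonom gen} F aug_monom aug_monom_mmorphism.

Definition aug : {lrmorphism {malg F[{fmonom gen}]} -> F | *%R} :=
  mmap idfun aug_monom.

Lemma aug_gen g : aug (fgen F g) = (if g is GB _ then 0 else 1).
Proof. by rewrite /aug /= fgen.unlock mmapU mul1r /aug_monom fmU big_seq1. Qed.

Lemma aug_rel x y : relU x y -> aug x = aug y.
Proof. by apply: (@defrel_aug F v freeU _ _ _ aug) => i; rewrite aug_gen. Qed.

Lemma aug_ideal x : relideal x -> aug x = 0.
Proof.
have aD a b : aug (a + b) = aug a + aug b by exact: rmorphD.
have aM a b : aug (a * b) = aug a * aug b by exact: rmorphM.
have aB a b : aug (a - b) = aug a - aug b by exact: rmorphB.
elim=> {x} [x y xy||x y _ x0 _ y0|x y _ y0|x y _ x0].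
- by rewrite aB (aug_rel xy) subrr.
- exact: rmorph0.
- by rewrite aD x0 y0 addr0.
- by rewrite aM y0 mulr0.
- by rewrite aM x0 mul0r.
Qed.

Lemma Uone_neq0 : Uone != Uzero.
Proof.
apply/eqP => /piUP /aug_ideal; rewrite subr0 rmorph1 => /eqP.
by rewrite oner_eq0.
Qed.

Lemma UscaleA a b x : Uscale a (Uscale b x) = Uscale (a * b) x.
Proof. by elim/piU_ind: x => x; rewrite !piE scalerA. Qed.

Lemma Uscale1 : left_id 1 Uscale.
Proof. by elim/piU_ind=> x; rewrite !piE scale1r. Qed.

Lemma UscaleDr : right_distributive Uscale Uadd.
Proof.
by move=> a; elim/piU_ind=> x; elim/piU_ind=> y; rewrite !piE scalerDr.
Qed.

Lemma UscaleDl x a b : Uscale (a + b) x = Uadd (Uscale a x) (Uscale b x).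
Proof. by elim/piU_ind: x => x; rewrite !piE scalerDl. Qed.

Lemma UscaleAl a x y : Uscale a (Umul x y) = Umul (Uscale a x) y.
Proof.
by elim/piU_ind: x => x; elim/piU_ind: y => y; rewrite !piE scalerAl.
Qed.

Lemma UscaleAr a x y : Uscale a (Umul x y) = Umul x (Uscale a y).
Proof.
by elim/piU_ind: x => x; elim/piU_ind: y => y; rewrite !piE scalerAr.
Qed.

HB.instance Definition _ := GRing.isZmodule.Build U UaddA UaddC Uadd0 UaddN.

HB.instance Definition _ := GRing.Zmodule_isNzRing.Build U
  UmulA Umul1l Umul1r UmulDl UmulDr Uone_neq0.

HB.instance Definition _ := GRing.Zmodule_isLmodule.Build F U
  UscaleA Uscale1 UscaleDr UscaleDl.

HB.instance Definition _ := GRing.Lmodule_isLalgebra.Build F U UscaleAl.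

HB.instance Definition _ := GRing.Lalgebra_isAlgebra.Build F U UscaleAr.

End Ops.

End Construction.

Record algAut (F : fieldType) (A : algType F) := AlgAut {
  aut_fun :> {lrmorphism A -> A};
  aut_inv : A -> A;
  aut_funK : cancel aut_fun aut_inv;
  aut_invK : cancel aut_inv aut_fun
}.

Section Automorphisms.

Variables (F : fieldType) (A : algType F).

Definition aut_comp (S T : algAut A) : algAut A :=
  AlgAut (can_comp (aut_funK S) (aut_funK T))
         (can_comp (aut_invK T) (aut_invK S)).

Definition aut_expz (T : algAut A) (k : int) (x : A) : A :=
  match k with
  | Posz n => iter n T x
  | Negz n => iter n.+1 (aut_inv T) x
  end.

End Automorphisms.

Section RootVectors.

Variables (F : fieldType) (v : F).

Definition genB (i : 'I_3) : U v := piU v (fgen F (GB i)).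
Definition genK (i : 'I_3) : U v := piU v (fgen F (GK i)).
Definition genKV (i : 'I_3) : U v := piU v (fgen F (GKV i)).

Local Notation B := genB.
Local Notation K := genK.
Local Notation KV := genKV.

Definition is_T0 (T : algAut (U v)) : Prop :=
  [/\ T (K 0) = KV 0,
      forall i, i != 0 -> T (K i) = K i * K 0,
      T (B 0) = B 0 * KV 0
    & forall i, i != 0 -> T (B i) = qcomm v (B i) (B 0)].

Definition is_T1 (T : algAut (U v)) : Prop :=
  [/\ T (K 1) = v^-1 *: KV 2, T (K 2) = v^-1 *: KV 1
    & T (K 0) = v ^+ 2 *: (K 0 * K 1 ^+ 2 * K 2 ^+ 2)] /\
  [/\ T (B 1) = - (v ^- 2 *: (B 1 * KV 2)),
      T (B 2) = - (v ^- 2 *: (B 2 * KV 1))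
    & T (B 0) =
        v *: comm (comm (qcomm v (B 0) (B 1)) (B 2)) (qcomm v (B 2) (B 1))
        - comm (B 0) (qcomm (v ^+ 3) (B 2) (B 1)) * K 1
        + v *: (B 0 * K 1 * K 2)].

Variables (o : 'I_3 -> F) (Tw : algAut (U v)).

Definition Ccentral : U v := - (v *: (K 0 * K 1 * K 2)).

Definition rootB (i : 'I_3) (k : int) : U v :=
  o i ^ k *: aut_expz Tw (- k) (B i).

Definition rootD (i : 'I_3) (k : int) : U v :=
  - qcomm v^-1 (B (tau i)) (rootB i k)
  - qcomm v^-1 (rootB i (k + 1)) (rootB (tau i) (-1)).

Local Notation C := Ccentral.

(* Only i = 1, 2 are meaningful. The last two cases are indexed by m = n - 2;
   the extra summand with tau i occurs only for n = 2. *)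
Fixpoint Theta (i : 'I_3) (n : nat) {struct n} : U v :=
  match n with
  | 0 => (v - v^-1)^-1 *: 1
  | 1 => - (o i *: (qcomm (v ^+ 2) (B i) (qcomm v (B (tau i)) (B 0))
                    - v *: (B 0 * K i)))
  | m.+2 =>
      if m == 0%N then
        - (v *: (rootD i 0 * C * KV (tau i))) + v *: (Theta i m * C)
        - Theta (tau i) m * C * KV (tau i) * K i
      else
        v *: (Theta i m * C) - v *: (rootD i m * C * KV (tau i))
  end.

End RootVectors.

Notation Qv := {fraction {poly rat}}.

(* The indeterminate of Q(v), locked to keep unification from computing with
   fractions. *)
HB.lock Definition vQ : Qv := tofrac 'X.

(* Main.v *)
From Stdlib Require Import ZArith.
Require Import Defs.
From mathcomp Require Import all_boot all_order all_algebra.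
From mathcomp Require Import ssrZ zify ring.

Set Implicit Arguments.
Unset Strict Implicit.
Unset Printing Implicit Defensive.

Import Order.TTheory GRing.Theory Num.Theory.
Local Open Scope ring_scope.
Local Delimit Scope Z_scope with BZ.

(** Write T for T_omega, a_k = B_{1,k} and b_k = B_{2,k}. Up to signs, T lowers
    the index of both families by one; it fixes the central element C and maps
    K_1 and K_2 to - C^-1 K_1 and - C^-1 K_2. Put
      E_{m,l} = [b_l, a_m]_{v^-1} + [a_(m+1), b_(l-1)]_{v^-1}
    ([mixed]). Then D_{1,m} = - E_{m,0} and T E_{m,l} = - E_{m-1,l-1}. By the
    recursion, Theta_{1,n} is made of C, K_1, K_2^-1, Theta_{1,1} and the
    elements C E_{m,0} K_2^-1 with 0 <= m <= n - 2; and T fixes C E_{m,0} K_2^-1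
    as soon as E_{m,0} = C E_{m-1,-1}. So everything follows if the defects
      E_{m+1,l+1} - C E_{m,l}
    vanish ([T_imag_upto]). Their vanishing only depends on the diagonal
    d = m - l ([shifted1]). Exchanging the two families replaces d by -2 - d, so
    that the statements for i = 1 and i = 2 together say that all defects
    vanish ([all_shifted]).

    For -3 <= d <= 1 this is a consequence of finitely many identities between
    the a_k and b_k with -2 <= k <= 1, which are collected, together with their
    translates under T, in [loop_data] and proved in [qsp_loop]. They are found
    by normal forms: words in B_0, B_1, B_2 are reduced by the Serre relations
    and by rules obtained from overlaps of these, with coefficients in the ring
    of Laurent polynomials in v localized at 1 + v^2, and T_0 and T_1 act on the
    reduced polynomials ([decideE], [derive_ok]).

    For the other diagonals one argues by induction. Assume that the defects
    vanish for -n - 1 <= d < n, where n >= 2. Then theta_m = (v - v^-1)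
    Theta_{1,m} satisfies the exchange relations with all a_q and b_q that are
    familiar from Drinfeld's presentation, for m <= n ([weight_all]). In terms
    of the logarithmic derivative h of the series of the theta_m they say that
    [h_n, a_q] is a combination of a_(q+n) and C^n a_(q-n), and likewise for b
    ([logd_bracket]). It follows that the brackets [h_n, E_{0,0}] and
    [h_2, E_{n-2,0}] are multiples of the defect g on the diagonal n, with
    factors n (v^(2n) - v^(-2n)) and 2 (v^4 - v^(-4)). On the other hand E_{0,0}
    and E_{n-2,0} can be expressed by theta_2 and theta_n, so that the same
    brackets are multiples of [theta_2, theta_n], with factors of opposite sign.
    As v^(2n) - v^(-2n) + v^4 - v^(-4) is not zero, both g and
    [theta_2, theta_n] vanish ([shifted_step]), and so does the defect on the
    diagonal -2 - n, by symmetry. *)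

(** * Scalars: Laurent polynomials in v over powers of 1 + v^2 *)

Section Zpow.
Variable R : nzRingType.

(** Here y plays the role of the inverse of x, as x^-1 is only defined in rings
    with a decidable notion of unit. *)
Definition zpow (x y : R) (z : Z) : R :=
  match z with
  | Z0 => 1
  | Zpos p => x ^+ Pos.to_nat p
  | Zneg p => y ^+ Pos.to_nat p
  end.

Lemma zpow_nat (x y : R) n : zpow x y (Z.of_nat n) = x ^+ n.
Proof. by case: n => [|n] //=; rewrite SuccNat2Pos.id_succ. Qed.

Lemma zpow_opp_nat (x y : R) n : zpow x y (- Z.of_nat n)%BZ = y ^+ n.
Proof. by case: n => [|n] //=; rewrite SuccNat2Pos.id_succ. Qed.

Variables (x y : R) (xy : x * y = 1) (yx : y * x = 1).

Lemma zpow_succ z : zpow x y (Z.succ z) = zpow x y z * x.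
Proof.
have [|z0] := Z.le_gt_cases 0 z.
  move=> z0; rewrite -(Z2Nat.id _ z0) -Nat2Z.inj_succ !zpow_nat exprSr //.
have -> : z = Z.opp (Z.of_nat (Z.to_nat (- z - 1)).+1).
  by rewrite Nat2Z.inj_succ Z2Nat.id; Lia.lia.
rewrite zpow_opp_nat exprSr -mulrA yx mulr1 -(zpow_opp_nat x y).
by congr zpow; Lia.lia.
Qed.

Lemma zpowD a b : zpow x y (a + b)%BZ = zpow x y a * zpow x y b.
Proof.
elim/Z.peano_ind: b => [|b IH|b IH]; first by rewrite Z.add_0_r mulr1.
  by rewrite Z.add_succ_r !zpow_succ IH mulrA.
rewrite -[LHS]mulr1 -xy mulrA -zpow_succ -[Z.pred b]/(Z.pred b).
have -> : Z.succ (a + Z.pred b)%BZ = (a + b)%BZ by Lia.lia.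
rewrite IH -{1}(Z.succ_pred b) zpow_succ.
by rewrite -!mulrA xy mulr1.
Qed.

End Zpow.

Section Scalars.
Variables (F : fieldType) (v : F).

Definition zF (z : Z) : F := (int_of_Z z)%:~R.

Lemma zFD a b : zF (a + b)%BZ = zF a + zF b.
Proof. by rewrite /zF -intrD; congr (_%:~R); exact: (rmorphD int_of_Z). Qed.
Lemma zFM a b : zF (a * b)%BZ = zF a * zF b.
Proof. by rewrite /zF -intrM; congr (_%:~R); exact: (rmorphM int_of_Z). Qed.
Lemma zFN a : zF (- a)%BZ = - zF a.
Proof. by rewrite /zF -rmorphN; congr (_%:~R); exact: (rmorphN int_of_Z). Qed.
Lemma zFB a b : zF (a - b)%BZ = zF a - zF b.
Proof. by rewrite -zFN -zFD. Qed.

Lemma zF0 : zF 0 = 0. Proof. by []. Qed.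
Lemma zF1 : zF 1 = 1. Proof. by []. Qed.

(** Coefficients from the constant term upwards; trailing zeros are allowed. *)
Definition zpoly := seq Z.

Fixpoint peval (p : zpoly) : F :=
  if p is c :: p' then zF c + v * peval p' else 0.

Definition pcons (c : Z) (p : zpoly) : zpoly :=
  match c, p with Z0, [::] => [::] | _, _ => c :: p end.

Lemma pconsE c p : peval (pcons c p) = zF c + v * peval p.
Proof. by case: c p => [|?|?] [|? ?] //=; rewrite mulr0 add0r. Qed.

Fixpoint padd (p q : zpoly) : zpoly :=
  match p, q with
  | [::], _ => q
  | _, [::] => p
  | c :: p', d :: q' => pcons (c + d)%BZ (padd p' q')
  end.

Lemma paddE p q : peval (padd p q) = peval p + peval q.
Proof.
elim: p q => [|c p IH] [|d q] /=; rewrite ?add0r ?addr0 //.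
by rewrite pconsE IH zFD mulrDr addrACA.
Qed.

Definition pscale (c : Z) (p : zpoly) : zpoly := [seq (c * x)%BZ | x <- p].

Lemma pscaleE c p : peval (pscale c p) = zF c * peval p.
Proof.
by elim: p => [|d p IH] /=; rewrite ?mulr0 // IH zFM mulrDr mulrCA.
Qed.

Fixpoint pmul (p q : zpoly) : zpoly :=
  match p with
  | [::] => [::]
  | c :: p' => if c is Z0 then pcons 0 (pmul p' q)
               else padd (pscale c q) (pcons 0 (pmul p' q))
  end.

Lemma pmulE p q : peval (pmul p q) = peval p * peval q.
Proof.
elim: p => [|c p IH] /=; first by rewrite mul0r.
have -> : peval (if c is Z0 then pcons 0 (pmul p q)
               else padd (pscale c q) (pcons 0 (pmul p q)))
  = zF c * peval q + v * (peval p * peval q).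
  by case: c => [|c|c]; rewrite ?paddE ?pscaleE pconsE IH /= ?mul0r ?add0r.
by rewrite mulrDl mulrA.
Qed.

Definition popp (p : zpoly) : zpoly := map Z.opp p.

Lemma poppE p : peval (popp p) = - peval p.
Proof. by elim: p => [|d p IH] /=; rewrite ?oppr0 // IH zFN mulrN opprD. Qed.

(** Exact division by 1 + v^2 from the constant term upwards; q1 and q2 are the
    two previous digits of the quotient. *)
Fixpoint pdiv12 (p : zpoly) (q1 q2 : Z) : option zpoly :=
  match p with
  | [::] => if (Z.eqb q1 0 && Z.eqb q2 0)%bool then Some [::] else None
  | c :: p' =>
      let q := (c - q2)%BZ in
      if pdiv12 p' q q1 is Some r then Some (pcons q r) else None
  end.

Lemma pdiv12E p q1 q2 r : pdiv12 p q1 q2 = Some r ->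
  peval p = (1 + v ^+ 2) * peval r + zF q2 + v * zF q1.
Proof.
elim: p q1 q2 r => [|c p IH] q1 q2 r /=.
  case: ifP => // /andP[/Z.eqb_eq -> /Z.eqb_eq ->] [<-] /=.
  by rewrite !mulr0 !addr0.
case E: pdiv12 => [s|] // [<-]; rewrite (IH _ _ _ E) pconsE zFB.
by ring.
Qed.

Definition p12 : zpoly := [:: 1%BZ; 0%BZ; 1%BZ].

Lemma p12E : peval p12 = 1 + v ^+ 2.
Proof. by rewrite /= zF0 zF1; ring. Qed.

(** The triple (e, b, p) stands for v^e p(v) / (1 + v^2)^b. Up to a power of v,
    the only scalar ever divided by is v + v^-1, so these fractions suffice. *)
Definition coef : Type := Z * nat * zpoly.

Definition cval (c : coef) : F :=
  let: (e, b, p) := c in zpow v v^-1 e * peval p / (1 + v ^+ 2) ^+ b.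

(* An integer polynomial that vanishes at v is zero: v is transcendental over
   the rationals. *)
Hypothesis vtr : forall p : zpoly, peval p = 0 -> all (Z.eqb 0) p.

Lemma v_neq0 : v != 0.
Proof.
apply/eqP => v0; have := vtr (p := [:: 0%BZ; 1%BZ]); rewrite /= v0 mul0r addr0.
by move=> /(_ erefl).
Qed.

Lemma d12_neq0 : 1 + v ^+ 2 != 0.
Proof. by rewrite -p12E; apply/eqP => /vtr. Qed.

Lemma zvD a b : zpow v v^-1 (a + b)%BZ = zpow v v^-1 a * zpow v v^-1 b.
Proof. by apply: zpowD; rewrite ?mulfV ?mulVf ?v_neq0. Qed.

Fixpoint cstrip (e : Z) (p : zpoly) : Z * zpoly :=
  if p is Z0 :: p' then cstrip (Z.succ e) p' else (e, p).

Lemma cstripE e p : zpow v v^-1 (cstrip e p).1 * peval (cstrip e p).2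
  = zpow v v^-1 e * peval p.
Proof.
elim: p e => [|[|c|c] p IH] e //=.
by rewrite IH -Z.add_1_r zvD /= expr1 add0r mulrA.
Qed.

Fixpoint ccancel (b : nat) (p : zpoly) : nat * zpoly :=
  if b is b'.+1 then
    if pdiv12 p 0 0 is Some r then ccancel b' r else (b, p)
  else (0%N, p).

Lemma ccancelE b p :
  peval (ccancel b p).2 / (1 + v ^+ 2) ^+ (ccancel b p).1
  = peval p / (1 + v ^+ 2) ^+ b.
Proof.
elim: b p => [|b IH] p //=.
case E: pdiv12 => [r|] //=; rewrite IH (pdiv12E E) zF0 mulr0 !addr0 [_ ^+ b.+1]exprS.
by rewrite invfM mulrA [(1 + v ^+ 2) * _]mulrC mulfK ?d12_neq0.
Qed.

(** Reducing the fraction keeps the numbers small during long computations. *)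
Definition cmk (e : Z) (b : nat) (p : zpoly) : coef :=
  if p is [::] then (0%BZ, 0%N, [::]) else
  let ep := cstrip e p in let bp := ccancel b ep.2 in (ep.1, bp.1, bp.2).

Lemma cmkE e b p : cval (cmk e b p) = cval (e, b, p).
Proof.
rewrite /cmk; case: p => [|c p]; first by rewrite /= !mulr0 !mul0r.
by rewrite /cval -mulrA ccancelE mulrA cstripE.
Qed.

Definition clift (e em : Z) (b bm : nat) (p : zpoly) : zpoly :=
  iter (Z.to_nat (e - em)) (cons 0%BZ) (iter (bm - b) (pmul p12) p).

Lemma cliftE e em b bm p : (em <= e)%BZ -> (b <= bm)%N ->
  cval (em, bm, clift e em b bm p) = cval (e, b, p).
Proof.
move=> le_e le_b; rewrite /cval /clift.
have -> n q : peval (iter n (cons 0%BZ) q) = v ^+ n * peval q.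
  by elim: n => [|n IH]; rewrite ?mul1r //= zF0 add0r IH exprS mulrA.
have -> n q : peval (iter n (pmul p12) q) = (1 + v ^+ 2) ^+ n * peval q.
  elim: n => [|n IH]; first by rewrite expr0 mul1r.
  by rewrite iterS pmulE p12E IH [_ ^+ n.+1]exprS mulrA.
rewrite -(zpow_nat v v^-1) Z2Nat.id ?mulrA -?zvD; last by Lia.lia.
rewrite Zplus_minus -!mulrA; congr (_ * _); rewrite mulrCA; congr (_ * _).
rewrite -{2}(subnK le_b) exprD invfM mulrA mulfV ?mul1r //.
by rewrite expf_neq0 ?d12_neq0.
Qed.

Definition cadd (c d : coef) : coef :=
  let: (e1, b1, p1) := c in let: (e2, b2, p2) := d in
  let e := Z.min e1 e2 in let b := maxn b1 b2 in
  cmk e b (padd (clift e1 e b1 b p1) (clift e2 e b2 b p2)).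

Lemma caddE c d : cval (cadd c d) = cval c + cval d.
Proof.
case: c d => [[e1 b1] p1] [[e2 b2] p2]; rewrite /cadd cmkE.
rewrite -(@cliftE e1 (Z.min e1 e2) b1 (maxn b1 b2)) ?leq_maxl //; last by Lia.lia.
rewrite -(@cliftE e2 (Z.min e1 e2) b2 (maxn b1 b2)) ?leq_maxr //; last by Lia.lia.
by rewrite /cval paddE mulrDr mulrDl.
Qed.

Definition cmul (c d : coef) : coef :=
  let: (e1, b1, p1) := c in let: (e2, b2, p2) := d in
  cmk (e1 + e2)%BZ (b1 + b2) (pmul p1 p2).

Lemma cmulE c d : cval (cmul c d) = cval c * cval d.
Proof.
case: c d => [[e1 b1] p1] [[e2 b2] p2]; rewrite /cmul cmkE /cval.
by rewrite zvD pmulE exprD mulrACA mulf_div.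
Qed.

Definition copp (c : coef) : coef := let: (e, b, p) := c in (e, b, popp p).

Lemma coppE c : cval (copp c) = - cval c.
Proof. by case: c => [[e b] p]; rewrite /= poppE mulrN mulNr. Qed.

Definition cshift (z : Z) (c : coef) : coef :=
  let: (e, b, p) := c in ((z + e)%BZ, b, p).

Lemma cshiftE z c : cval (cshift z c) = zpow v v^-1 z * cval c.
Proof. by case: c => [[e b] p]; rewrite /= zvD !mulrA. Qed.

Definition czero (c : coef) : bool := all (Z.eqb 0) c.2.

Lemma czeroE c : czero c -> cval c = 0.
Proof.
case: c => [[e b] p]; rewrite /czero /= => p0.
have -> : peval p = 0.
  by elim: p p0 => //= -[|c|c] p IH //= /IH ->; rewrite mulr0 addr0.
by rewrite mulr0 mul0r.
Qed.

Lemma cval_neq0 c : ~~ czero c -> cval c != 0.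
Proof.
case: c => [[e b] p]; rewrite /czero /= => p0.
rewrite !mulf_neq0 ?invr_neq0 ?expf_neq0 ?d12_neq0 //.
  have ve : zpow v v^-1 e * zpow v v^-1 (- e)%BZ = 1.
    by rewrite -zvD Z.add_opp_diag_r.
  by apply/eqP => e0; move: ve; rewrite e0 mul0r => /esym/eqP; rewrite oner_eq0.
by apply: contra p0 => /eqP /vtr.
Qed.

Definition c1 : coef := (0%BZ, 0%N, [:: 1%BZ]).

Lemma c1E : cval c1 = 1.
Proof. by rewrite /cval /= zF1 mulr0 addr0 expr0 invr1 !mulr1. Qed.

(** The low order terms of a power series quotient p / m, for m with constant
    term 1 or -1; whether the division is exact is not tested here. *)
Fixpoint pdivlow (n : nat) (p m : zpoly) : zpoly :=
  match n, p, m with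
  | n'.+1, c :: p', m0 :: m' =>
      let q := (c * m0)%BZ in
      pcons q (pdivlow n' (padd p' (pscale (- q) m')) m)
  | _, _, _ => [::]
  end.

(** A candidate for the quotient c / d. It is exact only if the remaining factor
    of the numerator of d divides that of c, which [solve] checks by multiplying
    back; at most 9 factors 1 + v^2 are cancelled from d. *)
Definition cquo (c d : coef) : coef :=
  let: (e1, b1, p1) := c in let: (e2, b2, p2) := d in
  let bm := ccancel 9 p2 in
  let q := iter b2 (pmul p12) p1 in
  cmk (e1 - e2)%BZ (b1 + (9 - bm.1)) (pdivlow (size q) q bm.2).

End Scalars.

Arguments cval : simpl never.
Arguments copp : simpl never.
Arguments c1 : simpl never.

(** * Normal forms in a skew group ring *)

Definition word := seq nat.
Definition tor : Type := Z * Z * Z.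
Definition mono : Type := word * tor.
(** A sum of terms c w K^k with the word w on the left of the torus element, in
    decreasing order of monomials. *)
Definition poly_ : Type := seq (coef * mono).

Definition tadd (k l : tor) : tor :=
  let: (k0, k1, k2) := k in let: (l0, l1, l2) := l in
  ((k0 + l0)%BZ, (k1 + l1)%BZ, (k2 + l2)%BZ).

Definition tdot (k l : tor) : Z :=
  let: (k0, k1, k2) := k in let: (l0, l1, l2) := l in
  (k0 * l0 + k1 * l1 + k2 * l2)%BZ.

Definition t0 : tor := (0%BZ, 0%BZ, 0%BZ).

Definition tcmp (k l : tor) : comparison :=
  let: (k0, k1, k2) := k in let: (l0, l1, l2) := l in
  match Z.compare k0 l0 with
  | Eq => match Z.compare k1 l1 with Eq => Z.compare k2 l2 | c => c end
  | c => c
  end.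

Fixpoint wlex (u w : word) : comparison :=
  match u, w with
  | [::], [::] => Eq
  | [::], _ => Lt
  | _, [::] => Gt
  | i :: u', j :: w' => match Nat.compare i j with Eq => wlex u' w' | c => c end
  end.

Definition wcmp (u w : word) : comparison :=
  match Nat.compare (size u) (size w) with Eq => wlex u w | c => c end.

Definition mcmp (m n : mono) : comparison :=
  match wcmp m.1 n.1 with Eq => tcmp m.2 n.2 | c => c end.

Lemma wlex_eq u w : wlex u w = Eq -> u = w.
Proof.
elim: u w => [|i u IH] [|j w] //=.
by case E: Nat.compare => // /IH ->; move/Nat.compare_eq_iff: E => ->.
Qed.

Lemma mcmp_eq m n : mcmp m n = Eq -> m = n.
Proof.
case: m n => [u [[k0 k1] k2]] [w [[l0 l1] l2]]; rewrite /mcmp /wcmp /=.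
case: Nat.compare => //; case E: wlex => //; rewrite (wlex_eq E).
case E0: Z.compare => //; case E1: Z.compare => //.
case E2: Z.compare => // _.
by rewrite (Z.compare_eq _ _ E0) (Z.compare_eq _ _ E1) (Z.compare_eq _ _ E2).
Qed.

Fixpoint qadd (f : poly_) : poly_ -> poly_ :=
  fix aux (g : poly_) : poly_ :=
    match f, g with
    | [::], _ => g
    | _, [::] => f
    | (c, m) :: f', (d, n) :: g' =>
        match mcmp m n with
        | Gt => (c, m) :: qadd f' g
        | Lt => (d, n) :: aux g'
        | Eq => let s := cadd c d in
                if czero s then qadd f' g' else (s, m) :: qadd f' g'
        end
    end.

Definition rule : Type := word * poly_.

Fixpoint strip_prefix (u w : word) : option word :=
  match u, w with
  | [::], _ => Some w
  | i :: u', j :: w' => if Nat.eqb i j then strip_prefix u' w' else None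
  | _, [::] => None
  end.

Fixpoint match_rules (rs : seq rule) (w : word) : option (poly_ * word) :=
  if rs is (u, f) :: rs' then
    if strip_prefix u w is Some t then Some (f, t) else match_rules rs' w
  else None.

Fixpoint find_redex (rs : seq rule) (w : word) : option (word * poly_ * word) :=
  match match_rules rs w with
  | Some (f, t) => Some ([::], f, t)
  | None =>
      if w is i :: w' then
        if find_redex rs w' is Some (s, f, t) then Some (i :: s, f, t) else None
      else None
  end.

Section Engine.

Variables (F : fieldType) (v : F) (A : algType F).
Hypothesis vtr : forall p : zpoly, peval v p = 0 -> all (Z.eqb 0) p.

Variables (x : nat -> A) (wt : nat -> tor) (T : tor -> A).

Hypothesis T0 : T t0 = 1.
Hypothesis TD : forall k l, T (tadd k l) = T k * T l.
(* The letters are eigenvectors for conjugation by the torus, with weights wt. *)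
Hypothesis Tx : forall k i,
  T k * x i = zpow v v^-1 (tdot k (wt i)) *: (x i * T k).

Local Notation cv := (cval v).

Fixpoint wval (w : word) : A := if w is i :: w' then x i * wval w' else 1.
Definition mval (m : mono) : A := wval m.1 * T m.2.
Fixpoint qval (f : poly_) : A :=
  if f is t :: f' then cv t.1 *: mval t.2 + qval f' else 0.

Lemma wval_cat u w : wval (u ++ w) = wval u * wval w.
Proof. by elim: u => [|i u IH] /=; rewrite ?mul1r // IH mulrA. Qed.

Lemma qval_cons t f : qval (t :: f) = cv t.1 *: mval t.2 + qval f.
Proof. by []. Qed.

Lemma qaddE f g : qval (qadd f g) = qval f + qval g.
Proof.
elim: f g => [|[c m] f IHf]; first by case=> [|? ?] /=; rewrite ?add0r.
elim=> [|[d n] g IHg]; first by rewrite addr0.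
have -> : qadd ((c, m) :: f) ((d, n) :: g) =
  match mcmp m n with
        | Gt => (c, m) :: qadd f ((d, n) :: g)
        | Lt => (d, n) :: qadd ((c, m) :: f) g
        | Eq => let s := cadd c d in
                if czero s then qadd f g else (s, m) :: qadd f g
        end by [].
case E: mcmp.
- rewrite /= -(mcmp_eq E); case: ifP => [/(czeroE v) s0|_].
    by rewrite IHf addrACA -scalerDl -(caddE vtr) s0 scale0r add0r.
  by rewrite qval_cons /= (caddE vtr) IHf scalerDl addrACA.
- by rewrite qval_cons IHg !qval_cons addrCA.
- by rewrite qval_cons IHf !qval_cons addrA.
Qed.

Definition rule_ok (r : rule) : Prop := wval r.1 = qval r.2.

Fixpoint rules_ok (rs : seq rule) : Prop :=
  if rs is r :: rs' then rule_ok r /\ rules_ok rs' else True.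

Lemma strip_prefixE u w t : strip_prefix u w = Some t -> w = u ++ t.
Proof.
elim: u w => [|i u IH] [|j w] //=; try by case=> ->.
by case: ifP => // /Nat.eqb_eq -> /IH ->.
Qed.

Lemma match_rulesE rs w f t : rules_ok rs -> match_rules rs w = Some (f, t) ->
  wval w = qval f * wval t.
Proof.
elim: rs => [|[u g] rs IH] //= [r0 rs0].
case E: strip_prefix => [s|]; last exact: IH.
by case=> <- <-; rewrite (strip_prefixE E) wval_cat r0.
Qed.

Lemma find_redexE rs w s f t : rules_ok rs ->
  find_redex rs w = Some (s, f, t) -> wval w = wval s * qval f * wval t.
Proof.
move=> rs0; elim: w s f t => [|i w IH] s f t /=.
  case E: match_rules => [[g u]|] // [<- <- <-].
  by rewrite mul1r -(match_rulesE rs0 E).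
case E: match_rules => [[g u]|].
  by case=> <- <- <-; rewrite mul1r -(match_rulesE rs0 E).
case E': find_redex => [[[s' g] u]|] // [<- <- <-].
by rewrite /= (IH _ _ _ E') !mulrA.
Qed.

Fixpoint chi (k : tor) (w : word) : Z :=
  if w is i :: w' then (tdot k (wt i) + chi k w')%BZ else 0%BZ.

Lemma tor_wval k w : T k * wval w = zpow v v^-1 (chi k w) *: (wval w * T k).
Proof.
elim: w => [|i w IH] /=; first by rewrite scale1r mulr1 mul1r.
rewrite mulrA Tx -scalerAl -[x i * T k * _]mulrA IH -scalerAr scalerA mulrA.
by rewrite -(zvD vtr).
Qed.

(** The product c s f t K^k; the torus part of f has to move past t, which
    costs a power of v for each term. *)
Definition sandwich (c : coef) (s : word) (f : poly_) (t : word) (k : tor) :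
  poly_ :=
  [seq (cmul c (cshift (chi p.2.2 t) p.1), (s ++ p.2.1 ++ t, tadd p.2.2 k))
     | p <- f].

Lemma sandwichE c s f t k :
  qval (sandwich c s f t k) = cv c *: (wval s * qval f * wval t * T k).
Proof.
elim: f => [|[d [u l]] f IH] /=; first by rewrite mulr0 !mul0r scaler0.
rewrite IH mulrDr !mulrDl scalerDr; congr (_ + _).
rewrite /mval /= (cmulE vtr) (cshiftE vtr) !wval_cat TD.
have -> : wval s * (cv d *: (wval u * T l)) * wval t * T k =
  (zpow v v^-1 (chi l t) * cv d) *: (wval s * (wval u * wval t) * (T l * T k)).
  rewrite -scalerAr -!scalerAl [zpow _ _ _ * _]mulrC -scalerA; congr (_ *: _).
  rewrite -!mulrA [T l * (wval t * _)]mulrA tor_wval.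
  by rewrite -!scalerAl -!scalerAr -!mulrA.
by rewrite scalerA.
Qed.

(** The number n bounds the steps. Running out of it leaves a polynomial that is
    not reduced, but equal in the algebra, so correctness does not depend on n. *)
Fixpoint nf (rs : seq rule) (n : nat) (f : poly_) : poly_ :=
  match n, f with
  | n'.+1, (c, (w, k)) :: f' =>
      match find_redex rs w with
      | Some (s, g, t) => nf rs n' (qadd f' (sandwich c s g t k))
      | None => (c, (w, k)) :: nf rs n' f'
      end
  | _, _ => f
  end.

Lemma nfE rs n f : rules_ok rs -> qval (nf rs n f) = qval f.
Proof.
move=> rs0; elim: n f => [|n IH] [|[c [w k]] f] //=.
case E: find_redex => [[[s g] t]|]; last by rewrite qval_cons IH.
rewrite IH qaddE sandwichE addrC; congr (_ *: _ + _).
by rewrite /mval /= (find_redexE rs0 E).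
Qed.

Definition lterm (c : coef) (w : word) (k : tor) (g : poly_) : poly_ :=
  [seq (cmul c (cshift (chi k p.2.1) p.1), (w ++ p.2.1, tadd k p.2.2))
     | p <- g].

Lemma ltermE c w k g :
  qval (lterm c w k g) = cv c *: (wval w * T k) * qval g.
Proof.
elim: g => [|[d [u l]] g IH] /=; first by rewrite mulr0.
rewrite IH mulrDr; congr (_ + _).
rewrite /mval /= (cmulE vtr) (cshiftE vtr) !wval_cat TD.
rewrite -scalerAl -scalerA; congr (_ *: _).
rewrite -scalerAr [zpow _ _ _ * _]mulrC -scalerA; congr (_ *: _).
rewrite -!mulrA [T k * (wval u * _)]mulrA tor_wval.
by rewrite -!scalerAl -!scalerAr -!mulrA.
Qed.

Definition mulq (f g : poly_) : poly_ :=
  foldr (fun t a => qadd (lterm t.1 t.2.1 t.2.2 g) a) [::] f.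

Lemma mulqE f g : qval (mulq f g) = qval f * qval g.
Proof.
elim: f => [|[c [w k]] f IH] /=; first by rewrite mul0r.
by rewrite qaddE ltermE IH mulrDl.
Qed.

(** The images of the letters, and those of the three generators of the torus,
    which have to be powers of v times torus elements. *)
Definition endo : Type := seq poly_ * ((Z * tor) * (Z * tor) * (Z * tor)).

Definition tscale (n : Z) (k : tor) : tor :=
  let: (k0, k1, k2) := k in ((n * k0)%BZ, (n * k1)%BZ, (n * k2)%BZ).

Definition etor (h : endo) (k : tor) : Z * tor :=
  let: ((e0, r0), (e1, r1), (e2, r2)) := h.2 in let: (k0, k1, k2) := k in
  (tdot (e0, e1, e2) k,
   tadd (tscale k0 r0) (tadd (tscale k1 r1) (tscale k2 r2))).

Definition endo_ok (h : endo) (f : A -> A) : Prop :=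
  (forall i, f (x i) = qval (nth [::] h.1 i)) /\
  (forall k, f (T k) = zpow v v^-1 (etor h k).1 *: T (etor h k).2).

Variables (rs : seq rule) (fuel : nat).

Definition hword (h : endo) (w : word) : poly_ :=
  foldl (fun a i => nf rs fuel (mulq a (nth [::] h.1 i))) [:: (c1, ([::], t0))] w.

Definition happ (h : endo) (f : poly_) : poly_ :=
  foldr (fun t a => qadd (mulq (hword h t.2.1)
       [:: (cshift (etor h t.2.2).1 t.1, ([::], (etor h t.2.2).2))]) a) [::] f.

Lemma happE h (f : {lrmorphism A -> A}) p : rules_ok rs -> endo_ok h f ->
  qval (happ h p) = f (qval p).
Proof.
move=> rs0 [fx fT].
have q1 : qval [:: (c1, ([::], t0))] = 1.
  by rewrite /= /mval /= T0 mulr1 (c1E v) scale1r addr0.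
have hE w : qval (hword h w) = f (wval w).
  rewrite /hword -[RHS]mul1r -[in RHS]q1.
  elim: w [:: _] => [|i w IH] a /=; first by rewrite rmorph1 mulr1.
  by rewrite IH (nfE _ _ rs0) mulqE rmorphM /= fx mulrA.
elim: p => [|[c [w k]] p IH] /=; first by rewrite rmorph0.
rewrite qaddE mulqE hE IH rmorphD /= linearZ /= rmorphM /= fT.
rewrite /mval /= mul1r addr0 (cshiftE vtr); congr (_ + _).
by rewrite -!scalerAr scalerA mulrC.
Qed.

Inductive scal :=
| SV | SInv | SPow of nat | SInvPow of nat | S0 | S1 | SHalf
| SAdd of scal & scal | SMul of scal & scal | SOpp of scal.

Inductive expr :=
| EX of nat | ET of tor | E0 | E1 | EScale of scal & expr | EOpp of expr
| EAdd of expr & expr | EMul of expr & expr | EHom of nat & expr.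

Fixpoint seval (s : scal) : F :=
  match s with
  | SV => v
  | SInv => v^-1
  | SPow n => v ^+ n
  | SInvPow n => v ^- n
  | S0 => 0
  | S1 => 1
  | SHalf => (v + v^-1)^-1
  | SAdd s1 s2 => seval s1 + seval s2
  | SMul s1 s2 => seval s1 * seval s2
  | SOpp s1 => - seval s1
  end.

Fixpoint snorm (s : scal) : coef :=
  match s with
  | SV => (1%BZ, 0%N, [:: 1%BZ])
  | SInv => ((-1)%BZ, 0%N, [:: 1%BZ])
  | SPow n => (Z.of_nat n, 0%N, [:: 1%BZ])
  | SInvPow n => ((- Z.of_nat n)%BZ, 0%N, [:: 1%BZ])
  | S0 => (0%BZ, 0%N, [::])
  | S1 => c1
  | SHalf => (1%BZ, 1%N, [:: 1%BZ])
  | SAdd s1 s2 => cadd (snorm s1) (snorm s2)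
  | SMul s1 s2 => cmul (snorm s1) (snorm s2)
  | SOpp s1 => copp (snorm s1)
  end.

Lemma snormE s : cv (snorm s) = seval s.
Proof.
have v0 := v_neq0 vtr; have d0 := d12_neq0 vtr.
have E e b : cv (e, b, [:: 1%BZ]) = zpow v v^-1 e / (1 + v ^+ 2) ^+ b.
  by rewrite /cval /= zF1 mulr0 addr0 mulr1.
elim: s => [||n|n||||s1 IH1 s2 IH2|s1 IH1 s2 IH2|s IH].
- by rewrite E expr0 divr1.
- by rewrite E expr0 divr1.
- by rewrite E zpow_nat expr0 divr1.
- by rewrite E zpow_opp_nat expr0 divr1 /= exprVn.
- by rewrite (czeroE v).
- exact: c1E.
- rewrite E /= !expr1; have d0' : v + v^-1 != 0.
    by apply: contra d0 => /eqP e; rewrite -(mulfV v0) -mulrDr addrC e mulr0.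
  by field; rewrite v0 -expr2 addrC.
- by rewrite /= (caddE vtr) IH1 IH2.
- by rewrite /= (cmulE vtr) IH1 IH2.
- by rewrite /= (coppE v) IH.
Qed.

Variables (hs : seq endo) (fs : nat -> {lrmorphism A -> A}).

Fixpoint eval (e : expr) : A :=
  match e with
  | EX i => x i
  | ET k => T k
  | E0 => 0
  | E1 => 1
  | EScale s e1 => seval s *: eval e1
  | EOpp e1 => - eval e1
  | EAdd e1 e2 => eval e1 + eval e2
  | EMul e1 e2 => eval e1 * eval e2
  | EHom i e1 => fs i (eval e1)
  end.

Definition qscale (c : coef) (f : poly_) : poly_ :=
  [seq (cmul c t.1, t.2) | t <- f].

Lemma qscaleE c f : qval (qscale c f) = cv c *: qval f.
Proof.
elim: f => [|[d m] f IH] /=; first by rewrite scaler0.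
by rewrite (cmulE vtr) IH scalerDr scalerA.
Qed.

Fixpoint norm (e : expr) : poly_ :=
  match e with
  | EX i => [:: (c1, ([:: i], t0))]
  | ET k => [:: (c1, ([::], k))]
  | E0 => [::]
  | E1 => [:: (c1, ([::], t0))]
  | EScale s e1 => qscale (snorm s) (norm e1)
  | EOpp e1 => qscale (copp c1) (norm e1)
  | EAdd e1 e2 => qadd (norm e1) (norm e2)
  | EMul e1 e2 => nf rs fuel (mulq (norm e1) (norm e2))
  | EHom i e1 => happ (nth ([::], (0%BZ, t0, (0%BZ, t0), (0%BZ, t0))) hs i) (norm e1)
  end.

Fixpoint endos_ok (n : nat) (l : seq endo) : Prop :=
  if l is h :: l' then endo_ok h (fs n) /\ endos_ok n.+1 l' else True.

Fixpoint wf (e : expr) : bool :=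
  match e with
  | EAdd e1 e2 | EMul e1 e2 => wf e1 && wf e2
  | EHom i e1 => (i < size hs)%N && wf e1
  | EScale _ e1 | EOpp e1 => wf e1
  | _ => true
  end.

Lemma normE e : rules_ok rs -> endos_ok 0 hs -> wf e -> qval (norm e) = eval e.
Proof.
move=> rs0 hs0.
elim: e => [i|k|||s e IH|e IH|e1 IH1 e2 IH2|e1 IH1 e2 IH2|i e IH] /=.
- by rewrite /mval /= T0 !mulr1 (c1E v) scale1r addr0.
- by rewrite /mval /= mul1r (c1E v) scale1r addr0.
- by [].
- by rewrite /mval /= T0 !mulr1 (c1E v) scale1r addr0.
- by move=> /IH {}IH; rewrite qscaleE snormE IH.
- by move=> /IH {}IH; rewrite qscaleE (coppE v) (c1E v) scaleN1r IH.
- by case/andP=> /IH1 {}IH1 /IH2 {}IH2; rewrite qaddE IH1 IH2.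
- by case/andP=> /IH1 {}IH1 /IH2 {}IH2; rewrite nfE // mulqE IH1 IH2.
- case/andP=> lt_i /IH {}IH; rewrite -IH; apply: happE => //.
  have ok n l : endos_ok n l -> forall j, (j < size l)%N ->
    endo_ok (nth ([::], (0%BZ, t0, (0%BZ, t0), (0%BZ, t0))) l j) (fs (n + j)).
    elim: l n => [|h l IHl] n //= [h0 l0] [|j] lt_j; rewrite ?addn0 //=.
    by rewrite addnS -addSn; apply: IHl.
  exact: (ok 0%N).
Qed.

(** A negative answer says nothing: the rules need not be confluent. *)
Definition decide (e1 e2 : expr) : bool :=
  wf e1 && wf e2 && all (fun t => czero t.1) (norm (EAdd e1 (EOpp e2))).

Lemma decideE e1 e2 : rules_ok rs -> endos_ok 0 hs -> decide e1 e2 ->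
  eval e1 = eval e2.
Proof.
move=> rs0 hs0 /andP[/andP[wf1 wf2] n0].
have : qval (norm (EAdd e1 (EOpp e2))) = 0.
  elim: norm n0 => //= t f IH /andP[/(czeroE v) -> /IH ->].
  by rewrite scale0r addr0.
by rewrite normE /= ?wf1 ?wf2 // => /subr0_eq.
Qed.

(** The word in which the rules i and j overlap along n letters reduces in two
    ways; the difference of the results is zero in the algebra. *)
Definition overlap (l : seq rule) (h : nat * nat * nat) : poly_ :=
  let: (i, j, n) := h in
  match onth l i, onth l j with
  | Some (u, f), Some (w, g) =>
      if drop (size u - n) u == take n w then
        nf l fuel (qadd (sandwich c1 [::] f (drop n w) t0)
          (sandwich (copp c1) (take (size u - n) u) g [::] t0))
      else [::]
  | _, _ => [::]
  end.

Lemma overlapE l h : rules_ok l -> qval (overlap l h) = 0.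
Proof.
move=> l0; case: h => [[i j] n]; rewrite /overlap.
have ok m k r : rules_ok m -> onth m k = Some r -> rule_ok r.
  elim: m k => [|r' m IH] [|k] //= [r0 m0]; last exact: IH.
  by case=> <-.
case Ei: onth => [[u f]|] //; case Ej: onth => [[w g]|] //.
case: eqP => // uw; rewrite nfE // qaddE !sandwichE T0 (coppE v) (c1E v).
rewrite scale1r scaleN1r /= mul1r !mulr1.
rewrite -(ok _ _ _ l0 Ei) -(ok _ _ _ l0 Ej) /=.
have -> : wval u * wval (drop n w) = wval (take (size u - n) u) * wval w.
  rewrite -!wval_cat -[u in LHS](cat_take_drop (size u - n) u) uw.
  by rewrite -catA cat_take_drop.
by rewrite subrr.
Qed.

(** The relation f = 0, solved for its leading word. Multiplying the solution
    back guards against an inexact division of scalars. *)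
Definition solve (f : poly_) : option rule :=
  if f is (c, (w, (Z0, Z0, Z0))) :: f' then
    let g := [seq (copp (cquo t.1 c), t.2) | t <- f'] in
    if ~~ czero c && nilp (qadd f' (sandwich c [::] g [::] t0)) then Some (w, g)
    else None
  else None.

Lemma solveE f r : solve f = Some r -> qval f = 0 -> rule_ok r.
Proof.
case: f => [|[c [w [[[|?|?] [|?|?]] [|?|?]]]] f] //=.
set g := map _ _; case: ifP => // /andP[c0 /nilP n0] [<-] /=.
have := qaddE f (sandwich c [::] g [::] t0).
rewrite n0 sandwichE /= T0 mul1r !mulr1 => /esym/eqP.
rewrite addr_eq0 => /eqP ->; rewrite /mval /= -/t0 T0 mulr1 -scalerBr => /eqP.
rewrite scaler_eq0 (negbTE (cval_neq0 vtr c0)) /= subr_eq0 => /eqP.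
exact.
Qed.

Fixpoint derive (l : seq rule) (hints : seq (nat * nat * nat)) : seq rule :=
  if hints is h :: hints' then
    if solve (overlap l h) is Some r then derive (rcons l r) hints'
    else derive l hints'
  else l.

(** Completion never adds a false rule, whichever overlaps are listed. *)
Lemma derive_ok l hints : rules_ok l -> rules_ok (derive l hints).
Proof.
elim: hints l => [|h hints IH] l //= l0.
case E: solve => [r|]; apply: IH => //.
have := solveE E (overlapE h l0).
by elim: l l0 {E} => [|r' l IHl] //= [? ?] r0; split; auto.
Qed.

End Engine.

(** * Identities over a central invertible element *)

Section FreeIdentities.

Variables (F : fieldType) (v : F) (A : algType F).
Hypothesis vtr : forall p : zpoly, peval v p = 0 -> all (Z.eqb 0) p.
Variables (C Ci : A) (xs : seq A).
Hypotheses (CCi : C * Ci = 1) (CiC : Ci * C = 1).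

Fixpoint all_comm (l : seq A) : Prop :=
  if l is a :: l' then C * a = a * C /\ all_comm l' else True.

Hypothesis Cxs : all_comm xs.

(** A central C is a torus of rank one acting trivially. *)
Definition ncT (k : tor) : A := zpow C Ci k.1.1.
Definition ncx (i : nat) : A := nth 0 xs i.

Lemma ncTx k i : ncT k * ncx i = zpow v v^-1 (tdot k t0) *: (ncx i * ncT k).
Proof.
have CE : C * ncx i = ncx i * C.
  rewrite /ncx; elim: xs i Cxs => [|a l IH] [|i] //=; rewrite ?mulr0 ?mul0r //.
    by case.
  by case=> _ /IH.
have CiE : Ci * ncx i = ncx i * Ci.
  by rewrite -[LHS]mulr1 -CCi -mulrA (mulrA _ C) -CE !mulrA CiC mul1r.
have -> : tdot k t0 = 0%BZ by case: k => [[? ?] ?]; rewrite /= !Z.mul_0_r.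
rewrite scale1r /ncT; case: k.1.1 => [|p|p] /=; first by rewrite mulr1 mul1r.
  exact/esym/commrX/esym.
exact/esym/commrX/esym.
Qed.

Definition nc_rules (eqs : seq (word * expr)) : seq rule :=
  [seq (p.1, norm (fun=> t0) [::] 0 [::] p.2) | p <- eqs].

(** Associated to the left, like the products to be reified. *)
Definition wprod (w : word) : A :=
  if w is i :: w' then foldl (fun a j => a * ncx j) (ncx i) w' else 1.

Lemma wprodE w : wprod w = wval ncx w.
Proof.
case: w => //= i w; elim: w (ncx i) => [|j w IH] a /=; first by rewrite mulr1.
by rewrite IH mulrA.
Qed.

Fixpoint eqs_ok (eqs : seq (word * expr)) : Prop :=
  if eqs is p :: eqs' then
    wprod p.1 = eval v ncx ncT (fun=> idfun) p.2 /\ eqs_ok eqs'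
  else True.

Lemma nc_sound eqs n e1 e2 : eqs_ok eqs ->
  all (fun p => wf [::] p.2) eqs ->
  decide (fun=> t0) (nc_rules eqs) n [::] e1 e2 ->
  eval v ncx ncT (fun=> idfun) e1 = eval v ncx ncT (fun=> idfun) e2.
Proof.
move=> eqs0 wfs; apply: decideE => //; rewrite ?/ncT //.
- by move=> [[? ?] ?] [[? ?] ?]; apply: zpowD.
- exact: ncTx.
elim: eqs eqs0 wfs => [|[w e] eqs IH] //= [we eqs0] /andP[wf1 wfs].
split; last exact: IH.
rewrite /rule_ok /= -wprodE we; symmetry; apply: normE => //.
- by move=> [[? ?] ?] [[? ?] ?]; apply: zpowD.
- exact: ncTx.
Qed.

End FreeIdentities.

(* The indices of a family are integers such as l - 1 + 1, so members of a
   family are compared up to conversion of their indices. *)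
Ltac same_atom x y :=
  first
  [ constr_eq x y
  | lazymatch x with ?f ?i => lazymatch y with f ?j => unify i j end end
  | lazymatch x with ?f ?i ?k => lazymatch y with f ?j ?l =>
      unify i j; unify k l end end ].

Ltac mem_atom x xs :=
  lazymatch xs with
  | @nil _ => constr:(false)
  | @cons _ ?y ?r =>
      match constr:(Set) with
      | _ => let _ := match constr:(Set) with _ => same_atom x y end in
             constr:(true)
      | _ => mem_atom x r
      end
  end.

Ltac add_atom x xs :=
  let b := mem_atom x xs in
  lazymatch b with true => xs | false => constr:(rcons xs x) end.

Ltac atom_index x xs :=
  lazymatch xs with
  | @cons _ ?y ?r =>
      match constr:(Set) with
      | _ => let _ := match constr:(Set) with _ => same_atom x y end in
             constr:(0%N)
      | _ => let n := atom_index x r in constr:(S n)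
      end
  end.

Ltac reify_scal v t :=
  lazymatch t with
  | v => constr:(SV)
  | v^-1 => constr:(SInv)
  | v ^+ ?n => constr:(SPow n)
  | (v ^+ ?n)^-1 => constr:(SInvPow n)
  | (v + v^-1)^-1 => constr:(SHalf)
  | 1 => constr:(S1)
  | 0 => constr:(S0)
  | ?a + ?b => let a' := reify_scal v a in let b' := reify_scal v b in
      constr:(SAdd a' b')
  | ?a * ?b => let a' := reify_scal v a in let b' := reify_scal v b in
      constr:(SMul a' b')
  | - ?a => let a' := reify_scal v a in constr:(SOpp a')
  end.

(* The table ts maps elements to their torus exponents; it is a nest of pairs
   ended by tt. *)
Ltac tor_lookup t ts :=
  lazymatch ts with
  | (t, ?k, _) => constr:(Some k)
  | (_, _, ?r) => tor_lookup t r
  | tt => constr:(@None tor)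
  end.

Ltac atoms ts t xs :=
  lazymatch t with
  | 0 => xs
  | 1 => xs
  | ?a + ?b => let ys := atoms ts a xs in atoms ts b ys
  | ?a * ?b => let ys := atoms ts a xs in atoms ts b ys
  | - ?a => atoms ts a xs
  | _ *: ?a => atoms ts a xs
  | _ => let k := tor_lookup t ts in
      lazymatch k with
      | Some _ => xs
      | None => let ys := add_atom t xs in eval cbv [rcons] in ys
      end
  end.

Ltac reify v ts xs t :=
  lazymatch t with
  | 0 => constr:(E0)
  | 1 => constr:(E1)
  | ?a + ?b => let a' := reify v ts xs a in let b' := reify v ts xs b in
      constr:(EAdd a' b')
  | ?a * ?b => let a' := reify v ts xs a in let b' := reify v ts xs b in
      constr:(EMul a' b')
  | - ?a => let a' := reify v ts xs a in constr:(EOpp a')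
  | ?s *: ?a => let s' := reify_scal v s in let a' := reify v ts xs a in
      constr:(EScale s' a')
  | _ => let k := tor_lookup t ts in
      lazymatch k with
      | Some ?k => constr:(ET k)
      | None => let n := atom_index t xs in constr:(EX n)
      end
  end.

Ltac reify_word xs t :=
  lazymatch t with
  | ?a * ?b => let a' := reify_word xs a in let b' := reify_word xs b in
      eval cbv [cat] in (a' ++ b')
  | _ => let n := atom_index t xs in constr:([:: n])
  end.

Ltac eqs_atoms ts P xs :=
  lazymatch P with
  | (?l = ?r) /\ ?Q => let ys := atoms ts l xs in let zs := atoms ts r ys in
      eqs_atoms ts Q zs
  | True => xs
  end.

Ltac reify_eqs v ts xs P :=
  lazymatch P with
  | (?l = ?r) /\ ?Q =>
      let w := reify_word xs l in let e := reify v ts xs r in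
      let q := reify_eqs v ts xs Q in constr:((w, e) :: q)
  | True => constr:(@nil (word * expr))
  end.

(** Proves an identity between noncommutative polynomials in xs and a central
    invertible C, after rewriting by eqs. The letters of xs come first in the
    order of monomials, and further ones are added as they are met. *)
Ltac nc vtr CCi CiC xs eqs commtac :=
  let TC := type of CCi in
  let TV := type of vtr in
  lazymatch TC with
  | ?C * ?Ci = _ =>
    lazymatch TV with
    | forall p, peval ?v p = _ -> _ =>
      let ts := constr:((C, (1%BZ, 0%BZ, 0%BZ), (Ci, ((-1)%BZ, 0%BZ, 0%BZ), tt))) in
      let P := type of eqs in
      lazymatch goal with
      | |- ?l = ?r =>
        let ys := eqs_atoms ts P xs in
        let ys := atoms ts l ys in
        let ys := atoms ts r ys in
        let q := reify_eqs v ts ys P in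
        let e1 := reify v ts ys l in
        let e2 := reify v ts ys r in
        refine (@nc_sound _ v _ vtr C Ci ys CCi CiC _ q (100 * 10)%N e1 e2 eqs _ _);
        [ commtac | vm_compute; reflexivity | vm_compute; reflexivity ]
      end
    end
  end.

(** * Logarithmic derivatives of intertwining series *)

Section LogDerivative.

Variables (F : fieldType) (A : algType F) (th : nat -> A).
Hypothesis th0 : th 0 = 1.

Fixpoint logd_seq (n : nat) : seq A :=
  if n is m.+1 then
    rcons (logd_seq m)
      (th m *+ m - \sum_(j < m) (logd_seq m)`_j * th (m - j))
  else [::].

(** The coefficients h_n of h = (z d/dz theta) theta^-1, for theta the series
    with coefficients th and constant term 1. *)
Definition logd (n : nat) : A := (logd_seq n.+1)`_n.

Lemma size_logd_seq n : size (logd_seq n) = n.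
Proof. by elim: n => //= n IH; rewrite size_rcons IH. Qed.

Lemma nth_logd_seq n j : (j < n)%N -> (logd_seq n)`_j = logd j.
Proof.
elim: n => // n IH; rewrite ltnS leq_eqVlt => /predU1P[->//|lt_jn].
by rewrite /= nth_rcons size_logd_seq lt_jn IH.
Qed.

Lemma logdE n : logd n = th n *+ n - \sum_(j < n) logd j * th (n - j).
Proof.
rewrite /logd /= nth_rcons size_logd_seq ltnn eqxx; congr (_ - _).
by apply: eq_bigr => j _; rewrite nth_logd_seq.
Qed.

Lemma logd0 : logd 0 = 0.
Proof. by rewrite logdE big_ord0 mulr0n subr0. Qed.

Lemma logd_sum n : \sum_(j < n.+1) logd j * th (n - j) = th n *+ n.
Proof. by rewrite big_ord_recr /= subnn th0 mulr1 [logd n]logdE addrC subrK. Qed.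

Lemma logd_comm x n : (forall j, (j <= n)%N -> x * th j = th j * x) ->
  x * logd n = logd n * x.
Proof.
elim/ltn_ind: n => n IH xth; rewrite logdE mulrBr mulrBl mulrnAr mulrnAl xth //.
congr (_ - _); rewrite mulr_sumr mulr_suml; apply: eq_bigr => j _.
rewrite mulrA IH // -?mulrA ?xth ?leq_subr //.
by move=> k le_k; apply: xth; apply: leq_trans le_k (ltnW _).
Qed.

Variables (C : A) (a : int -> A) (s t s' t' : F) (N : nat).

Local Notation "u *! p" := ((u%:A)%:P * p) (at level 40).

(** The operator (1 - s z S) (1 - t C z S^-1) on families of polynomials in z,
    with S the shift of the index of the family. *)
Definition quadop (s t : F) (f : int -> {poly A}) (q : int) : {poly A} :=
  f q - s *! ('X * f (q + 1)) - t *! (C%:P * ('X * f (q - 1)))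
  + (s * t) *! (C%:P * ('X^2 * f q)).

(** Equality of power series up to z^N. *)
Definition eqN (p r : {poly A}) : Prop := forall i, (i <= N)%N -> p`_i = r`_i.

Lemma eqN_mull p r u : eqN p r -> eqN (u * p) (u * r).
Proof.
move=> pr i le_i; rewrite !coefM; apply: eq_bigr => j _.
by rewrite pr // (leq_trans (leq_subr _ _)).
Qed.

Lemma eqN_mulr p r u : eqN p r -> eqN (p * u) (r * u).
Proof.
move=> pr i le_i; rewrite !coefM; apply: eq_bigr => j _.
by rewrite pr // (leq_trans _ le_i) // -ltnS.
Qed.

Lemma eqN_deriv p r : eqN p r -> eqN ('X * p^`()) ('X * r^`()).
Proof.
move=> pr [|i] le_i; rewrite !coefXM //= !coef_deriv pr //.
Qed.

Let ac (q : int) : {poly A} := (a q)%:P.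

(** The family obtained by applying z d/dz log of the operator
    (1 - s z S) (1 - t C z S^-1) to a, truncated after z^N. *)
Definition geo (s t : F) (q : int) : {poly A} :=
  \poly_(n < N.+1) (if n == 0%N then 0 else
     - (s ^+ n *: a (q + n%:Z) + t ^+ n *: (C ^+ n * a (q - n%:Z)))).

Lemma coef_quadop u w f q i : (quadop u w f q)`_i =
  (f q)`_i - u *: (if i is j.+1 then (f (q + 1))`_j else 0)
  - w *: (C * (if i is j.+1 then (f (q - 1))`_j else 0))
  + (u * w) *: (C * (if i is j.+2 then (f q)`_j else 0)).
Proof.
rewrite /quadop coefD !coefB !coefCM !mulr_algl !coefXM coefXnM.
by case: i => [|[|i]] //=; rewrite subn2.
Qed.

(** Both sides are z d/dz of the operator, applied to a. *)
Lemma quadop_geo u w q :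
  eqN (quadop u w (geo u w) q) ('X * (quadop u w ac q)^`()).
Proof.
move=> i le_i; rewrite coef_quadop coefXM.
have gE r k : (k <= N)%N -> (geo u w r)`_k = if k == 0%N then 0 else
     - (u ^+ k *: a (r + k%:Z) + w ^+ k *: (C ^+ k * a (r - k%:Z))).
  by move=> le_k; rewrite /geo coef_poly ltnS le_k.
case: i le_i => [|i] le_i; first by rewrite gE //= !mulr0 !scaler0 !subr0 addr0.
rewrite coef_deriv coef_quadop !gE ?(ltnW le_i) //=.
rewrite /ac !coefC /=.
have Zmul (x y : F) (z : A) : x *: (C * (y *: z)) = (x * y) *: (C * z).
  by rewrite -scalerAr scalerA.
case: i le_i => [|[|i]] le_i /=.
- by rewrite !(mulr0, scaler0, subr0, addr0) sub0r !expr1 mulr1n opprD.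
- rewrite !(mulr0, scaler0, sub0r, subr0, oppr0, add0r, addr0, expr1).
  rewrite !mulrN !scalerN !opprK mulrDr !scalerDr !Zmul !scalerA -expr2.
  have -> : q + 1 + 1%:Z = q + 2%:Z by lia.
  have -> : q + 1 - 1%:Z = q by lia.
  have -> : q - 1 + 1%:Z = q by lia.
  have -> : q - 1 - 1%:Z = q - 2%:Z by lia.
  rewrite mulrA -!expr2 mulr2n [w * u]mulrC coefC /=.
  set x := _ *: a (q + _); set y := _ *: (C * a q).
  set z := _ *: (_ * a (q - _)).
  rewrite opprD [- x - z + _]addrACA addNr add0r [y + z]addrC addrACA addNr add0r.
  by rewrite gE // mulr0 scaler0 addr0.
- rewrite gE ?(leq_trans _ le_i) //=.
  rewrite !coefC !mulr0 !scaler0 !subr0 addr0 mul0rn !mulrN !scalerN !opprK !mulrDr !scalerDr !Zmul !scalerA.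
  have -> : q + 1 + i.+2%:Z = q + i.+3%:Z by lia.
  have -> : q + 1 - i.+2%:Z = q - i.+1%:Z by lia.
  have -> : q - 1 + i.+2%:Z = q + i.+1%:Z by lia.
  have -> : q - 1 - i.+2%:Z = q - i.+3%:Z by lia.
  rewrite ![C * (C ^+ _ * _)]mulrA -!exprS [w * u ^+ _]mulrC.
  rewrite -[u * w * w ^+ _]mulrA -exprS [u * w * _]mulrAC -exprS.
  set x := _ *: a _; set z := _ *: (_ * a _); set y1 := _ *: (_ * a _).
  set y2 := _ *: (_ * a _).
  rewrite opprD [- x - z + _]addrACA addNr add0r [y2 + z]addrC addrACA addNr.
  by rewrite add0r [y2 + y1]addrC subrr.
by lia.
Qed.

Hypothesis Cth : forall j, C * th j = th j * C.
Hypothesis Ca : forall q, C * a q = a q * C.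

Let Th : {poly A} := \poly_(i < N.+1) th i.
Let H : {poly A} := \poly_(i < N.+1) logd i.

(** Multiplication by theta exchanges the operators of parameters (s, t) and
    (s', t'). *)
Definition intertwined (f : int -> {poly A}) : Prop :=
  forall q, eqN (Th * quadop s t f q) (quadop s' t' f q * Th).

Lemma eqND p r p' r' : eqN p r -> eqN p' r' -> eqN (p + p') (r + r').
Proof. by move=> e e' i le_i; rewrite !coefD e ?e'. Qed.

Lemma eqN_trans p r u : eqN p r -> eqN r u -> eqN p u.
Proof. by move=> e e' i le_i; rewrite e ?e'. Qed.

Lemma eqN_sym p r : eqN p r -> eqN r p.
Proof. by move=> e i le_i; rewrite e. Qed.

Lemma polyXC (p : {poly A}) : 'X * p = p * 'X.
Proof. exact/esym/commr_polyX. Qed.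

Lemma algPC (u : F) (p : {poly A}) : u *! p = p * (u%:A)%:P.
Proof.
by apply/polyP=> i; rewrite coefCM coefMC mulr_algl mulr_algr.
Qed.

Lemma CThC : C%:P * Th = Th * C%:P.
Proof.
apply/polyP=> i; rewrite coefCM coefMC coef_poly.
by case: ifP; rewrite ?mulr0 ?mul0r.
Qed.

Lemma CHC : C%:P * H = H * C%:P.
Proof.
apply/polyP=> i; rewrite coefCM coefMC coef_poly.
case: ifP; rewrite ?mulr0 ?mul0r // => _.
exact/logd_comm.
Qed.

Lemma quadopD u w f g q :
  quadop u w (fun q => f q + g q) q = quadop u w f q + quadop u w g q.
Proof.
have E (x y x1 y1 x2 y2 x3 y3 : {poly A}) :
    x + y - (x1 + y1) - (x2 + y2) + (x3 + y3)
    = (x - x1 - x2 + x3) + (y - y1 - y2 + y3).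
  by rewrite !opprD (addrACA x) (addrACA (x - x1)) (addrACA (x - x1 - x2)).
by rewrite /quadop !mulrDr E.
Qed.

Lemma quadop_mull u w c f q : C%:P * c = c * C%:P ->
  quadop u w (fun q => c * f q) q = c * quadop u w f q.
Proof.
move=> Cc.
have hX g : 'X * (c * g) = c * ('X * g) by rewrite !mulrA polyXC.
have hX2 g : 'X^2 * (c * g) = c * ('X^2 * g) by rewrite expr2 -!mulrA !hX.
have hC g : C%:P * (c * g) = c * (C%:P * g) by rewrite !mulrA Cc.
have hu z g : z *! (c * g) = c * (z *! g) by rewrite mulrA algPC -mulrA.
by rewrite /quadop !(hX, hX2) !hC !hu -!mulrBr -mulrDr.
Qed.

Lemma quadop_mulr u w c f q :
  quadop u w (fun q => f q * c) q = quadop u w f q * c.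
Proof. by rewrite /quadop !mulrDl !mulNr !mulrA. Qed.

Lemma quadop_shift u w f q r :
  quadop u w (fun q => f (q + r)) q = quadop u w f (q + r).
Proof.
rewrite /quadop; have -> : q + 1 + r = q + r + 1 by lia.
by have -> : q - 1 + r = q + r - 1 by lia.
Qed.

Lemma intertwinedD f g : intertwined f -> intertwined g ->
  intertwined (fun q => f q + g q).
Proof.
move=> If Ig q; rewrite !quadopD mulrDr mulrDl.
by apply: eqND; [exact: If | exact: Ig].
Qed.

Lemma intertwinedM c f : C%:P * c = c * C%:P -> Th * c = c * Th ->
  intertwined f -> intertwined (fun q => c * f q).
Proof.
move=> Cc Tc If q; rewrite !quadop_mull // mulrA Tc -!mulrA.
exact/eqN_mull/If.
Qed.

Lemma intertwined_coef :
  (forall q, th 1 * a q - s *: a (q + 1) - t *: (C * a (q - 1))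
     = a q * th 1 - s' *: a (q + 1) - t' *: (C * a (q - 1))) ->
  (forall n, (n.+2 <= N)%N -> forall q,
     th n.+2 * a q - s *: (th n.+1 * a (q + 1)) - t *: (C * (th n.+1 * a (q - 1)))
     + (s * t) *: (C * (th n * a q))
     = a q * th n.+2 - s' *: (a (q + 1) * th n.+1)
       - t' *: (C * (a (q - 1) * th n.+1)) + (s' * t') *: (C * (a q * th n))) ->
  intertwined ac.
Proof.
move=> r1 r2 q i le_i.
have E1 : Th * quadop s t ac q = quadop s t (fun q => Th * ac q) q.
  by rewrite quadop_mull // CThC.
rewrite E1 -quadop_mulr !coef_quadop.
have cE r j : (j <= N)%N -> (Th * ac r)`_j = th j * a r.
  by move=> le_j; rewrite coefMC coef_poly ltnS le_j.
have cE' r j : (j <= N)%N -> (ac r * Th)`_j = a r * th j.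
  by move=> le_j; rewrite coefCM coef_poly ltnS le_j.
case: i le_i => [|[|i]] le_i.
- by rewrite cE // cE' // th0 !(mulr0, scaler0, subr0, addr0) mulr1 mul1r.
- rewrite !cE ?(ltnW le_i) // !cE' ?(ltnW le_i) // th0.
  by rewrite !(mulr0, scaler0, subr0, addr0) !mul1r !mulr1.
rewrite !cE ?(ltnW le_i) ?(ltnW (ltnW le_i)) //.
by rewrite !cE' ?(ltnW le_i) ?(ltnW (ltnW le_i)) //; apply: r2.
Qed.

Hypothesis rel : intertwined ac.

Lemma intertwined0 : intertwined (fun=> 0).
Proof. by move=> q; rewrite /quadop !mulr0 !subr0 !addr0 mulr0 mul0r. Qed.

(** The exchange relation is linear and invariant under shifts of the index, and
    the family geo is a combination of shifts of a. *)
Lemma intertwined_geo u w : intertwined (geo u w).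
Proof.
pose g n (q : int) : {poly A} := if n == 0%N then 0 else
  (- u ^+ n) *! ('X^n * ac (q + n%:Z))
  + (- w ^+ n) *! ((C ^+ n)%:P * ('X^n * ac (q - n%:Z))).
have gE q : geo u w q = \sum_(n < N.+1) g n q.
  rewrite /geo poly_def; apply: eq_bigr => n _; rewrite /g.
  case: eqP => _; first by rewrite scale0r.
  apply/polyP=> i; rewrite coefZ coefD !coefCM !coefXnM !mulr_algl coefXn /ac.
  case: (ltngtP i n) => [lt|gt|->] /=.
  - by rewrite !mulr0 !scaler0 addr0.
  - by rewrite !coefC subn_eq0 leqNgt gt /= !mulr0 !scaler0 addr0.
  by rewrite subnn !coefC !eqxx mulr1 !scaleNr opprD.
have -> : geo u w = fun q => \sum_(n < N.+1) g n q.
  by apply: boolp.funext.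
elim: N.+1 => [|m IH].
  have -> : (fun q => \sum_(n < 0) g n q) = fun=> 0.
    by apply: boolp.funext => q; rewrite big_ord0.
  exact: intertwined0.
have -> : (fun q => \sum_(n < m.+1) g n q) =
    (fun q => \sum_(n < m) g n q + g m q).
  by apply: boolp.funext => q; rewrite big_ord_recr.
apply: intertwinedD => //; rewrite /g; case: eqP => _; first exact: intertwined0.
have algC z p : p * (z%:A)%:P = z *! p :> {poly A} by rewrite algPC.
have XnC (p : {poly A}) : p * 'X^m = 'X^m * p.
  exact/commr_polyXn.
have CmC : C%:P * (C ^+ m)%:P = (C ^+ m)%:P * C%:P :> {poly A}.
  by rewrite -!polyCM -exprS -exprSr.
have CmTh : Th * (C ^+ m)%:P = (C ^+ m)%:P * Th.
  rewrite polyC_exp; apply/commrX; exact/esym/CThC.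
have sh r : intertwined (fun q => ac (q + r)).
  by move=> q; rewrite !quadop_shift; apply: rel.
apply: intertwinedD.
  apply: intertwinedM; rewrite ?algC //.
  by apply: intertwinedM; rewrite ?XnC //; apply: sh.
apply: intertwinedM; rewrite ?algC //.
by do 2 (apply: intertwinedM; rewrite ?XnC //); apply: sh.
Qed.

Lemma derivXM (p r : {poly A}) :
  'X * (p * r)^`() = 'X * p^`() * r + p * ('X * r^`()).
Proof. by rewrite derivM mulrDr !mulrA -(polyXC p). Qed.

Lemma deriv_Th : eqN ('X * Th^`()) (H * Th).
Proof.
move=> i le_i; rewrite coefXM coefM.
transitivity (th i *+ i).
  case: i le_i => [|i] le_i //=.
  by rewrite coef_deriv coef_poly ltnS le_i.
rewrite -logd_sum; apply: eq_bigr => j _.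
rewrite !coef_poly !ltnS (leq_trans _ le_i) ?(leq_trans (leq_subr _ _)) //.
by rewrite -ltnS.
Qed.

(** Write M and M' for the operators of parameters (s, t) and (s', t'), so that
    theta M a = (M' a) theta. Taking z d/dz and dividing by theta on the right
    gives M' ([h, a] + z d/dz log M a - z d/dz log M' a) = 0 up to z^N, and M'
    has constant term 1. *)
Lemma logd_bracket n q : (n <= N)%N ->
  logd n * a q = a q * logd n + (s ^+ n - s' ^+ n) *: a (q + n%:Z)
    + (t ^+ n - t' ^+ n) *: (C ^+ n * a (q - n%:Z)).
Proof.
move=> le_n.
pose G q := H * ac q - ac q * H - geo s' t' q + geo s t q.
have G0 q' : eqN (quadop s' t' G q' * Th) 0.
  have -> : quadop s' t' G q' = H * quadop s' t' ac q' - quadop s' t' ac q' * H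
     - quadop s' t' (geo s' t') q' + quadop s' t' (geo s t) q'.
    have N1 f : quadop s' t' (fun q => - f q) q' = - quadop s' t' f q'.
      by rewrite /quadop !mulrN !opprD !opprK.
    rewrite /G !quadopD !N1 quadop_mull ?quadop_mulr //.
    exact: CHC.
  apply: (@eqN_trans _ ('X * (Th * quadop s t ac q')^`()
                        - 'X * (quadop s' t' ac q' * Th)^`())); last first.
    move=> i le_i; rewrite coefB coef0; apply/eqP; rewrite subr_eq0; apply/eqP.
    exact: (eqN_deriv (rel q')).
  have e1 : eqN (H * quadop s' t' ac q' * Th) ('X * Th^`() * quadop s t ac q').
    rewrite -mulrA; apply: (eqN_trans (eqN_mull _ (eqN_sym (rel q')))).
    rewrite mulrA; apply/eqN_mulr/eqN_sym/deriv_Th.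
  have e2 : eqN (quadop s' t' ac q' * H * Th) (quadop s' t' ac q' * ('X * Th^`())).
    rewrite -mulrA; apply/eqN_mull/eqN_sym/deriv_Th.
  have e3 := eqN_mulr Th (quadop_geo s' t' q').
  have e4 : eqN (quadop s' t' (geo s t) q' * Th) (Th * ('X * (quadop s t ac q')^`())).
    apply: (eqN_trans (eqN_sym (intertwined_geo s t q'))).
    exact/eqN_mull/quadop_geo.
  move: e1 e2 e3 e4 {G}; move: (quadop s' t' ac q') (quadop s t ac q').
  move: (quadop _ _ (geo s' t') q') (quadop _ _ (geo s t) q').
  move=> g1 g2 M P e1 e2 e3 e4 i le_i; rewrite !derivXM !mulrDl !mulNr.
  have := (e1 i le_i, e2 i le_i, e3 i le_i, e4 i le_i).
  rewrite !(coefD, coefN) => -[[[-> ->] ->] ->].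
  have E (x y z w : A) : x - y - z + w = x + w - (z + y).
    by rewrite addrAC (addrAC x) -addrA -opprD [y + z]addrC.
  exact: E.
have gE u w r k : (k <= N)%N -> (geo u w r)`_k = if k == 0%N then 0 else
     - (u ^+ k *: a (r + k%:Z) + w ^+ k *: (C ^+ k * a (r - k%:Z))).
  by move=> le_k; rewrite /geo coef_poly ltnS le_k.
have Gn k : (k <= N)%N -> forall r, (G r)`_k = 0.
  elim/ltn_ind: k => k IH le_k r; have := G0 r k le_k.
  have M0 j : (j < k)%N -> (quadop s' t' G r)`_j = 0.
    move=> lt_j; rewrite coef_quadop IH ?(leq_trans (ltnW lt_j)) //.
    case: j lt_j => [|[|j]] lt_j; rewrite ?IH ?mulr0 ?scaler0 ?subr0 ?addr0 //; by lia.
  rewrite coef0 coefM big_ord_recr /= subnn big1 ?add0r => [|j _]; last first.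
    by rewrite M0 ?mul0r.
  rewrite coef_poly /= th0 mulr1 coef_quadop.
  case: k IH le_k {M0} => [|[|k]] IH le_k.
  - by rewrite !(mulr0, scaler0, subr0, addr0).
  - by rewrite !(IH 0) // !(mulr0, scaler0, subr0, addr0).
  by rewrite !(IH k.+1) 1?(IH k) ?(ltnW le_k) ?(ltnW (ltnW le_k)) //
     !(mulr0, scaler0, subr0, addr0).
have := Gn n le_n q; rewrite /G !(coefD, coefN) coefMC coefCM coef_poly ltnS le_n.
rewrite !gE // => /eqP; rewrite addr_eq0 subr_eq => /eqP e.
case: eqP e => [->|_] e.
  by rewrite logd0 !expr0 !subrr !scale0r mul0r mulr0 !addr0.
have -> : logd n * a q = (logd n * a q - a q * logd n) + a q * logd n.
  by rewrite subrK.
by rewrite {}e opprK !scalerBl [LHS]addrC -[RHS]addrA opprD [_ + _ + (- _ - _)]addrACA.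
Qed.

End LogDerivative.

(** * Two families of root vectors exchanging with each other *)

Lemma shift_ind (P : int -> Prop) k0 :
  (forall k, P k <-> P (k + 1)) -> P k0 -> forall k, P k.
Proof.
move=> step Pk0 k.
have up n : P (k0 + n%:Z).
  elim: n => [|n IH]; first by rewrite addr0.
  by rewrite -addn1 PoszD addrA; apply: (proj1 (step _)) IH.
have down n : P (k0 - n%:Z).
  elim: n => [|n IH]; first by rewrite subr0.
  by apply: (proj2 (step _)); rewrite -addn1 PoszD opprD addrA subrK.
case: (lerP k0 k) => le_k.
  by have -> : k = k0 + `|k - k0|%N%:Z by lia.
by have -> : k = k0 - `|k - k0|%N%:Z by lia.
Qed.

Section LoopDefs.
Variables (F : fieldType) (v : F) (A : algType F).

(** These elements carry all the interaction of the two families: D_{1,m} is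
    - E_{m,0} and D_{2,l-1} is - E_{-1,l}. *)
Definition mixed (a b : int -> A) (m l : int) : A :=
  b l * a m - v^-1 *: (a m * b l)
  + (a (m + 1) * b (l - 1) - v^-1 *: (b (l - 1) * a (m + 1))).

(** The elements theta_n = (v - v^-1) Theta_n, rescaled so that theta_0 = 1. *)
Fixpoint imag (C K L X : A) (E : int -> int -> A) (n : nat) : A :=
  match n with
  | 0 => 1
  | 1 => (v - v^-1) *: X
  | m.+2 => ((v - v^-1) * v) *: (C * E m 0 * L) + v *: (C * imag C K L X E m)
            - (if m == 0%N then C * (K * L) else 0)
  end.

(** The coefficient of z^(n+2) in the relation
    theta (1 - s z S) (1 - t C z S^-1) a = (1 - s' z S) (1 - t' C z S^-1) a theta,
    where S shifts the index of the family a. *)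
Definition weight_at (s t s' t' : F) (C : A) (th : nat -> A) (a : int -> A)
  (n : nat) (q : int) : Prop :=
  th n.+2 * a q - s *: (th n.+1 * a (q + 1))
     - t *: (C * (th n.+1 * a (q - 1))) + (s * t) *: (C * (th n * a q))
     = a q * th n.+2 - s' *: (a (q + 1) * th n.+1)
       - t' *: (C * (a (q - 1) * th n.+1)) + (s' * t') *: (C * (a q * th n)).

Definition weight_rel s t s' t' C th a n : Prop :=
  forall q, weight_at s t s' t' C th a n q.

(** The relations satisfied by one of the two families. Here X and Y are
    Theta_{1,1} and Theta_{2,1}, up to the order of the families. *)
Record loop_half (a b : int -> A) (C Ci K K' L X Y : A) : Prop := LoopHalf {
  lh_Ca : forall k, C * a k = a k * C;
  lh_CK : C * K = K * C;
  lh_CX : C * X = X * C;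
  lh_KL : K * L = 1;
  lh_LK : L * K = 1;
  lh_KK' : K * K' = K' * K;
  lh_Ka : forall k, K * a k = v ^- 3 *: (a k * K);
  lh_Kb : forall k, K * b k = v ^+ 3 *: (b k * K);
  lh_KX : K * X = X * K;
  lh_KY : K * Y = Y * K;
  lh_Xa : forall k, X * a k = a k * X + (v + v^-1) *: a (k + 1) + C * a (k - 1);
  lh_Xb : forall k, X * b k = b k * X - b (k + 1) - (v + v^-1) *: (C * b (k - 1));
  lh_aa : forall k, a k * a (k + 1) = v ^- 2 *: (a (k + 1) * a k);
  lh_XE : X * mixed a b 0 0 = mixed a b 0 0 * X;
}.

(** What the induction uses of the algebra: the relations of both families, and
    the exchange relations in the lowest degree at the single index 0, from which
    T spreads them. The sign eps is that of the first family. *)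
Record loop_data (T : {lrmorphism A -> A}) (eps : F) (a b : int -> A)
  (C Ci K1 L1 K2 L2 X Y : A) : Prop := LoopData {
  ld_1 : loop_half a b C Ci K1 K2 L1 X Y;
  ld_2 : loop_half b a C Ci K2 K1 L2 Y X;
  ld_inj : injective T;
  ld_CCi : C * Ci = 1;
  ld_CiC : Ci * C = 1;
  ld_TC : T C = C;
  ld_eps : eps * eps = 1;
  ld_Ta : forall k, T (a k) = eps *: a (k - 1);
  ld_Tb : forall k, T (b k) = - eps *: b (k - 1);
  ld_TX : T X = X;
  ld_TY : T Y = Y;
  ld_TK1 : C * T K1 = - K1;
  ld_TK2 : C * T K2 = - K2;
  ld_XY : X * Y = Y * X;
  ld_E : v *: (C * mixed a b (-1) 0) = X * K2 + Y * K1;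
  ld_th1a : weight_at (v ^+ 2) v (v ^- 2) v^-1 C
              (imag C K1 L2 X (mixed a b)) a 0 0;
  ld_th1b : weight_at v^-1 (v ^- 2) v (v ^+ 2) C
              (imag C K1 L2 X (mixed a b)) b 0 0;
  ld_th2b : weight_at (v ^+ 2) v (v ^- 2) v^-1 C
              (imag C K2 L1 Y (mixed b a)) b 0 0;
  ld_th2a : weight_at v^-1 (v ^- 2) v (v ^+ 2) C
              (imag C K2 L1 Y (mixed b a)) a 0 0;
}.

Lemma mixed_swap a b m l : mixed b a m l = mixed a b (l - 1) (m + 1).
Proof. by rewrite /mixed subrK addrK addrC. Qed.

(** Whatever holds for one family thereby holds for the other. *)
Lemma loop_data_swap T eps a b C Ci K1 L1 K2 L2 X Y :
  loop_data T eps a b C Ci K1 L1 K2 L2 X Y ->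
  loop_data T (- eps) b a C Ci K2 L2 K1 L1 Y X.
Proof.
case=> *; split=> //; rewrite ?mulrNN ?opprK //.
by rewrite mixed_swap /= sub0r addNr [RHS]addrC.
Qed.

End LoopDefs.

(** * Defects on the small diagonals, and the exchange relations *)

Section Loop.
Variables (F : fieldType) (v : F) (A : algType F).
Hypothesis vtr : forall p : zpoly, peval v p = 0 -> all (Z.eqb 0) p.
Variables (T : {lrmorphism A -> A}) (eps : F) (a b : int -> A).
Variables (C Ci K1 L1 K2 L2 X Y : A).
Hypothesis D : loop_data v T eps a b C Ci K1 L1 K2 L2 X Y.

Let D1 := ld_1 D.
Let D2 := ld_2 D.
Let CCi := ld_CCi D.
Let CiC := ld_CiC D.
Let Ca := lh_Ca D1.
Let Cb := lh_Ca D2.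
Let CX := lh_CX D1.
Let CY := lh_CX D2.
Let CK1 := lh_CK D1.
Let CK2 := lh_CK D2.

Local Notation E := (mixed v a b).

Lemma comm_inv (x K L : A) : K * L = 1 -> L * K = 1 ->
  K * x = x * K -> L * x = x * L.
Proof.
by move=> KL LK Kx; rewrite -[LHS]mulr1 -KL -mulrA (mulrA x) -Kx !mulrA LK mul1r.
Qed.

Lemma commM (z x y : A) : z * x = x * z -> z * y = y * z -> z * (x * y) = x * y * z.
Proof. by move=> ex ey; rewrite mulrA ex -mulrA ey mulrA. Qed.
Lemma commD (z x y : A) : z * x = x * z -> z * y = y * z -> z * (x + y) = (x + y) * z.
Proof. by move=> ex ey; rewrite mulrDr mulrDl ex ey. Qed.
Lemma commN (z x : A) : z * x = x * z -> z * (- x) = - x * z.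
Proof. by move=> ex; rewrite mulrN mulNr ex. Qed.
Lemma commZ (z x : A) c : z * x = x * z -> z * (c *: x) = c *: x * z.
Proof. by move=> ex; rewrite -scalerAr -scalerAl ex. Qed.

Lemma CL1 : C * L1 = L1 * C.
Proof. by apply/esym/(comm_inv (lh_KL D1) (lh_LK D1)); rewrite CK1. Qed.
Lemma CL2 : C * L2 = L2 * C.
Proof. by apply/esym/(comm_inv (lh_KL D2) (lh_LK D2)); rewrite CK2. Qed.

Lemma CE m l : C * E m l = E m l * C.
Proof. by rewrite /mixed; do ![apply: commD|apply: commN|apply: commZ|apply: commM|apply: Ca|apply: Cb]. Qed.

Ltac cc := repeat split; first
  [ exact: Ca | exact: Cb | exact: CX | exact: CY | exact: CK1 | exact: CK2
  | exact: CL1 | exact: CL2 | exact: CE | assumption ].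
Ltac ring_nc xs eqs := nc vtr CCi CiC xs eqs cc.

Lemma K1E m l : K1 * E m l = E m l * K1.
Proof.
rewrite /mixed.
ring_nc [:: a m; a (m + 1); b l; b (l - 1); K1]
  (conj (lh_Ka D1 m) (conj (lh_Ka D1 (m + 1)) (conj (lh_Kb D1 l)
     (conj (lh_Kb D1 (l - 1)) I)))).
Qed.

Lemma K2E m l : K2 * E m l = E m l * K2.
Proof.
rewrite /mixed.
ring_nc [:: a m; a (m + 1); b l; b (l - 1); K2]
  (conj (lh_Kb D2 m) (conj (lh_Kb D2 (m + 1)) (conj (lh_Ka D2 l)
     (conj (lh_Ka D2 (l - 1)) I)))).
Qed.

Lemma TE m l : T (E m l) = - E (m - 1) (l - 1).
Proof.
rewrite /mixed !(linearD, linearN, linearZ, rmorphM) /= !(ld_Ta D) !(ld_Tb D).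
rewrite -!scalerAl -!scalerAr !scalerA !mulNr !mulrN !(ld_eps D) addrK subrK.
by rewrite !scaleNr !scale1r !scalerN !opprK.
Qed.

(** The theorem amounts to the vanishing of these elements, which has to be shown
    for one position on each diagonal m - l. *)
Definition mixed_defect m l : A := E (m + 1) (l + 1) - C * E m l.
Local Notation defect := mixed_defect.

Lemma adXE m l : X * E m l - E m l * X
  = (v + v^-1) *: defect m (l - 1) - defect (m - 1) l.
Proof.
rewrite /mixed_defect /mixed !addrK ?subrK.
have Xa1 := lh_Xa D1 (m + 1); have Xb1 := lh_Xb D1 (l - 1).
rewrite addrK in Xa1; rewrite subrK in Xb1.
ring_nc [:: a m; a (m + 1); b l; b (l - 1); X]
  (conj (lh_Xa D1 m) (conj Xa1 (conj (lh_Xb D1 l) (conj Xb1 I)))).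
Qed.

Lemma adYE m l : Y * E m l - E m l * Y
  = (v + v^-1) *: defect (m - 1) l - defect m (l - 1).
Proof.
rewrite /mixed_defect /mixed !addrK ?subrK.
have Xa1 := lh_Xb D2 (m + 1); have Xb1 := lh_Xa D2 (l - 1).
rewrite addrK in Xa1; rewrite subrK in Xb1.
ring_nc [:: a m; a (m + 1); b l; b (l - 1); Y]
  (conj (lh_Xb D2 m) (conj Xa1 (conj (lh_Xa D2 l) (conj Xb1 I)))).
Qed.

Lemma diag_ind (P : int -> int -> Prop) (d : int) :
  (forall m l, m - l = d -> P m l <-> P (m + 1) (l + 1)) ->
  forall m l m' l', m - l = d -> m' - l' = d -> P m l -> P m' l'.
Proof.
move=> step m l m' l' dml dml' Pml; have -> : m' = l' + d by lia.
apply: (shift_ind (P := fun k => P (k + d) k) (k0 := l)) => [k|].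
  by rewrite [k + 1 + d]addrAC; apply: step; lia.
by have <- : m = l + d by lia.
Qed.

Definition mixed_shifted (d : int) : Prop := forall m l, m - l = d -> defect m l = 0.
Local Notation shifted := mixed_shifted.

Lemma Tdefect m l : T (defect m l) = - defect (m - 1) (l - 1).
Proof.
rewrite /mixed_defect linearB rmorphM /= !TE (ld_TC D) !addrK ?subrK.
by rewrite mulrN opprB opprK addrC.
Qed.

(** T moves defects along their diagonal and is injective. *)
Lemma shifted1 m l : defect m l = 0 -> shifted (m - l).
Proof.
move=> g0 m' l' d; apply: (diag_ind (d := m - l) (P := fun m l => defect m l = 0)) g0 => //.
move=> p r _; split=> [g0|/(congr1 T)]; last first.
  by rewrite Tdefect !addrK raddf0 => /eqP; rewrite oppr_eq0 => /eqP.
by apply: (ld_inj D); rewrite Tdefect !addrK g0 oppr0 raddf0.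
Qed.

Lemma shiftedE d m l : shifted d -> m - l = d -> E (m + 1) (l + 1) = C * E m l.
Proof. by move=> i /i /subr0_eq. Qed.

Lemma Cinj x : C * x = 0 -> x = 0.
Proof. by move=> e; rewrite -[x]mul1r -CiC -mulrA e mulr0. Qed.

Let v0 : v != 0. Proof. exact: v_neq0 vtr. Qed.

Lemma v_pow_neq1 n : v ^+ n.+1 != 1.
Proof.
apply/eqP => e; have := vtr (p := (-1)%BZ :: rcons (nseq n 0%BZ) 1%BZ).
have -> : peval v ((-1)%BZ :: rcons (nseq n 0%BZ) 1%BZ) = -1 + v * v ^+ n.
  congr (_ + _ * _); elim: n {e} => [|n IH] /=; first by rewrite mulr0 addr0.
  by rewrite IH add0r -exprS.
by rewrite -exprS e addNr => /(_ erefl).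
Qed.

Lemma natF_neq0 n : n.+1%:R != 0 :> F.
Proof.
apply/eqP => e; have := vtr (p := [:: Z.of_nat n.+1]).
have -> : peval v [:: Z.of_nat n.+1] = n.+1%:R.
  by rewrite /= mulr0 addr0 /zF -[Z.pos _]/(Z_of_int n.+1) Z_of_intK.
by rewrite e => /(_ erefl).
Qed.

(** Apply T to the expression of E_{-1,0} by X, Y, K_1 and K_2, whose terms are
    multiplied by - C^-1. *)
Lemma shifted_m1 : shifted (-1).
Proof.
rewrite -[-1]/(-2 - (-1) : int); apply: shifted1.
rewrite /mixed_defect -[-2 + 1]/(-1 : int) -[-1 + 1]/(0 : int).
apply: Cinj; apply/eqP; rewrite -[_ == _](inj_eq (@scalerI _ _ v v0)).
have := congr1 T (ld_E D).
rewrite linearZ linearD !rmorphM /= TE (ld_TX D) (ld_TY D) (ld_TC D).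
rewrite -[-1 - 1]/(-2 : int) -[0 - 1]/(-1 : int) => e.
have CTK x K : C * x = x * C -> C * T K = - K -> C * (x * T K) = - (x * K).
  by move=> Cx e'; rewrite mulrA Cx -mulrA e' mulrN.
rewrite mulrBr scalerBr scaler0 subr_eq0 (ld_E D); apply/eqP.
have := congr1 (fun x => - (C * x)) e.
rewrite mulrDr !CTK ?(ld_TK1 D) ?(ld_TK2 D) // -opprD opprK => <-.
by rewrite -scalerAr !mulrN scalerN opprK.
Qed.

Lemma two_neq0 : v + v^-1 != 0.
Proof.
have := d12_neq0 vtr; apply: contra => /eqP e.
by rewrite -(mulfV v0) expr2 -mulrDr addrC e mulr0.
Qed.

Lemma three_neq0 : (v + v^-1) ^+ 2 - 1 != 0.
Proof.
have p0 : v ^+ 4 + v ^+ 2 + 1 != 0.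
  apply/eqP => e; have := vtr (p := [:: 1; 0; 1; 0; 1]%BZ).
  have -> : peval v [:: 1; 0; 1; 0; 1]%BZ = v ^+ 4 + v ^+ 2 + 1.
    by rewrite /= !zF0 !zF1; ring.
  by rewrite e => /(_ erefl).
apply: contra p0 => /eqP e; apply/eqP.
have -> : v ^+ 4 + v ^+ 2 + 1 = v ^+ 2 * ((v + v^-1) ^+ 2 - 1) by field.
by rewrite e mulr0.
Qed.

Lemma XK2YK1 : X * (X * K2 + Y * K1) = (X * K2 + Y * K1) * X.
Proof.
rewrite mulrDr mulrDl -!mulrA (lh_KY D2) (lh_KX D1) !mulrA.
by rewrite (ld_XY D).
Qed.

Lemma YK2XK1 : Y * (X * K2 + Y * K1) = (X * K2 + Y * K1) * Y.
Proof.
rewrite mulrDr mulrDl -!mulrA (lh_KX D2) (lh_KY D1) !mulrA.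
by rewrite (ld_XY D).
Qed.

(** E_{-1,0} is a multiple of X K_2 + Y K_1. *)
Lemma comm_E (x : A) : C * x = x * C ->
  x * (X * K2 + Y * K1) = (X * K2 + Y * K1) * x ->
  x * E (-1) 0 - E (-1) 0 * x = 0.
Proof.
move=> Cx e; apply: Cinj; apply/eqP.
rewrite -[_ == _](inj_eq (@scalerI _ _ v v0)) scaler0 mulrBr scalerBr.
rewrite (mulrA C x) Cx -(mulrA x) scalerAr (mulrA C) (scalerAl v (C * _) x) (ld_E D) e.
by rewrite subrr.
Qed.

(** X and Y commute with E_{-1,0}. By [adXE] and [adYE] this gives two linear
    relations between a defect on the diagonal 0 and one on the diagonal -2, with
    determinant (v + v^-1)^2 - 1. *)
Lemma shifted_0_m2 : shifted 0 /\ shifted (-2).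
Proof.
have := adXE (-1) 0; rewrite (comm_E CX XK2YK1).
have := adYE (-1) 0; rewrite (comm_E CY YK2XK1).
set g := defect _ _; set h := defect _ _ => /esym/subr0_eq e1 /esym/subr0_eq e2.
have h0 : h = 0.
  apply/eqP; have := congr1 (fun x => (v + v^-1) *: x) e2.
  rewrite scalerA e1 -expr2 => /eqP; rewrite -subr_eq0 -[X in _ - X]scale1r.
  by rewrite -scalerBl scaler_eq0 (negbTE three_neq0).
have g0 : g = 0 by rewrite -e2 h0 scaler0.
split; [rewrite -[0]/(-1 - (0 - 1) : int) | rewrite -[-2]/(-1 - 1 - 0 : int)];
  exact: shifted1.
Qed.

Lemma shifted_1 : shifted 1.
Proof.
have := adXE 0 0; rewrite (lh_XE D1) subrr (shifted_m1 (m := 0 - 1)) // subr0 => /esym/eqP.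
rewrite scaler_eq0 (negbTE two_neq0) => /eqP.
exact: shifted1.
Qed.

Lemma shifted_m3 : shifted (-3).
Proof.
have := lh_XE D2; rewrite mixed_swap => e.
have := adYE (0 - 1) (0 + 1); rewrite e subrr (shifted_m1 (l := 0 + 1 - 1)) // subr0 => /esym/eqP.
rewrite scaler_eq0 (negbTE two_neq0) => /eqP.
exact: shifted1.
Qed.

(** The defect of the quadratic relation of Drinfeld's presentation for the
    family a. *)
Definition quad k l : A := a k * a (l + 1) - v ^- 2 *: (a (l + 1) * a k)
  - v ^- 2 *: (a (k + 1) * a l) + a l * a (k + 1).

Lemma quad_sym k l : quad k l = quad l k.
Proof. rewrite /quad. ring_nc (@nil A) I. Qed.

(** The combination of X and Y that shifts the index of a by one without
    involving a (k - 1). *)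
Definition raiser : A := ((v + v^-1) ^+ 2 - 1)^-1 *: ((v + v^-1) *: X + Y).

Lemma raiser_a k : raiser * a k = a k * raiser + a (k + 1).
Proof.
rewrite /raiser -scalerAl -scalerAr; set p := _^-1.
have -> : a (k + 1) = p *: (((v + v^-1) * (v + v^-1) - 1) *: a (k + 1)).
  by rewrite scalerA -expr2 mulVf ?three_neq0 // scale1r.
rewrite -scalerDr; congr (_ *: _).
ring_nc [:: a k; X; Y] (conj (lh_Xa D1 k) (conj (lh_Xb D2 k) I)).
Qed.

Lemma C_raiser : C * raiser = raiser * C.
Proof. by rewrite /raiser; apply: commZ; apply: commD CY; apply: commZ. Qed.

Lemma raiser_quad k l : raiser * quad k l - quad k l * raiser = quad (k + 1) l + quad k (l + 1).
Proof.
have C_raiser' := C_raiser; rewrite /quad.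
ring_nc [:: a k; a (k + 1); a l; a (l + 1); raiser]
  (conj (raiser_a k) (conj (raiser_a (k + 1)) (conj (raiser_a l) (conj (raiser_a (l + 1)) I)))).
Qed.

(** The bracket with the raiser is a derivation, so it produces the relation for
    (k + 1, l) and (k, l + 1) from the one for (k, l). Starting from k = l this
    reaches all distances |k - l|. *)
Lemma quad0 k l : quad k l = 0.
Proof.
suff H n : forall k, quad k (k + n%:Z) = 0.
  case: (lerP k l) => le_kl.
    have -> : l = k + `|l - k|%N%:Z by lia.
    exact: H.
  have -> : k = l + `|k - l|%N%:Z by lia.
  by rewrite quad_sym H.
elim/ltn_ind: n => -[|[|n]] IH {}k.
- rewrite addr0 /quad (lh_aa D1) subrr sub0r.
  by rewrite addNr.
- have q0 : quad k k = 0 by have := IH 0%N isT k; rewrite addr0.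
  have := raiser_quad k k; rewrite q0 mulr0 mul0r subrr.
  rewrite quad_sym -mulr2n -scaler_nat => /esym/eqP.
  by rewrite scaler_eq0 (negbTE (natF_neq0 1)) => /eqP.
have := raiser_quad k (k + n.+1%:Z); rewrite (IH n.+1) // mulr0 mul0r subrr.
have -> : k + n.+1%:Z = k + 1 + n%:Z by lia.
rewrite (IH n) ?(ltnW (ltnSn _)) // add0r => /esym.
by have -> : k + 1 + n%:Z + 1 = k + n.+2%:Z by lia.
Qed.

(** The exchange relation of E with a at general indices. In [mixed_rel_a] the
    shifts by C bring the second index of E to 0. *)
Definition qrel p q r : A :=
  E p r * a (q + 1) - v^-1 *: (E p (r - 1) * a (q + 1 + 1))
  - v ^- 2 *: (E (p + 1) r * a q) + v ^- 3 *: (E (p + 1) (r - 1) * a (q + 1))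
  + v^-1 *: (a q * E (p + 1) r) - a (q + 1) * E (p + 1) (r - 1)
  - v ^- 3 *: (a (q + 1) * E p r) + v ^- 2 *: (a (q + 1 + 1) * E p (r - 1)).

(** The sum is a combination of quadratic relations of a with coefficients b. *)
Lemma qrel_anti p q r : qrel p q r + qrel q p r = 0.
Proof.
have -> : qrel p q r + qrel q p r =
    b r * quad p q - v^-1 *: (b (r - 1) * (quad (p + 1) q + quad p (q + 1)))
    + v ^- 2 *: (b (r - 1 - 1) * quad (p + 1) (q + 1))
    - (v ^- 2 *: (quad p q * b r)
       - v^-1 *: ((quad (p + 1) q + quad p (q + 1)) * b (r - 1))
       + quad (p + 1) (q + 1) * b (r - 1 - 1)).
  by rewrite /qrel /mixed /quad; ring_nc (@nil A) I.
by rewrite !quad0 !(addr0, mulr0, mul0r, scaler0, subr0).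
Qed.

Lemma qrel_shift d p q r : shifted d -> shifted (d + 1) -> shifted (d + 2) -> p - r = d ->
  qrel (p + 1) q (r + 1) = C * qrel p q r.
Proof.
move=> i0 i1 i2 dpr; rewrite /qrel.
have -> : r + 1 - 1 = r - 1 + 1 by lia.
rewrite (shiftedE i0 dpr) (shiftedE i1 (m := p) (l := r - 1)); last by lia.
rewrite (shiftedE i1 (m := p + 1) (l := r)); last by lia.
rewrite (shiftedE i2 (m := p + 1) (l := r - 1)); last by lia.
ring_nc (@nil A) I.
Qed.

(** Along its diagonal qrel is multiplied by C, so it may be evaluated at p = q,
    where antisymmetry applies. *)
Lemma qrel0 d p q r : shifted d -> shifted (d + 1) -> shifted (d + 2) -> p - r = d ->
  qrel p q r = 0.
Proof.
move=> i0 i1 i2 dpr.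
apply: (diag_ind (d := d) (P := fun p r => qrel p q r = 0) _ (m := q) (l := q - d)) => //.
- move=> m l dml; rewrite (qrel_shift _ i0) //; split=> [->|/Cinj //].
  by rewrite mulr0.
- by lia.
have := qrel_anti q q (q - d); rewrite -mulr2n -scaler_nat => /eqP.
by rewrite scaler_eq0 (negbTE (natF_neq0 1)) => /eqP.
Qed.

Lemma mixed_rel_a d q : shifted (d - 1) -> shifted d -> shifted (d + 1) ->
  C * (E (d - 1) 0 * a q) - v^-1 *: (E d 0 * a (q + 1))
  - v ^- 2 *: (C * (E d 0 * a (q - 1))) + v ^- 3 *: (E (d + 1) 0 * a q)
  + v^-1 *: (C * (a (q - 1) * E d 0)) - a q * E (d + 1) 0
  - v ^- 3 *: (C * (a q * E (d - 1) 0)) + v ^- 2 *: (a (q + 1) * E d 0) = 0.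
Proof.
move=> i0 i1 i2; have := @qrel0 (d - 1) (d - 1) (q - 1) 0 i0.
have -> : d - 1 + 2 = d + 1 by lia.
rewrite subrK subr0 /qrel => /(_ i1 i2 erefl).
have -> : d - 1 + 1 = d by lia.
have -> : q - 1 + 1 = q by lia.
have e1 : E d 0 = C * E (d - 1) (0 - 1).
  by rewrite -(shiftedE i1) ?subrK //; lia.
have e2 : E (d + 1) 0 = C * E d (0 - 1).
  by rewrite -(shiftedE i2) ?subrK //; lia.
move=> /(congr1 (fun x => C * x)); rewrite mulr0 => <-.
rewrite {1 4}e1 e2.
ring_nc (@nil A) I.
Qed.

Local Notation th := (imag v C K1 L2 X E).

(** The part of theta_(d+2) that comes from E_{d,0}; negative d occur in the
    exchange relations of low order. *)
Definition imag_gap d : A := ((v - v^-1) * v) *: (C * E d 0 * L2).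
(** The extra term of Theta_2. *)
Definition imag_fix n : A := if n == 0%N then C * (K1 * L2) else 0.

Lemma imagSS n : th n.+2 = imag_gap n + v *: (C * th n) - imag_fix n.
Proof. by []. Qed.

(** In degree -1 the gap is theta_1 plus a term in Y, which is why the exchange
    relation of order 1 needs its own proof. *)
Lemma gap_m1 : imag_gap (-1)
  = (v - v^-1) *: X + (v - v^-1) *: (Y * (K1 * L2)).
Proof.
rewrite /imag_gap -scalerA -scalerDr; congr (_ *: _).
by rewrite scalerAl (ld_E D) mulrDl -!mulrA (lh_KL D2) mulr1.
Qed.

Lemma L2a k : L2 * a k = v ^- 3 *: (a k * L2).
Proof.
rewrite -[LHS]mulr1 -(lh_KL D2) -mulrA (mulrA (a k)).
have -> : a k * K2 = v ^- 3 *: (K2 * a k).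
  by rewrite (lh_Kb D2) scalerA mulVf ?scale1r // expf_neq0.
by rewrite -!scalerAl -scalerAr -!mulrA (mulrA L2) (lh_LK D2) mul1r.
Qed.

Lemma L2b k : L2 * b k = v ^+ 3 *: (b k * L2).
Proof.
rewrite -[LHS]mulr1 -(lh_KL D2) -mulrA (mulrA (b k)).
have -> : b k * K2 = v ^+ 3 *: (K2 * b k).
  by rewrite (lh_Ka D2) scalerA mulfV ?scale1r // expf_neq0.
by rewrite -!scalerAl -scalerAr -!mulrA (mulrA L2) (lh_LK D2) mul1r.
Qed.

Lemma gap_rel_a d q : shifted (d - 1) -> shifted d -> shifted (d + 1) ->
  imag_gap (d + 1) * a q = v ^+ 2 *: (imag_gap d * a (q + 1))
   + v *: (C * (imag_gap d * a (q - 1)))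
   - (v ^+ 2 * v) *: (C * (imag_gap (d - 1) * a q))
   + a q * imag_gap (d + 1) - v ^- 2 *: (a (q + 1) * imag_gap d)
   - v^-1 *: (C * (a (q - 1) * imag_gap d))
   + (v ^- 2 * v^-1) *: (C * (a q * imag_gap (d - 1))).
Proof.
move=> i0 i1 i2; have := mixed_rel_a q i0 i1 i2.
set R := (X in X = 0) => R0.
apply/eqP; rewrite -subr_eq0; apply/eqP.
transitivity (((v - v^-1) * v) *: (C * R * L2)); last first.
  by rewrite R0 mulr0 mul0r scaler0.
rewrite /R /imag_gap.
ring_nc [:: a q; a (q + 1); a (q - 1); E d 0; E (d + 1) 0; E (d - 1) 0; L2]
  (conj (L2a q) (conj (L2a (q + 1)) (conj (L2a (q - 1)) I))).
Qed.

Lemma CM : C * (K1 * L2) = K1 * L2 * C.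
Proof. exact: commM CK1 CL2. Qed.

Lemma CYM : C * (Y * (K1 * L2)) = Y * (K1 * L2) * C.
Proof. exact: commM CY CM. Qed.

Lemma Cgap d : C * imag_gap d = imag_gap d * C.
Proof. by apply/commZ/commM; [apply/commM/CE | exact: CL2]. Qed.

Lemma Cfix n : C * imag_fix n = imag_fix n * C.
Proof.
rewrite /imag_fix; case: eqP => _; last by rewrite mulr0 mul0r.
exact/commM/CM.
Qed.

Lemma Cth n : C * th n = th n * C.
Proof.
elim/ltn_ind: n => -[|[|n]] IH; first by rewrite mulr1 mul1r.
  exact/commZ/CX.
rewrite imagSS; apply: commD; last exact/commN/Cfix.
by apply: commD (Cgap _) _; apply/commZ/commM => //; apply: IH.
Qed.

Ltac cc ::= repeat split; first
  [ exact: Ca | exact: Cb | exact: CX | exact: CY | exact: CK1 | exact: CK2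
  | exact: CL1 | exact: CL2 | exact: CE | exact: CYM | exact: CM | exact: Cgap
  | exact: Cfix | exact: Cth | assumption ].

Lemma Ma k : K1 * L2 * a k = v ^- 6 *: (a k * (K1 * L2)).
Proof.
ring_nc [:: a k; K1; L2] (conj (L2a k) (conj (lh_Ka D1 k) I)).
Qed.

Lemma Mb k : K1 * L2 * b k = v ^+ 6 *: (b k * (K1 * L2)).
Proof.
ring_nc [:: b k; K1; L2] (conj (L2b k) (conj (lh_Kb D1 k) I)).
Qed.

Lemma fixa n k : imag_fix n * a k = v ^- 6 *: (a k * imag_fix n).
Proof.
rewrite /imag_fix; case: eqP => _; last by rewrite mulr0 mul0r scaler0.
by rewrite -mulrA Ma -scalerAr !mulrA Ca.
Qed.

Lemma fixb n k : imag_fix n * b k = v ^+ 6 *: (b k * imag_fix n).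
Proof.
rewrite /imag_fix; case: eqP => _; last by rewrite mulr0 mul0r scaler0.
by rewrite -mulrA Mb -scalerAr !mulrA Cb.
Qed.

Lemma YMa k : Y * (K1 * L2) * a k = v ^- 6 *: (a k * (Y * (K1 * L2))
  - a (k + 1) * (K1 * L2) - (v + v^-1) *: (C * (a (k - 1) * (K1 * L2)))).
Proof.
ring_nc [:: a k; K1; L2; Y]
  (conj (L2a k) (conj (lh_Ka D1 k) (conj (lh_Xb D2 k) I))).
Qed.

Lemma YMb k : Y * (K1 * L2) * b k = v ^+ 6 *: (b k * (Y * (K1 * L2))
  + (v + v^-1) *: (b (k + 1) * (K1 * L2)) + C * (b (k - 1) * (K1 * L2))).
Proof.
ring_nc [:: b k; K1; L2; Y]
  (conj (L2b k) (conj (lh_Kb D1 k) (conj (lh_Xa D2 k) I))).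
Qed.

Lemma solve_rel (x y z w r : A) : x - y - z + w = r -> x = y + z - w + r.
Proof.
by move=> <-; rewrite -[x - y - z]addrA -opprD [RHS]addrC addrACA subrK subrr addr0.
Qed.

(** Up to the extra term of Theta_2, the gaps are theta_(d+2) - v C theta_d. They
    satisfy the exchange relation by [gap_rel_a], which lifts it from order n to
    order n + 2. *)
Lemma weight_step_a n : weight_rel (v ^+ 2) v (v ^- 2) v^-1 C th a n ->
  shifted n%:Z -> shifted (n%:Z + 1) -> shifted (n%:Z + 2) ->
  weight_rel (v ^+ 2) v (v ^- 2) v^-1 C th a n.+2.
Proof.
move=> IH i0 i1 i2 q; have t2 := solve_rel (IH q).
have := @gap_rel_a (n%:Z + 1) q.
have -> : n%:Z + 1 - 1 = n%:Z by lia.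
have -> : n%:Z + 1 + 1 = n%:Z + 2 by lia.
have g0 : imag_gap n%:Z = th n.+2 - v *: (C * th n) + imag_fix n.
  by rewrite imagSS addrAC subrK addrK.
rewrite g0 => /(_ i0 i1 i2) g2.
rewrite /weight_at (imagSS n.+2) (imagSS n.+1) !subr0.
have -> : n.+2%:Z = n%:Z + 2 by lia.
have -> : n.+1%:Z = n%:Z + 1 by lia.
move: g2 t2; move: (imag_gap (n%:Z + 2)) (imag_gap (n%:Z + 1)) (Cgap (n%:Z + 2)) (Cgap (n%:Z + 1)).
move: (th n.+2) (th n.+1) (th n) (Cth n.+2) (Cth n.+1) (Cth n).
move=> x2 x1 x0 Cx2 Cx1 Cx0 g2 g1 Cg2 Cg1 rg2 rx2.
ring_nc [:: a q; a (q + 1); a (q - 1); imag_fix n; x0; x1; x2; g1; g2]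
  (conj (fixa n q) (conj rx2 (conj rg2 I))).
Qed.

Lemma weight_step_b n : weight_rel v^-1 (v ^- 2) v (v ^+ 2) C th b n ->
  (forall q, imag_gap (n%:Z + 2) * b q
     - v^-1 *: (imag_gap (n%:Z + 1) * b (q + 1))
     - v ^- 2 *: (C * (imag_gap (n%:Z + 1) * b (q - 1)))
     + (v^-1 * v ^- 2) *: (C * (imag_gap n * b q))
   = b q * imag_gap (n%:Z + 2) - v *: (b (q + 1) * imag_gap (n%:Z + 1))
     - v ^+ 2 *: (C * (b (q - 1) * imag_gap (n%:Z + 1)))
     + (v * v ^+ 2) *: (C * (b q * imag_gap n))) ->
  weight_rel v^-1 (v ^- 2) v (v ^+ 2) C th b n.+2.
Proof.
move=> IH g q; have t2 := solve_rel (IH q).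
have := solve_rel (g q).
have g0 : imag_gap n%:Z = th n.+2 - v *: (C * th n) + imag_fix n.
  by rewrite imagSS addrAC subrK addrK.
rewrite g0 => g2.
rewrite /weight_at (imagSS n.+2) (imagSS n.+1) !subr0.
have -> : n.+2%:Z = n%:Z + 2 by lia.
have -> : n.+1%:Z = n%:Z + 1 by lia.
move: g2 t2; move: (imag_gap (n%:Z + 2)) (imag_gap (n%:Z + 1)) (Cgap (n%:Z + 2)) (Cgap (n%:Z + 1)).
move: (th n.+2) (th n.+1) (th n) (Cth n.+2) (Cth n.+1) (Cth n).
move=> x2 x1 x0 Cx2 Cx1 Cx0 g2 g1 Cg2 Cg1 rg2 rx2.
ring_nc [:: b q; b (q + 1); b (q - 1); imag_fix n; x0; x1; x2; g1; g2]
  (conj (fixb n q) (conj rx2 (conj rg2 I))).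
Qed.

(** As in [weight_step_a], with the term in Y of [gap_m1] in place of the missing
    theta_(-1). *)
Lemma weight_1_a : shifted (-1) -> shifted 0 -> shifted 1 ->
  weight_rel (v ^+ 2) v (v ^- 2) v^-1 C th a 1.
Proof.
move=> i0 i1 i2 q; have := @gap_rel_a 0 q i0 i1 i2.
rewrite sub0r add0r gap_m1 => g1.
rewrite /weight_at (imagSS 1) (imagSS 0) [imag_fix 1]/= subr0.
rewrite [th 1]/= [th 0]/= mulr1 -[imag_fix 0]/(C * (K1 * L2)).
have M0 := Ma q; have M1 := Ma (q + 1); have M2 := Ma (q - 1).
move: g1 (YMa q) CYM M0 M1 M2 CM; move: (imag_gap 1) (imag_gap 0) (Cgap 1) (Cgap 0).
move=> g1 g0 Cg1 Cg0; move: (Y * (K1 * L2)) => W; move: (K1 * L2) => M.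
move=> rg rW CW rM0 rM1 rM2 CM'.
ring_nc [:: a q; a (q + 1); a (q - 1); M; X; W; g0; g1]
  (conj rM0 (conj rM1 (conj rM2 (conj (lh_Xa D1 q) (conj rW (conj rg I)))))).
Qed.

Lemma weight_1_b :
  (forall q, imag_gap 1 * b q - v^-1 *: (imag_gap 0 * b (q + 1))
     - v ^- 2 *: (C * (imag_gap 0 * b (q - 1)))
     + (v^-1 * v ^- 2) *: (C * (imag_gap (-1) * b q))
   = b q * imag_gap 1 - v *: (b (q + 1) * imag_gap 0)
     - v ^+ 2 *: (C * (b (q - 1) * imag_gap 0))
     + (v * v ^+ 2) *: (C * (b q * imag_gap (-1)))) ->
  weight_rel v^-1 (v ^- 2) v (v ^+ 2) C th b 1.
Proof.
move=> g q; have := solve_rel (g q).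
rewrite gap_m1 => g1.
rewrite /weight_at (imagSS 1) (imagSS 0) [imag_fix 1]/= subr0.
rewrite [th 1]/= [th 0]/= mulr1 -[imag_fix 0]/(C * (K1 * L2)).
have M0 := Mb q; have M1 := Mb (q + 1); have M2 := Mb (q - 1).
move: g1 (YMb q) CYM M0 M1 M2 CM; move: (imag_gap 1) (imag_gap 0) (Cgap 1) (Cgap 0).
move=> g1 g0 Cg1 Cg0; move: (Y * (K1 * L2)) => W; move: (K1 * L2) => M.
move=> rg rW CW rM0 rM1 rM2 CM'.
ring_nc [:: b q; b (q + 1); b (q - 1); M; X; W; g0; g1]
  (conj rM0 (conj rM1 (conj rM2 (conj (lh_Xb D1 q) (conj rW (conj rg I)))))).
Qed.

End Loop.

(** * Induction on the diagonal *)

Section Loop2.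
Variables (F : fieldType) (v : F) (A : algType F).
Hypothesis vtr : forall p : zpoly, peval v p = 0 -> all (Z.eqb 0) p.
Variables (T : {lrmorphism A -> A}) (eps : F) (a b : int -> A).
Variables (C Ci K1 L1 K2 L2 X Y : A).
Hypothesis D : loop_data v T eps a b C Ci K1 L1 K2 L2 X Y.

Let D' := loop_data_swap D.
Let D1 := ld_1 D.
Let D2 := ld_2 D.
Let CCi := ld_CCi D.
Let CiC := ld_CiC D.
Let Ca := lh_Ca D1.
Let Cb := lh_Ca D2.
Let CX := lh_CX D1.
Let CY := lh_CX D2.
Let CK1 := lh_CK D1.
Let CK2 := lh_CK D2.

Local Notation E := (mixed v a b).
Local Notation shifted := (mixed_shifted v a b C).
Local Notation defect := (mixed_defect v a b C).
Local Notation th := (imag v C K1 L2 X E).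
Local Notation gap := (imag_gap v a b C L2).

Let CE := CE D.
Let CL2 := CL2 D.
Let Cgap := Cgap D.
Let Cth := Cth D.

Ltac cc := repeat split; first
  [ exact: Ca | exact: Cb | exact: CX | exact: CY | exact: CK1 | exact: CK2
  | exact: CL2 | exact: CE | exact: Cgap | exact: Cth | assumption ].
Ltac ring_nc xs eqs := nc vtr CCi CiC xs eqs cc.

Lemma shifted_swap d : shifted d -> mixed_shifted v b a C (-2 - d).
Proof.
move=> i m l dml; rewrite /mixed_defect !(@mixed_swap _ v _ a b) addrK.
by have := i (l - 1) (m + 1); rewrite /mixed_defect subrK => -> //; lia.
Qed.

(** The relation [qrel0] with the two families exchanged. *)
Lemma gap_rel_b d q : shifted d -> shifted (d + 1) -> shifted (d + 2) ->
  gap (d + 2) * b q - v^-1 *: (gap (d + 1) * b (q + 1))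
     - v ^- 2 *: (C * (gap (d + 1) * b (q - 1)))
     + (v^-1 * v ^- 2) *: (C * (gap d * b q))
   = b q * gap (d + 2) - v *: (b (q + 1) * gap (d + 1))
     - v ^+ 2 *: (C * (b (q - 1) * gap (d + 1)))
     + (v * v ^+ 2) *: (C * (b q * gap d)).
Proof.
move=> i0 i1 i2; apply/eqP; rewrite -subr_eq0; apply/eqP.
have := @qrel0 _ _ _ vtr _ _ _ _ _ _ _ _ _ _ _ _ D' (- 4 - d) (- 1) (q - 1) (d + 3).
have -> : - 4 - d + 1 = - 2 - (d + 1) by lia.
have -> : - 4 - d + 2 = - 2 - d by lia.
have e4 : - 4 - d = - 2 - (d + 2) by lia.
rewrite {1}e4 => /(_ (shifted_swap i2) (shifted_swap i1) (shifted_swap i0)).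
have -> : - 1 - (d + 3) = - 4 - d by lia.
move=> /(_ erefl); rewrite /qrel !(@mixed_swap _ v _ a b) addNr.
have -> : q - 1 + 1 = q by lia.
have -> : d + 3 - 1 - 1 = d + 1 by lia.
have -> : d + 3 - 1 = d + 2 by lia.
have e1 : E (d + 2) (0 + 1) = C * E (d + 1) 0.
  by rewrite -(shiftedE i1) ?subr0 // -addrA.
have e0 : E (d + 1) (0 + 1) = C * E d 0 by rewrite -(shiftedE i0) ?subr0.
rewrite e1 e0; set R := (X in X = 0) => R0.
transitivity ((v ^+ 3 * ((v - v^-1) * v)) *: (C * R * L2)); last first.
  by rewrite R0 mulr0 mul0r scaler0.
rewrite /R /imag_gap.
ring_nc [:: b q; b (q + 1); b (q - 1); E d 0; E (d + 1) 0; E (d + 2) 0; L2]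
  (conj (L2b vtr D q) (conj (L2b vtr D (q + 1)) (conj (L2b vtr D (q - 1)) I))).
Qed.

(** T sends C E_{n,0} K_2^-1 to C (- E_{n-1,-1}) (- C K_2^-1), which is the same
    element once the diagonal n is shifted by C. *)
Lemma T_imag_upto N : (forall d : int, 0 <= d -> d + 2 <= N%:Z -> shifted d) ->
  forall n, (n <= N)%N -> T (th n) = th n.
Proof.
move=> sh.
have TL2 : T L2 = - (C * L2).
  have e : T L2 * T K2 = 1 by rewrite -rmorphM (lh_LK (ld_2 D)) rmorph1.
  rewrite -[T L2]mulr1 -(lh_KL (ld_2 D)) mulrA.
  have -> : T L2 * K2 = - C; last by rewrite mulNr.
  rewrite -[K2]opprK -(ld_TK2 D) mulrN mulrA.
  have -> : T L2 * C = C * T L2 by rewrite -{1 2}(ld_TC D) -!rmorphM CL2.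
  by rewrite -mulrA e mulr1.
elim/ltn_ind => -[|[|n]] IH le_n; first by rewrite rmorph1.
  by rewrite linearZ /= (ld_TX D).
rewrite imagSS linearB linearD /=; congr (_ + _ - _).
- rewrite /imag_gap linearZ !rmorphM /= (TE D) (ld_TC D) TL2 sub0r.
  congr (_ *: _); rewrite !mulrN mulNr opprK.
  have sn : shifted n%:Z by apply: sh; lia.
  have := shiftedE sn (m := n%:Z - 1) (l := -1).
  rewrite subrK addNr => ->; last by lia.
  by rewrite -!mulrA; congr (_ * _); rewrite !mulrA CE.
- by rewrite linearZ rmorphM /= (ld_TC D) IH //; lia.
rewrite /imag_fix; case: eqP => _; last by rewrite raddf0.
rewrite !rmorphM /= (ld_TC D) (mulrA C (T K1)) (ld_TK1 D) TL2 mulrNN.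
by rewrite !mulrA (lh_CK (ld_1 D)).
Qed.

(** T moves the exchange relation at q to the one at q - 1. *)
Lemma weight_T (x : int -> A) (e s t s' t' : F) n q :
  e * e = 1 -> (forall k, T (x k) = e *: x (k - 1)) ->
  (forall j, (j <= n.+2)%N -> T (th j) = th j) ->
  weight_at s t s' t' C th x n 0 -> weight_at s t s' t' C th x n q.
Proof.
move=> ee Tx Tth.
pose wf (s t : F) (p : nat -> int -> A) q := p n.+2 q - s *: p n.+1 (q + 1)
     - t *: (C * p n.+1 (q - 1)) + (s * t) *: (C * p n q).
have Twf u w p r : (forall j k, (j <= n.+2)%N -> T (p j k) = e *: p j (k - 1)) ->
    T (wf u w p r) = e *: wf u w p (r - 1).
  move=> Tp; rewrite /wf !(linearD, linearN, linearZ, rmorphM) /= (ld_TC D).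
  rewrite !Tp; try lia.
  have -> : r - 1 + 1 = r + 1 - 1 by lia.
  rewrite !scalerN -!scalerAr ![_ *: (e *: _)]scalerA ![_ * e]mulrC -!scalerA.
  by rewrite -!scalerN -!scalerDr.
have T1 r := @Twf s t (fun j k => th j * x k) r.
have T2 r := @Twf s' t' (fun j k => x k * th j) r.
have {}T1 r : T (wf s t (fun j k => th j * x k) r)
    = e *: wf s t (fun j k => th j * x k) (r - 1).
  by apply: T1 => j k le_j; rewrite rmorphM /= Tx Tth // -scalerAr.
have {}T2 r : T (wf s' t' (fun j k => x k * th j) r)
    = e *: wf s' t' (fun j k => x k * th j) (r - 1).
  by apply: T2 => j k le_j; rewrite rmorphM /= Tx Tth // -scalerAl.
have e0 : e != 0 by apply/eqP => e0; move: ee; rewrite e0 mul0r => /esym/eqP; rewrite oner_eq0.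
apply: (diag_ind (d := 0) (P := fun m _ => weight_at s t s' t' C th x n m)
  _ (m := 0) (l := 0) (m' := q) (l' := q)); rewrite ?subrr // => m _ _.
change (wf s t (fun j k => th j * x k) m = wf s' t' (fun j k => x k * th j) m <->
  wf s t (fun j k => th j * x k) (m + 1) = wf s' t' (fun j k => x k * th j) (m + 1)).
split=> [em|/(congr1 T)]; last by rewrite T1 T2 addrK => /(scalerI e0).
by apply: (ld_inj D); rewrite T1 T2 addrK em.
Qed.

Lemma weight_all N : (forall d : int, -1 <= d -> d <= N%:Z -> shifted d) ->
  forall n, (n <= N)%N ->
  weight_rel (v ^+ 2) v (v ^- 2) v^-1 C th a n /\
  weight_rel v^-1 (v ^- 2) v (v ^+ 2) C th b n.
Proof.
move=> sh; elim/ltn_ind => -[|[|n]] IH le_n.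
- have Tth j : (j <= 2)%N -> T (th j) = th j.
    by apply: T_imag_upto => d d1 d2; apply: sh; lia.
  split=> q; first exact: (weight_T q (ld_eps D) (ld_Ta D) Tth (ld_th1a D)).
  apply: (weight_T q _ (ld_Tb D) Tth (ld_th1b D)).
  by rewrite mulrNN (ld_eps D).
- split; first by apply: (weight_1_a vtr D); apply: sh; lia.
  apply: (weight_1_b vtr D) => q.
  by apply: (gap_rel_b (d := -1)); apply: sh; lia.
have [IHa IHb] := IH n (ltnW (ltnSn _)) (ltnW (ltnW le_n)).
split; first by apply: (weight_step_a vtr D) => //; apply: sh; lia.
apply: (weight_step_b vtr D) => // q.
by apply: gap_rel_b; apply: sh; lia.
Qed.

Lemma logd_a N n q : (forall d : int, -1 <= d -> d <= N%:Z - 2 -> shifted d) ->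
  (n <= N)%N ->
  logd th n * a q = a q * logd th n
    + ((v ^+ 2) ^+ n - (v ^- 2) ^+ n) *: a (q + n%:Z)
    + (v ^+ n - v^-1 ^+ n) *: (C ^+ n * a (q - n%:Z)).
Proof.
move=> sh le_n.
suff R : intertwined th C (v ^+ 2) v (v ^- 2) v^-1 N (fun q => (a q)%:P).
  exact: (logd_bracket (erefl : th 0 = 1) Cth R).
apply: intertwined_coef => //.
  move=> r; rewrite [th 1]/=.
  by ring_nc [:: a r; a (r + 1); a (r - 1); X] (conj (lh_Xa D1 r) I).
move=> m lt_m r; have le_m : (m <= N - 2)%N by lia.
have [|Ha _] := weight_all _ le_m; last exact: Ha.
by move=> d d1 d2; apply: sh; lia.
Qed.

Lemma logd_b N n q : (forall d : int, -1 <= d -> d <= N%:Z - 2 -> shifted d) ->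
  (n <= N)%N ->
  logd th n * b q = b q * logd th n
    + (v^-1 ^+ n - v ^+ n) *: b (q + n%:Z)
    + ((v ^- 2) ^+ n - (v ^+ 2) ^+ n) *: (C ^+ n * b (q - n%:Z)).
Proof.
move=> sh le_n.
suff R : intertwined th C v^-1 (v ^- 2) v (v ^+ 2) N (fun q => (b q)%:P).
  exact: (logd_bracket (erefl : th 0 = 1) Cth R).
apply: intertwined_coef => //.
  move=> r; rewrite [th 1]/=.
  by ring_nc [:: b r; b (r + 1); b (r - 1); X] (conj (lh_Xb D1 r) I).
move=> m lt_m r; have le_m : (m <= N - 2)%N by lia.
have [|_ Hb] := weight_all _ le_m; last exact: Hb.
by move=> d d1 d2; apply: sh; lia.
Qed.

(** E_{m,l} as a bilinear expression in the pairs (a_m, a_(m+1)) and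
    (b_l, b_(l-1)). *)
Definition mix (x0 x1 y0 y1 : A) : A :=
  y0 * x0 - v^-1 *: (x0 * y0) + (x1 * y1 - v^-1 *: (y1 * x1)).

Let sum8 (p q r s t u w z : A) :
  p + q - (r + s) + (t + u - (w + z)) = p - r + (t - w) + (q - s + (u - z)).
Proof. by rewrite !opprD (addrACA p q) (addrACA t u) (addrACA (p - r)). Qed.

Lemma mixD x0 x1 y0 y1 z0 z1 :
  mix (x0 + z0) (x1 + z1) y0 y1 = mix x0 x1 y0 y1 + mix z0 z1 y0 y1.
Proof.
by rewrite /mix !mulrDl !mulrDr !scalerDr sum8.
Qed.

Lemma mixDr x0 x1 y0 y1 z0 z1 :
  mix x0 x1 (y0 + z0) (y1 + z1) = mix x0 x1 y0 y1 + mix x0 x1 z0 z1.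
Proof.
by rewrite /mix !mulrDl !mulrDr !scalerDr sum8.
Qed.

Lemma mixZ c x0 x1 y0 y1 :
  mix (c *: x0) (c *: x1) y0 y1 = c *: mix x0 x1 y0 y1.
Proof.
rewrite /mix -!scalerAr -!scalerAl ![v^-1 *: (c *: _)]scalerA ![v^-1 * c]mulrC.
by rewrite -!scalerA -!scalerBr -scalerDr.
Qed.

Lemma mixZr c x0 x1 y0 y1 :
  mix x0 x1 (c *: y0) (c *: y1) = c *: mix x0 x1 y0 y1.
Proof.
rewrite /mix -!scalerAr -!scalerAl ![v^-1 *: (c *: _)]scalerA ![v^-1 * c]mulrC.
by rewrite -!scalerA -!scalerBr -scalerDr.
Qed.

Lemma mixM z x0 x1 y0 y1 : z * y0 = y0 * z -> z * y1 = y1 * z ->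
  mix (z * x0) (z * x1) y0 y1 = z * mix x0 x1 y0 y1.
Proof.
move=> e0 e1; rewrite /mix mulrDr !mulrBr -!scalerAr !mulrA -e0 -e1 -!mulrA.
by rewrite !mulrA.
Qed.

Lemma mixMr z x0 x1 y0 y1 : z * x0 = x0 * z -> z * x1 = x1 * z ->
  mix x0 x1 (z * y0) (z * y1) = z * mix x0 x1 y0 y1.
Proof.
move=> e0 e1; rewrite /mix mulrDr !mulrBr -!scalerAr !mulrA -e0 -e1 -!mulrA.
by rewrite !mulrA.
Qed.

Lemma mixE m l : E m l = mix (a m) (a (m + 1)) (b l) (b (l - 1)).
Proof. by []. Qed.

(** A derivation acts on both arguments in turn. *)
Lemma ad_mix h x0 x1 y0 y1 x0' x1' y0' y1' :
  h * x0 = x0 * h + x0' -> h * x1 = x1 * h + x1' ->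
  h * y0 = y0 * h + y0' -> h * y1 = y1 * h + y1' ->
  h * mix x0 x1 y0 y1
  = mix x0 x1 y0 y1 * h + (mix x0' x1' y0 y1 + mix x0 x1 y0' y1').
Proof.
have mulD x y x' y' : h * x = x * h + x' -> h * y = y * h + y' ->
    h * (x * y) = x * y * h + (x' * y + x * y').
  by move=> ex ey; rewrite mulrA ex mulrDl -mulrA ey mulrDr !mulrA addrAC addrA.
move=> ex0 ex1 ey0 ey1; rewrite /mix !mulrDr !mulrDl !mulrN !mulNr.
rewrite -!scalerAr -!scalerAl !(mulD _ _ _ _ ex0 ey0) !(mulD _ _ _ _ ex1 ey1).
rewrite !(mulD _ _ _ _ ey0 ex0) !(mulD _ _ _ _ ey1 ex1) !scalerDr.
by rewrite sum8 [y0' * x0 + _]addrC [v^-1 *: (y1' * x1) + _]addrC sum8.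
Qed.

(** The actions of h_n on a_m, a_(m+1) and on b_l, b_(l-1) are shifts of the same
    kind, so they combine to shifts of the indices of E. *)
Lemma logd_mixed N n m l :
  (forall d : int, -1 <= d -> d <= N%:Z - 2 -> shifted d) -> (n <= N)%N ->
  logd th n * E m l = E m l * logd th n
   + ((v ^+ 2) ^+ n - (v ^- 2) ^+ n) *:
       (E (m + n%:Z) l - C ^+ n * E m (l - n%:Z))
   + (v ^+ n - v^-1 ^+ n) *: (C ^+ n * E (m - n%:Z) l - E m (l + n%:Z)).
Proof.
move=> sh le_n.
have ha q := logd_a q sh le_n; have hb q := logd_b q sh le_n.
have Cn x : C * x = x * C -> C ^+ n * x = x * C ^+ n.
  by move=> e; apply/esym/commrX/esym.
rewrite mixE (ad_mix (etrans (ha m) (esym (addrA _ _ _)))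
  (etrans (ha (m + 1)) (esym (addrA _ _ _)))
  (etrans (hb l) (esym (addrA _ _ _))) (etrans (hb (l - 1)) (esym (addrA _ _ _)))).
rewrite !mixD !mixDr !mixZ !mixZr mixM; try exact: Cn.
rewrite mixMr; try exact: Cn.
rewrite -mixE; set al := _ - (v ^- 2) ^+ n; set be := _ - v^-1 ^+ n.
have -> : (v ^- 2) ^+ n - (v ^+ 2) ^+ n = - al by rewrite opprB.
have -> : v^-1 ^+ n - v ^+ n = - be by rewrite opprB.
have -> : m + 1 + n%:Z = m + n%:Z + 1 by lia.
have -> : m + 1 - n%:Z = m - n%:Z + 1 by lia.
have -> : l - 1 + n%:Z = l + n%:Z - 1 by lia.
have -> : l - 1 - n%:Z = l - n%:Z - 1 by lia.
rewrite -!mixE !scalerBr !scaleNr -!addrA; congr (_ + (_ + _)).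
by rewrite [RHS]addrCA; congr (_ + _); rewrite addrC.
Qed.

(** A telescoping sum along the diagonal, all of whose terms are equal when the
    defects are multiplied by C from one position to the next. *)
Lemma defect_sum m l (k : nat) :
  (forall m' l', m' - l' = m - l -> defect (m' + 1) (l' + 1) = C * defect m' l') ->
  E m l - C ^+ k * E (m - k%:Z) (l - k%:Z) = defect (m - 1) (l - 1) *+ k.
Proof.
move=> cov; have dE (j : nat) : C ^+ j * defect (m - j.+1%:Z) (l - j.+1%:Z) = defect (m - 1) (l - 1).
  elim: j => [|j IH]; first by rewrite expr0 mul1r.
  rewrite -IH exprSr -mulrA -cov; last by lia.
  have -> : m - j.+2%:Z + 1 = m - j.+1%:Z by lia.
  by have -> : l - j.+2%:Z + 1 = l - j.+1%:Z by lia.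
elim: k => [|k IH]; first by rewrite expr0 mul1r !subr0 subrr.
rewrite mulrS -IH -(dE k) /mixed_defect mulrBr.
have -> : m - k.+1%:Z + 1 = m - k%:Z by lia.
have -> : l - k.+1%:Z + 1 = l - k%:Z by lia.
by rewrite mulrA -exprSr addrC addrA subrK.
Qed.

Lemma K1th n : K1 * th n = th n * K1.
Proof.
have K1L2 : K1 * L2 = L2 * K1.
  by apply/esym/(comm_inv (lh_KL D2) (lh_LK D2))/esym/(lh_KK' D1).
elim/ltn_ind: n => -[|[|n]] IH; first by rewrite mulr1 mul1r.
  exact/commZ/(lh_KX D1).
rewrite imagSS /imag_gap; apply: commD.
  apply: commD; apply/commZ/commM; rewrite ?CK1 //; last exact: IH.
  by apply: commM; rewrite ?CK1 //; apply: (K1E vtr D).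
apply: commN; rewrite /imag_fix; case: eqP => _; last by rewrite mulr0 mul0r.
by apply: commM; rewrite ?CK1 //; apply: commM.
Qed.

Lemma K2th n : K2 * th n = th n * K2.
Proof.
have K2L2 : K2 * L2 = L2 * K2 by rewrite (lh_KL D2) (lh_LK D2).
elim/ltn_ind: n => -[|[|n]] IH; first by rewrite mulr1 mul1r.
  exact/commZ/(lh_KY D2).
rewrite imagSS /imag_gap; apply: commD.
  apply: commD; apply/commZ/commM; rewrite ?CK2 //; last exact: IH.
  by apply: commM; rewrite ?CK2 //; apply: (K2E vtr D).
apply: commN; rewrite /imag_fix; case: eqP => _; last by rewrite mulr0 mul0r.
apply: commM; rewrite ?CK2 //; apply: commM => //.
exact: (lh_KK' D2).
Qed.

Lemma L2th n : L2 * th n = th n * L2.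
Proof. exact: (comm_inv (lh_KL D2) (lh_LK D2) (K2th n)). Qed.

(** The bracket of X with E_{j,0} is a combination of defects on the diagonals
    j + 1 and j - 1. *)
Lemma X_th n : (forall d : int, -1 <= d -> d < n%:Z -> shifted d) ->
  forall j, (j <= n)%N -> X * th j = th j * X.
Proof.
move=> sh; elim/ltn_ind => -[|[|j]] IH le_j; first by rewrite mulr1 mul1r.
  by rewrite /= -scalerAl -scalerAr.
have XE : X * E j 0 = E j 0 * X.
  have s1 : defect j (0 - 1) = 0 by apply: (sh (j%:Z + 1)); lia.
  have s2 : defect (j%:Z - 1) 0 = 0 by apply: (sh (j%:Z - 1)); lia.
  by apply/eqP; rewrite -subr_eq0 (adXE vtr D) s1 s2 scaler0 subr0.
have XL2 : X * L2 = L2 * X.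
  by apply/esym/(comm_inv (lh_KL D2) (lh_LK D2))/(lh_KY D2).
have XK1 := esym (lh_KX D1); have XC := esym CX.
rewrite imagSS /imag_gap; apply: commD.
  apply: commD; apply/commZ/commM => //; last by apply: IH; lia.
  exact: commM.
apply: commN; rewrite /imag_fix; case: eqP => _; last by rewrite mulr0 mul0r.
by apply: commM => //; apply: commM.
Qed.

(** Up to a power of v this is (v^(2n+4) - 1) (v^(2n) + v^4). *)
Lemma alpha_neq0 n : (1 < n)%N ->
  ((v ^+ 2) ^+ n - (v ^- 2) ^+ n) + ((v ^+ 2) ^+ 2 - (v ^- 2) ^+ 2) != 0.
Proof.
move=> n1; have v0 : v != 0 := v_neq0 vtr.
have e : v ^+ (2 * n + 4) *
    (((v ^+ 2) ^+ n - (v ^- 2) ^+ n) + ((v ^+ 2) ^+ 2 - (v ^- 2) ^+ 2))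
  = (v ^+ (2 * n + 4) - 1) * (v ^+ (2 * n) + v ^+ 4).
  rewrite !exprVn -!exprM exprD.
  have x0 : v ^+ (2 * n) != 0 by rewrite expf_neq0.
  rewrite -[(2 * 2)%N]/4%N; move: (v ^+ (2 * n)) x0 => x x0.
  by field; rewrite x0 v0.
apply: contra (_ : (v ^+ (2 * n + 4) - 1) * (v ^+ (2 * n) + v ^+ 4) != 0).
  by move=> /eqP e0; rewrite -e e0 mulr0.
apply: mulf_neq0.
  have -> : (2 * n + 4 = (2 * n + 3).+1)%N by lia.
  by rewrite subr_eq0; apply: v_pow_neq1 vtr _.
rewrite addr_eq0; apply/eqP => e4.
have : v ^+ (4 * n) = v ^+ 8.
  have -> : (4 * n = 2 * n * 2)%N by lia.
  by rewrite (exprM v (2 * n)%N 2) e4 sqrrN -exprM.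
case: (ltngtP n 2) n1 => // [n2|n2] _ e8.
  have := @v_pow_neq1 _ _ vtr (4 * n - 9); have -> : (4 * n - 9).+1 = (4 * n - 8)%N by lia.
  have v8 : v ^+ 8 != 0 by rewrite expf_neq0.
  rewrite -(inj_eq (mulfI v8)) -exprD mulr1; have -> : (8 + (4 * n - 8) = 4 * n)%N by lia.
  by rewrite e8 eqxx.
rewrite n2 -[(2 * 2)%N]/4%N in e4.
have /eqP : 2%:R * v ^+ 4 = 0 by rewrite mulr_natl mulr2n {1}e4 addNr.
by rewrite mulf_eq0 (negbTE (natF_neq0 vtr 1)) expf_eq0 (negbTE v0).
Qed.

(** Two evaluations of [h_n, E_{0,0}] and of [h_2, E_{n-2,0}]. By [logd_mixed]
    they are n (v^(2n) - v^(-2n)) g and 2 (v^4 - v^(-4)) g, with g the defect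
    at (n - 1, -1). Expressing E_{0,0} and E_{n-2,0} by theta_2 and theta_n, they
    are - n w and 2 w up to a common invertible factor, where w is the bracket
    [theta_2, theta_n]. Hence (v^(2n) - v^(-2n) + v^4 - v^(-4)) g = 0. *)
Lemma shifted_step n : (1 < n)%N ->
  (forall d : int, - n%:Z - 1 <= d -> d < n%:Z -> shifted d) ->
  (forall j, (j < n)%N -> th 2 * th j = th j * th 2) ->
  shifted n%:Z /\ th 2 * th n = th n * th 2.
Proof.
move=> n1 sh c2.
have sh' : forall d : int, -1 <= d -> d <= n%:Z - 2 -> shifted d.
  by move=> d d1 d2; apply: sh; lia.
have sh2 : forall d : int, -1 <= d -> d <= 2%:Z - 2 -> shifted d.
  by move=> d d1 d2; apply: sh; lia.
have X_th_n : forall j, (j <= n)%N -> X * th j = th j * X.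
  by apply: X_th => d d1 d2; apply: sh; lia.
(* The defects on the diagonal n are not yet known to vanish, but they are
   brackets of X with elements on the diagonal n - 1. *)
have cov m l : m - l = n%:Z -> defect (m + 1) (l + 1) = C * defect m l.
  move=> dml; have XE m' l' : m' - l' = n%:Z ->
      (v + v^-1) *: defect m' l' = X * E m' (l' + 1) - E m' (l' + 1) * X.
    move=> d'; have s0 : defect (m' - 1) (l' + 1) = 0.
      by apply: (sh (n%:Z - 2)); lia.
    by rewrite (adXE vtr D) addrK s0 subr0.
  apply: (scalerI (two_neq0 vtr)); rewrite XE; last by lia.
  rewrite scalerAr XE //.
  have s1 : E (m + 1) (l + 1 + 1) = C * E m (l + 1).
    by apply: (shiftedE (sh (n%:Z - 1) _ _)); lia.
  by rewrite s1 mulrBr !mulrA CX.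
have adE (x y p q : A) : x = y + p + q -> x - y = p + q.
  by move=> ->; rewrite -(addrA y) addrAC subrr add0r.
pose g := defect (n%:Z - 1) (- 1).
(* All defects on the diagonal n are powers of C times g, and those on the
   diagonal - n vanish. *)
have e1 : logd th n * E 0 0 - E 0 0 * logd th n =
    ((v ^+ 2) ^+ n - (v ^- 2) ^+ n) *: (g *+ n).
  rewrite (adE _ _ _ _ (logd_mixed (N := n) _ _ sh' (leqnn n))).
  have -> : E (0 + n%:Z) 0 - C ^+ n * E 0 (0 - n%:Z) = g *+ n.
    have := @defect_sum n%:Z 0 n; rewrite subrr subr0 !sub0r add0r; apply.
    by move=> m' l' d'; apply: cov.
  have -> : C ^+ n * E (0 - n%:Z) 0 - E 0 (0 + n%:Z) = 0.
    apply/eqP; rewrite -oppr_eq0 opprB; apply/eqP.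
    have := @defect_sum 0 n%:Z n; rewrite subrr add0r => -> => [|m' l' d'].
      rewrite (sh (- n%:Z)) ?mul0rn //; by lia.
    rewrite !(sh (- n%:Z)) ?mulr0 //; by lia.
  by rewrite scaler0 addr0.
have e2 : logd th 2 * E (n%:Z - 2) 0 - E (n%:Z - 2) 0 * logd th 2 =
    ((v ^+ 2) ^+ 2 - (v ^- 2) ^+ 2) *: (g *+ 2).
  rewrite (adE _ _ _ _ (logd_mixed (N := 2) _ _ sh2 (leqnn 2))).
  rewrite subrK.
  have -> : E n%:Z 0 - C ^+ 2 * E (n%:Z - 2) (0 - 2%:Z) = g *+ 2.
    have := @defect_sum n%:Z 0 2; rewrite subr0 !sub0r; apply.
    by move=> m' l' d'; apply: cov.
  have -> : C ^+ 2 * E (n%:Z - 2 - 2%:Z) 0 - E (n%:Z - 2) (0 + 2%:Z) = 0.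
    apply/eqP; rewrite -oppr_eq0 opprB; apply/eqP.
    have := @defect_sum (n%:Z - 2) 2%:Z 2; rewrite subrr add0r => -> => [|m' l' d'].
      rewrite (sh (n%:Z - 4)) ?mul0rn //; by lia.
    rewrite !(sh (n%:Z - 4)) ?mulr0 //; by lia.
  by rewrite scaler0 addr0.
pose K := ((v - v^-1) * v) : F; pose u := K *: (C * g * L2).
have gapad x m : x * C = C * x -> x * L2 = L2 * x ->
    x * gap m - gap m * x = K *: (C * (x * E m 0 - E m 0 * x) * L2).
  move=> xC xL; rewrite /imag_gap -scalerAr -scalerAl -scalerBr; congr (_ *: _).
  by rewrite mulrBr mulrBl !mulrA xC -!mulrA xL.
have hC x j : (forall i, x * th i = th i * x) -> logd th j * x = x * logd th j.
  by move=> xth; rewrite -logd_comm.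
have lin al k : K *: (C * (al *: (g *+ k)) * L2) = al *: (u *+ k).
  rewrite -scalerAr -scalerAl !scalerA mulrC -scalerA; congr (_ *: _).
  by rewrite mulrnAr mulrnAl scalerMnr.
have f1 := gapad (logd th n) 0 (hC _ _ Cth) (hC _ _ L2th).
rewrite e1 lin in f1.
have f2 := gapad (logd th 2) (n%:Z - 2) (hC _ _ Cth) (hC _ _ L2th).
rewrite e2 lin in f2.
have brD x y z : x * z = z * x -> x * (y + z) - (y + z) * x = x * y - y * x.
  by move=> xz; rewrite mulrDr mulrDl xz opprD addrACA subrr addr0.
have fixC x j : x * C = C * x -> x * K1 = K1 * x -> x * L2 = L2 * x ->
    x * imag_fix C K1 L2 j = imag_fix C K1 L2 j * x.
  move=> xC xK xL; rewrite /imag_fix; case: eqP; rewrite ?mulr0 ?mul0r // => _.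
  by do 2 (apply: commM => //).
have thgap j : gap j%:Z = th j.+2 + (imag_fix C K1 L2 j - v *: (C * th j)).
  by rewrite imagSS [imag_fix _ _ _ _ - _]addrC addrA addrAC subrK addrK.
have hfix k j : logd th k * imag_fix C K1 L2 j = imag_fix C K1 L2 j * logd th k.
  by apply: fixC; apply: hC; [exact: Cth | exact: K1th | exact: L2th].
set w := th 2 * th n - th n * th 2.
(* In the recursion for h_n, only the term n theta_n need not commute with
   theta_2. *)
have w1 : - w *+ n = ((v ^+ 2) ^+ n - (v ^- 2) ^+ n) *: (u *+ n).
  rewrite -f1 thgap brD; last first.
    apply: commD (hfix _ _) _; apply/commN/commZ/commM; first exact: hC Cth.
    by rewrite mulr1 mul1r.
  have Sc : (\sum_(j < n) logd th j * th (n - j)) * th 2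
      = th 2 * \sum_(j < n) logd th j * th (n - j).
    rewrite mulr_suml mulr_sumr; apply: eq_bigr => j _; have lt_j := ltn_ord j.
    case: (posnP j) => [->|j0]; first by rewrite logd0 !mul0r mulr0.
    rewrite -mulrA -c2; last by lia.
    rewrite !mulrA; congr (_ * _); apply/esym/logd_comm => i le_i.
    by apply: c2; lia.
  have -> : - w = th n * th 2 - th 2 * th n by rewrite /w opprB.
  rewrite logdE; move: (\sum_(j < n) _) (th 2) (th n) Sc => S t2 tn Sc.
  rewrite mulrBl mulrBr Sc opprB addrA subrK mulrnAl mulrnAr.
  by rewrite -mulrnBl.
(* Here h_2 = 2 theta_2 - theta_1^2, and theta_1 is a multiple of X. *)
have w2 : w *+ 2 = ((v ^+ 2) ^+ 2 - (v ^- 2) ^+ 2) *: (u *+ 2).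
  have h2 : logd th 2 = th 2 *+ 2 - th 1 * th 1.
    rewrite logdE !big_ord_recr big_ord0 /= logd0 mul0r !add0r.
    by rewrite [logd th 1]logdE big_ord_recr big_ord0 /= logd0 mul0r addr0 subr0.
  have th1c j : (j <= n)%N -> th 1 * th j = th j * th 1.
    by move=> le_j; rewrite [th 1]/= -scalerAl -scalerAr X_th_n.
  have th11c j : (j <= n)%N -> th 1 * th 1 * th j = th j * (th 1 * th 1).
    by move=> le_j; rewrite -mulrA th1c // mulrA th1c // mulrA.
  rewrite -f2; have [k nk] : exists k, n = k.+2 by exists (n - 2)%N; lia.
  have -> : n%:Z - 2 = k%:Z by lia.
  rewrite thgap brD; last first.
    apply: commD (hfix _ _) _; apply/commN/commZ/commM; first exact: hC Cth.
    rewrite h2.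
    have ck : th 2 * th k = th k * th 2 by apply: c2; lia.
    have := th11c k ltac:(lia); move: (th 1 * th 1) (th 2) ck => t11 t2 ck e.
    by rewrite mulrBr mulrBl e mulrnAl mulrnAr ck.
  have := th11c n (leqnn n); rewrite -nk h2 /w.
  move: (th 1 * th 1) (th 2) (th n) => t11 t2 tn t11n.
  rewrite mulrBl mulrBr t11n opprB addrA subrK mulrnAl mulrnAr.
  by rewrite -mulrnBl.
have can k (x y : A) : (0 < k)%N -> x *+ k = y *+ k -> x = y.
  case: k => // k _ e; apply: (scalerI (natF_neq0 vtr k)).
  by rewrite !scaler_nat.
have w1' : - w = ((v ^+ 2) ^+ n - (v ^- 2) ^+ n) *: u.
  by apply: (can n); [exact: (ltnW n1) | rewrite w1 -scalerMnr].
have w2' : w = ((v ^+ 2) ^+ 2 - (v ^- 2) ^+ 2) *: u.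
  by apply: (can 2) => //; rewrite w2 -scalerMnr.
have u0 : u = 0.
  apply/eqP; have := addNr w; rewrite w1' w2' -scalerDl => /eqP.
  by rewrite scaler_eq0 (negbTE (alpha_neq0 n1)).
have w0 : w = 0 by rewrite w2' u0 scaler0.
split; last by apply/eqP; rewrite -subr_eq0 -/w w0.
have g0 : g = 0.
  apply: (Cinj D); rewrite -[C * g]mulr1 -(lh_LK D2) mulrA.
  move/eqP: u0; rewrite scaler_eq0 => /orP[|/eqP ->]; last by rewrite mul0r.
  rewrite mulf_eq0 (negbTE (v_neq0 vtr)) orbF subr_eq0 => /eqP vv.
  have := v_pow_neq1 vtr 1; rewrite expr2 {2}vv mulfV ?eqxx //.
  exact: (v_neq0 vtr).
have -> : n%:Z = n%:Z - 1 - (- 1) by lia.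
exact: (shifted1 D).
Qed.

End Loop2.

Section Loop3.
Variables (F : fieldType) (v : F) (A : algType F).
Hypothesis vtr : forall p : zpoly, peval v p = 0 -> all (Z.eqb 0) p.
Variables (T : {lrmorphism A -> A}) (eps : F) (a b : int -> A).
Variables (C Ci K1 L1 K2 L2 X Y : A).
Hypothesis D : loop_data v T eps a b C Ci K1 L1 K2 L2 X Y.

Let D' := loop_data_swap D.
Local Notation E := (mixed v a b).
Local Notation shifted := (mixed_shifted v a b C).
Local Notation th := (imag v C K1 L2 X E).
Local Notation th' := (imag v C K2 L1 Y (mixed v b a)).

Lemma imag2_comm1 :
  (forall d : int, -1 <= d -> d < 2 -> shifted d) -> th 2 * th 1 = th 1 * th 2.
Proof.
move=> sh; have := X_th vtr D (n := 2) sh (leqnn 2).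
by rewrite [th 1]/= -scalerAl -scalerAr => ->.
Qed.

Lemma shifted_base (d : int) : -3 <= d -> d < 2 -> shifted d.
Proof.
move=> d1 d2; have [s0 s2] := shifted_0_m2 vtr D.
have : [\/ d = -3, d = -2, d = -1 | d = 0 \/ d = 1].
  have : [|| d == -3, d == -2, d == -1, d == 0 | d == 1] by lia.
  by case/or4P=> [/eqP|/eqP|/eqP|/orP[]/eqP]; [constructor 1|constructor 2|
    constructor 3|constructor 4; left|constructor 4; right].
case=> [->|->|->|[->|->]] //.
- exact: (shifted_m3 vtr D).
- exact: (shifted_m1 vtr D).
- exact: (shifted_1 vtr D).
Qed.

End Loop3.

Section Loop4.
Variables (F : fieldType) (v : F) (A : algType F).
Hypothesis vtr : forall p : zpoly, peval v p = 0 -> all (Z.eqb 0) p.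
Variables (T : {lrmorphism A -> A}) (eps : F) (a b : int -> A).
Variables (C Ci K1 L1 K2 L2 X Y : A).
Hypothesis D : loop_data v T eps a b C Ci K1 L1 K2 L2 X Y.

Let D' := loop_data_swap D.
Local Notation E := (mixed v a b).
Local Notation shifted := (mixed_shifted v a b C).
Local Notation th := (imag v C K1 L2 X E).
Local Notation th' := (imag v C K2 L1 Y (mixed v b a)).

Lemma shifted_swapped d : mixed_shifted v b a C d -> shifted (-2 - d).
Proof. exact: shifted_swap. Qed.

(** Applying [shifted_step] to the two families in turn enlarges the range of
    diagonals by one on each side, since exchanging them maps d to -2 - d. *)
Lemma shifted_upto n : (1 < n)%N ->
  [/\ forall d : int, - n%:Z - 1 <= d -> d < n%:Z -> shifted d,
      forall j, (j < n)%N -> th 2 * th j = th j * th 2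
    & forall j, (j < n)%N -> th' 2 * th' j = th' j * th' 2].
Proof.
elim: n => [|n IH] // n1; have [n2|] := ltnP 1 n; last first.
  move=> n2; have -> : n = 1%N by lia.
  split=> [d d1 d2|[|[|j]]|[|[|j]]] //; rewrite ?mulr1 ?mul1r //.
  - by apply: (shifted_base vtr D); lia.
  - by move=> _; apply: (imag2_comm1 vtr D) => d d1 d2; apply: (shifted_base vtr D); lia.
  - by move=> _; apply: (imag2_comm1 vtr D') => d d1 d2; apply: (shifted_base vtr D'); lia.
have {}[sh c c'] := IH n2.
have [s1 c1] := shifted_step vtr D n2 sh c.
have sh' (d : int) : - n%:Z - 1 <= d -> d < n%:Z -> mixed_shifted v b a C d.
  move=> d1 d2; have -> : d = -2 - (-2 - d) by lia.
  by apply: (shifted_swap (sh _ _ _)); lia.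
have [s2 c2] := shifted_step vtr D' n2 sh' c'.
split=> [d d1 d2|j|j].
- have [->//|dn] := eqVneq d n%:Z.
  have [->|dn'] := eqVneq d (-2 - n%:Z); first exact: shifted_swapped.
  by apply: sh; lia.
- by rewrite ltnS leq_eqVlt => /predU1P[->|/c].
- by rewrite ltnS leq_eqVlt => /predU1P[->|/c'].
Qed.

Lemma all_shifted d : shifted d.
Proof.
have [sh _ _] := @shifted_upto (`|d| + 2) ltac:(lia).
by apply: sh; lia.
Qed.

Lemma T_imag n : T (th n) = th n.
Proof. by apply: (T_imag_upto D (N := n)) => // d _ _; apply: all_shifted. Qed.

End Loop4.

(** * The quasi-split algebra by rewriting *)

Section Relations.
Variables (F : fieldType) (v : F) (A : algType F).

(** The image of B_0 under T_1. *)
Definition T1B0 (B0 B1 B2 K1 K2 : A) : A :=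
  v *: comm (comm (qcomm v B0 B1) B2) (qcomm v B2 B1)
  - comm B0 (qcomm (v ^+ 3) B2 B1) * K1 + v *: (B0 * K1 * K2).

(** The presentation of the quasi-split algebra, with the Serre relations solved
    for the word that comes last in the lexicographic order with 0 < 1 < 2. *)
Record qsp_rel (B0 B1 B2 K0 K1 K2 L0 L1 L2 : A) : Prop := QspRel {
  q_KL0 : K0 * L0 = 1; q_LK0 : L0 * K0 = 1;
  q_KL1 : K1 * L1 = 1; q_LK1 : L1 * K1 = 1;
  q_KL2 : K2 * L2 = 1; q_LK2 : L2 * K2 = 1;
  q_K01 : K0 * K1 = K1 * K0; q_K02 : K0 * K2 = K2 * K0;
  q_K12 : K1 * K2 = K2 * K1;
  q_K0B0 : K0 * B0 = B0 * K0; q_K0B1 : K0 * B1 = B1 * K0;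
  q_K0B2 : K0 * B2 = B2 * K0;
  q_K1B0 : K1 * B0 = B0 * K1; q_K1B1 : K1 * B1 = v ^- 3 *: (B1 * K1);
  q_K1B2 : K1 * B2 = v ^+ 3 *: (B2 * K1);
  q_K2B0 : K2 * B0 = B0 * K2; q_K2B1 : K2 * B1 = v ^+ 3 *: (B1 * K2);
  q_K2B2 : K2 * B2 = v ^- 3 *: (B2 * K2);
  q_211 : B2 * B1 * B1 = (v + v^-1) *: (B1 * B2 * B1) - B1 * B1 * B2
    - (v + v^-1) *: (v *: (K1 * B1) + v *: (B1 * K2));
  q_221 : B2 * B2 * B1 = (v + v^-1) *: (B2 * B1 * B2) - B1 * B2 * B2
    - (v + v^-1) *: (v *: (K2 * B2) + v *: (B2 * K1));
  q_110 : B1 * B1 * B0 = (v + v^-1) *: (B1 * B0 * B1) - B0 * B1 * B1;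
  q_220 : B2 * B2 * B0 = (v + v^-1) *: (B2 * B0 * B2) - B0 * B2 * B2;
  q_100 : B1 * B0 * B0 = (v + v^-1) *: (B0 * B1 * B0) - B0 * B0 * B1
    - v^-1 *: (K0 * B1);
  q_200 : B2 * B0 * B0 = (v + v^-1) *: (B0 * B2 * B0) - B0 * B0 * B2
    - v^-1 *: (K0 * B2);
}.

Record braid_images (T0 T1 : A -> A) (B0 B1 B2 K0 K1 K2 L0 L1 L2 : A) : Prop :=
  BraidImages {
  i0_K0 : T0 K0 = L0; i0_K1 : T0 K1 = K1 * K0; i0_K2 : T0 K2 = K2 * K0;
  i0_B0 : T0 B0 = B0 * L0; i0_B1 : T0 B1 = qcomm v B1 B0;
  i0_B2 : T0 B2 = qcomm v B2 B0;
  i1_K1 : T1 K1 = v^-1 *: L2; i1_K2 : T1 K2 = v^-1 *: L1;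
  i1_K0 : T1 K0 = v ^+ 2 *: (K0 * K1 ^+ 2 * K2 ^+ 2);
  i1_B1 : T1 B1 = - (v ^- 2 *: (B1 * L2));
  i1_B2 : T1 B2 = - (v ^- 2 *: (B2 * L1));
  i1_B0 : T1 B0 = T1B0 B0 B1 B2 K1 K2;
}.

Lemma qsp_rel_swap B0 B1 B2 K0 K1 K2 L0 L1 L2 :
  qsp_rel B0 B1 B2 K0 K1 K2 L0 L1 L2 -> qsp_rel B0 B2 B1 K0 K2 K1 L0 L2 L1.
Proof.
have solve (p x y t : A) : x = p - y - t -> y = p - x - t.
  by move=> ->; rewrite -(addrA p) -opprD subrK opprB addrCA subrr addr0.
by case=> *; split=> //; exact: solve.
Qed.

End Relations.

(** Conjugation by K_0^k0 K_1^k1 K_2^k2 multiplies the letter i by v to the power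
    given by the pairing of (k0, k1, k2) with this weight. *)
Definition qwt (i : nat) : tor :=
  match i with 1 => (0, -3, 3)%BZ | 2 => (0, 3, -3)%BZ | _ => t0 end.

Declare Scope expr_scope.
Delimit Scope expr_scope with X.
Bind Scope expr_scope with expr.
Local Notation "a + b" := (EAdd a b) : expr_scope.
Local Notation "a - b" := (EAdd a (EOpp b)) : expr_scope.
Local Notation "- a" := (EOpp a) : expr_scope.
Local Notation "a * b" := (EMul a b) : expr_scope.
Local Notation "c *: a" := (EScale c a) : expr_scope.
Definition eK0 : expr := ET (1, 0, 0)%BZ.
Definition eK1 : expr := ET (0, 1, 0)%BZ.
Definition eK2 : expr := ET (0, 0, 1)%BZ.
Definition eL0 : expr := ET (-1, 0, 0)%BZ.
Definition eL1 : expr := ET (0, -1, 0)%BZ.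
Definition eL2 : expr := ET (0, 0, -1)%BZ.
Definition eB0 : expr := EX 0.
Definition eB1 : expr := EX 1.
Definition eB2 : expr := EX 2.
Local Notation two := (SAdd SV SInv).

Definition ecomm (c : scal) (a b : expr) : expr := (a * b - c *: (b * a))%X.
Definition ecomm1 (a b : expr) : expr := (a * b - b * a)%X.

Definition serre_rules : seq (word * expr) := [::
  ([:: 2; 1; 1]%N, (two *: (eB1 * eB2 * eB1) - eB1 * eB1 * eB2
     - two *: (SV *: (eK1 * eB1) + SV *: (eB1 * eK2)))%X);
  ([:: 2; 2; 1]%N, (two *: (eB2 * eB1 * eB2) - eB1 * eB2 * eB2
     - two *: (SV *: (eK2 * eB2) + SV *: (eB2 * eK1)))%X);
  ([:: 1; 1; 0]%N, (two *: (eB1 * eB0 * eB1) - eB0 * eB1 * eB1)%X);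
  ([:: 2; 2; 0]%N, (two *: (eB2 * eB0 * eB2) - eB0 * eB2 * eB2)%X);
  ([:: 1; 0; 0]%N, (two *: (eB0 * eB1 * eB0) - eB0 * eB0 * eB1
     - SInv *: (eK0 * eB1))%X);
  ([:: 2; 0; 0]%N, (two *: (eB0 * eB2 * eB0) - eB0 * eB0 * eB2
     - SInv *: (eK0 * eB2))%X)].

Definition fuel : nat := (100 * 100)%N.

Definition rules0 : seq rule :=
  [seq (p.1, norm qwt [::] fuel [::] p.2) | p <- serre_rules].

(** A part of the completion of the Serre rules, large enough for the identities
    proved below. Each triple lists two rules and the length of their overlap,
    followed by the leading word of the rule that results. *)
Definition overlaps : seq (nat * nat * nat) := [::
  (0, 2, 2);   (* 2101 *)
  (0, 2, 1);   (* 20111 *)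
  (1, 4, 1);   (* 21020 *)
  (1, 2, 1);   (* 21210 *)
  (6, 4, 1);   (* 201010 *)
  (7, 2, 2);   (* 201011 *)
  (8, 5, 2);   (* 202010 *)
  (3, 7, 2);   (* 212011 *)
  (1, 8, 2);   (* 212020 *)
  (1, 9, 2);   (* 212120 *)
  (3, 12, 2);  (* 2020201 *)
  (3, 11, 2);  (* 2120101 *)
  (9, 8, 3);   (* 2120210 *)
  (13, 4, 1);  (* 20120101 *)
  (14, 12, 4); (* 21201020 *)
  (1, 17, 2);  (* 21201210 *)
  (3, 19, 2);  (* 202011201 *)
  (21, 4, 2)   (* 212010210 *)
]%N.

Definition all_rules : seq rule := derive qwt fuel rules0 overlaps.
(** Evaluated once, so that no later computation repeats the completion. *)
Definition qrules : seq rule := Eval vm_compute in all_rules.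

Lemma qrulesE : qrules = all_rules.
Proof. by vm_compute. Qed.

Definition eT1B0 (x1 x2 k1 k2 : expr) : expr :=
  (SV *: ecomm1 (ecomm1 (ecomm SV eB0 x1) x2) (ecomm SV x2 x1)
   - ecomm1 eB0 (ecomm (SPow 3) x2 x1) * k1 + SV *: (eB0 * k1 * k2))%X.

Definition images0 : seq expr :=
  [:: (eB0 * eL0)%X; ecomm SV eB1 eB0; ecomm SV eB2 eB0].
Definition images1 : seq expr :=
  [:: eT1B0 eB1 eB2 eK1 eK2; (- (SInvPow 2 *: (eB1 * eL2)))%X;
      (- (SInvPow 2 *: (eB2 * eL1)))%X].

Definition endo0 : endo :=
  ([seq norm qwt qrules fuel [::] e | e <- images0],
   ((0, (-1, 0, 0)), (0, (1, 1, 0)), (0, (1, 0, 1)))%BZ).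
Definition endo1 : endo :=
  ([seq norm qwt qrules fuel [::] e | e <- images1],
   ((2, (1, 2, 2)), (-1, (0, 0, -1)), (-1, (0, -1, 0)))%BZ).
Definition qendos : seq endo := Eval vm_compute in [:: endo0; endo1].

Lemma qendosE : qendos = [:: endo0; endo1].
Proof. by vm_compute. Qed.

(** In what follows a prefix e marks expressions, and a suffix _1 or _2 stands for
    the index -1 or -2. *)
Definition eTw (e : expr) : expr := EHom 0 (EHom 1 e).
Definition eW (x y k : expr) : expr :=
  (ecomm (SPow 2) x (ecomm SV y eB0) - SV *: (eB0 * k))%X.
(** Theta_{1,1} and Theta_{2,1} for the signs o(1) = 1 and o(2) = -1. *)
Definition eX : expr := (- eW eB1 eB2 eK1)%X.
Definition eY : expr := eW eB2 eB1 eK2.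
Definition eC : expr := (- (SV *: ET (1, 1, 1)%BZ))%X.
Definition eCi : expr := (- (SInv *: ET (-1, -1, -1)%BZ))%X.
Definition ea_1 : expr := eTw eB1.
Definition ea_2 : expr := eTw ea_1.
Definition eb_1 : expr := (- eTw eB2)%X.
Definition eb_2 : expr := (- eTw eb_1)%X.
(** The relation [Theta_{1,1}, a_0] = (v + v^-1) a_1 + C a_(-1), solved for a_1;
    that the result is mapped to a_0 by T is checked afterwards. *)
Definition ea1 : expr := (SHalf *: (eX * eB1 - eB1 * eX - eC * ea_1))%X.
Definition eb1 : expr := (SHalf *: (eY * eB2 - eB2 * eY - eC * eb_1))%X.
Definition emixed (am am1 bl bl1 : expr) : expr :=
  (bl * am - SInv *: (am * bl) + (am1 * bl1 - SInv *: (bl1 * am1)))%X.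
Definition eEa : expr := emixed eB1 ea1 eB2 eb_1.
Definition eEb : expr := emixed eB2 eb1 eB1 ea_1.
Definition egap : scal := SAdd SV (SOpp SInv).
Definition eth1 (x : expr) : expr := (egap *: x)%X.
Definition eth2 (k l e : expr) : expr :=
  (SMul egap SV *: (eC * e * l) + SV *: (eC * E1) - eC * (k * l))%X.
(** Both sides of the exchange relation of degree 2 at one index. *)
Definition eweight (s t s' t' : scal) (th2 th1 q q1 q_1 : expr) : expr * expr :=
  ((th2 * q - s *: (th1 * q1) - t *: (eC * (th1 * q_1))
      + SMul s t *: (eC * (E1 * q)))%X,
   (q * th2 - s' *: (q1 * th1) - t' *: (eC * (q_1 * th1))
      + SMul s' t' *: (eC * (q * E1)))%X).

Section Torus.
Variables (F : fieldType) (v : F) (A : algType F).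
Hypothesis vtr : forall p : zpoly, peval v p = 0 -> all (Z.eqb 0) p.

Lemma zpow_comm (x x' y : A) (z : Z) : x * x' = 1 -> x' * x = 1 ->
  x * y = y * x -> zpow x x' z * y = y * zpow x x' z.
Proof.
move=> xx x'x xy; case: z => [|p|p] /=; first by rewrite mulr1 mul1r.
  exact/esym/commrX/esym.
exact/esym/commrX/esym/(comm_inv xx x'x).
Qed.

Lemma zpow_qcomm (x x' y : A) (e : Z) (z : Z) : x * x' = 1 -> x' * x = 1 ->
  x * y = zpow v v^-1 e *: (y * x) ->
  zpow x x' z * y = zpow v v^-1 (z * e)%BZ *: (y * zpow x x' z).
Proof.
move=> xx x'x xy; have zpD := zvD vtr.
have x'y : x' * y = zpow v v^-1 (- e)%BZ *: (y * x').
  rewrite -[LHS]mulr1 -xx -mulrA [y * _]mulrA.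
  have -> : y * x = zpow v v^-1 (- e)%BZ *: (x * y).
    by rewrite xy scalerA -zpD Z.add_opp_diag_l scale1r.
  by rewrite -scalerAl -scalerAr -!mulrA (mulrA x') x'x mul1r.
have pos (u : A) (f : Z) n : u * y = zpow v v^-1 f *: (y * u) ->
    u ^+ n * y = zpow v v^-1 (Z.of_nat n * f)%BZ *: (y * u ^+ n).
  move=> uy; elim: n => [|n IH]; first by rewrite mul1r mulr1 scale1r.
  rewrite exprS -mulrA IH -scalerAr [u * (y * _)]mulrA uy -scalerAl scalerA -zpD.
  by rewrite -mulrA; congr (zpow _ _ _ *: _); Lia.lia.
case: z => [|p|p].
- by rewrite /= mul1r mulr1 scale1r.
- by rewrite /= (pos _ _ _ xy) positive_nat_Z.
rewrite /= (pos _ _ _ x'y) positive_nat_Z; congr (zpow _ _ _ *: _).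
by case: (e).
Qed.

End Torus.

Section Model.
Variables (F : fieldType) (v : F) (A : algType F).
Hypothesis vtr : forall p : zpoly, peval v p = 0 -> all (Z.eqb 0) p.
Variables B0 B1 B2 K0 K1 K2 L0 L1 L2 : A.
Hypothesis R : qsp_rel v B0 B1 B2 K0 K1 K2 L0 L1 L2.

Definition qx (i : nat) : A := match i with 0 => B0 | 1 => B1 | 2 => B2 | _ => 0 end.
Definition qT (k : tor) : A :=
  zpow K0 L0 k.1.1 * zpow K1 L1 k.1.2 * zpow K2 L2 k.2.

Lemma qT0 : qT t0 = 1.
Proof. by rewrite /qT /= !mulr1. Qed.

Lemma qTD k l : qT (tadd k l) = qT k * qT l.
Proof.
case: k l => [[k0 k1] k2] [[m0 m1] m2]; rewrite /qT /=.
rewrite (zpowD (q_KL0 R) (q_LK0 R)) (zpowD (q_KL1 R) (q_LK1 R)).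
rewrite (zpowD (q_KL2 R) (q_LK2 R)).
have c10 z w : zpow K1 L1 z * zpow K0 L0 w = zpow K0 L0 w * zpow K1 L1 z.
  apply: (zpow_comm _ (q_KL1 R) (q_LK1 R)).
  exact/esym/(zpow_comm _ (q_KL0 R) (q_LK0 R))/(q_K01 R).
have c20 z w : zpow K2 L2 z * zpow K0 L0 w = zpow K0 L0 w * zpow K2 L2 z.
  apply: (zpow_comm _ (q_KL2 R) (q_LK2 R)).
  exact/esym/(zpow_comm _ (q_KL0 R) (q_LK0 R))/(q_K02 R).
have c21 z w : zpow K2 L2 z * zpow K1 L1 w = zpow K1 L1 w * zpow K2 L2 z.
  apply: (zpow_comm _ (q_KL2 R) (q_LK2 R)).
  exact/esym/(zpow_comm _ (q_KL1 R) (q_LK1 R))/(q_K12 R).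
rewrite -!mulrA; congr (_ * _).
rewrite [in RHS](mulrA (zpow K2 L2 k2)) c20 -!mulrA.
rewrite [in RHS](mulrA (zpow K1 L1 k1)) c10 -!mulrA; congr (_ * (_ * _)).
by rewrite [in RHS](mulrA (zpow K2 L2 k2)) c21 -!mulrA.
Qed.

Lemma qTx k i : qT k * qx i = zpow v v^-1 (tdot k (qwt i)) *: (qx i * qT k).
Proof.
case: k => [[k0 k1] k2]; rewrite /qT /=.
have one n (a b c y : A) (e0 e1 e2 : Z) :
    a * y = zpow v v^-1 e0 *: (y * a) -> b * y = zpow v v^-1 e1 *: (y * b) ->
    c * y = zpow v v^-1 e2 *: (y * c) -> n = (e0 + e1 + e2)%BZ ->
    a * b * c * y = zpow v v^-1 n *: (y * (a * b * c)).
  move=> ay b_y cy ->.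
  rewrite -mulrA cy -scalerAr (mulrA _ y c) -(mulrA a b y) b_y -scalerAr
    -scalerAl (mulrA a y) ay.
  by rewrite -!scalerAl !scalerA -!(zvD vtr) -!mulrA; congr (zpow _ _ _ *: _); Lia.lia.
have z0 y : K0 * y = y * K0 -> zpow K0 L0 k0 * y = zpow v v^-1 0 *: (y * zpow K0 L0 k0).
  by move=> e; rewrite scale1r; exact: zpow_comm (q_KL0 R) (q_LK0 R) e.
have z1 := zpow_qcomm vtr k1 (q_KL1 R) (q_LK1 R).
have z2 := zpow_qcomm vtr k2 (q_KL2 R) (q_LK2 R).
have u (y w : A) : y = w -> y = zpow v v^-1 0 *: w by rewrite scale1r.
case: i => [|[|[|i]]] /=; last by rewrite mulr0 mul0r scaler0.
- apply: one (z0 _ (q_K0B0 R)) (z1 _ 0%BZ (u _ _ (q_K1B0 R)))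
    (z2 _ 0%BZ (u _ _ (q_K2B0 R))) _; Lia.lia.
- apply: one (z0 _ (q_K0B1 R)) (z1 _ (-3)%BZ _) (z2 _ 3%BZ (q_K2B1 R)) _.
    by rewrite (q_K1B1 R) /= exprVn.
  by Lia.lia.
apply: one (z0 _ (q_K0B2 R)) (z1 _ 3%BZ (q_K1B2 R)) (z2 _ (-3)%BZ _) _.
  by rewrite (q_K2B2 R) /= exprVn.
by Lia.lia.
Qed.

Lemma norm_rules_ok (l : seq (word * expr)) fs :
  foldr (fun p P => wf [::] p.2 /\ wval qx p.1 = eval v qx qT fs p.2 /\ P) True l ->
  rules_ok v qx qT [seq (p.1, norm qwt [::] fuel [::] p.2) | p <- l].
Proof.
elim: l => [|[w e] l IH] //= [we [wE /IH]]; split=> //.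
by rewrite /rule_ok /= (normE (fs := fs) vtr qT0 qTD qTx _ _ _ we) //= wE.
Qed.

Lemma rules0_ok : rules_ok v qx qT rules0.
Proof.
rewrite /rules0; apply: (@norm_rules_ok serre_rules (fun=> idfun : {lrmorphism A -> A})).
rewrite /qT /= !mulr1 !mul1r !expr1 !mulrA.
by rewrite (q_211 R) (q_221 R) (q_110 R) (q_220 R) (q_100 R) (q_200 R).
Qed.

Lemma qrules_ok : rules_ok v qx qT qrules.
Proof.
rewrite qrulesE /all_rules.
exact (@derive_ok _ _ _ vtr qx qwt qT qT0 qTD qTx fuel rules0 overlaps rules0_ok).
Qed.

(** The image of B_0 is invariant under exchanging the indices 1 and 2, though its
    defining formula is not. Hence only one of the two choices of signs has to be
    computed. *)
Lemma T1B0_sym : T1B0 v B0 B1 B2 K1 K2 = T1B0 v B0 B2 B1 K2 K1.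
Proof.
have : decide qwt qrules fuel [::] (eT1B0 eB1 eB2 eK1 eK2)
    (eT1B0 eB2 eB1 eK2 eK1) by vm_compute.
move/(@decideE _ _ _ vtr _ _ _ qT0 qTD qTx _ _ [::] (fun=> idfun) _ _ qrules_ok I).
by rewrite /qT /= !mulr1 !mul1r !expr1.
Qed.

Lemma zpow_tor (x y : A) e r k : x * y = 1 -> y * x = 1 ->
  x = zpow v v^-1 e *: qT r ->
  zpow x y k = zpow v v^-1 (e * k)%BZ *: qT (tscale k r).
Proof.
move=> xy yx xE.
have gS z : zpow v v^-1 (e * Z.succ z)%BZ *: qT (tscale (Z.succ z) r)
    = zpow v v^-1 (e * z)%BZ *: qT (tscale z r) * x.
  rewrite xE -scalerAl -scalerAr scalerA -qTD -(zvD vtr).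
  congr (zpow _ _ _ *: qT _); first by Lia.lia.
  case: r {xE} => [[r0 r1] r2] /=; congr (_, _, _); Lia.lia.
elim/Z.peano_ind: k => [|k IH|k IH].
- rewrite Z.mul_0_r scale1r; case: r {xE gS} => [[r0 r1] r2] /=.
  by rewrite /qT /= !mulr1.
- by rewrite gS zpow_succ // IH.
rewrite -[LHS]mulr1 -xy mulrA -zpow_succ // Z.succ_pred IH.
by rewrite -{1 2}(Z.succ_pred k) gS -mulrA xy mulr1.
Qed.

Lemma endo_ok_of (f : {lrmorphism A -> A}) (im : seq expr) e0 r0 e1 r1 e2 r2 :
  all (wf [::]) im -> (forall i, f (qx i) = eval v qx qT (fun=> idfun : {lrmorphism A -> A}) (nth E0 im i)) ->
  f K0 = zpow v v^-1 e0 *: qT r0 -> f K1 = zpow v v^-1 e1 *: qT r1 ->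
  f K2 = zpow v v^-1 e2 *: qT r2 ->
  endo_ok v qx qT ([seq norm qwt qrules fuel [::] e | e <- im],
                   ((e0, r0), (e1, r1), (e2, r2))) f.
Proof.
move=> wim fx fK0 fK1 fK2; split=> [i|[[k0 k1] k2]].
  rewrite fx; case: (ltnP i (size im)) => lt_i; last first.
    by rewrite !nth_default ?size_map.
  rewrite (nth_map E0) //.
  rewrite (normE (fs := fun=> idfun) vtr qT0 qTD qTx _ qrules_ok) //.
  by have /all_nthP := wim; apply.
have fz (K L : A) z : f (zpow K L z) = zpow (f K) (f L) z.
  by case: z => [|p|p] /=; rewrite ?rmorph1 ?rmorphXn.
rewrite /qT /= !rmorphM /= !fz -/(qT _).
have fKL (K L : A) : K * L = 1 -> f K * f L = 1.
  by move=> KL; rewrite -rmorphM KL rmorph1.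
rewrite (zpow_tor _ (fKL _ _ (q_KL0 R)) (fKL _ _ (q_LK0 R)) fK0).
rewrite (zpow_tor _ (fKL _ _ (q_KL1 R)) (fKL _ _ (q_LK1 R)) fK1).
rewrite (zpow_tor _ (fKL _ _ (q_KL2 R)) (fKL _ _ (q_LK2 R)) fK2).
rewrite !(=^~ scalerAl, =^~ scalerAr) !scalerA -!(zvD vtr) -!qTD.
congr (zpow _ _ _ *: qT _); first by Lia.lia.
move: (tscale _ _) (tscale _ _) (tscale _ _) => [[? ?] ?] [[? ?] ?] [[? ?] ?] /=.
by congr (_, _, _); Lia.lia.
Qed.

Variables T0 T1 : {lrmorphism A -> A}.
Hypothesis I : braid_images v T0 T1 B0 B1 B2 K0 K1 K2 L0 L1 L2.

Definition qf (i : nat) : {lrmorphism A -> A} := if i == 0%N then T0 else T1.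

Lemma endo0_ok : endo_ok v qx qT endo0 T0.
Proof.
apply: endo_ok_of => //.
- case=> [|[|[|i]]] /=; rewrite /qT /= ?mulr1 ?mul1r ?expr1.
  + exact: i0_B0 I.
  + exact: i0_B1 I.
  + exact: i0_B2 I.
  + by rewrite nth_nil rmorph0.
- by rewrite (i0_K0 I) /qT /= !mulr1 scale1r expr1.
- by rewrite (i0_K1 I) /qT /= !mulr1 scale1r !expr1 (q_K01 R).
- by rewrite (i0_K2 I) /qT /= !mulr1 scale1r !expr1 (q_K02 R).
Qed.

Lemma endo1_ok : endo_ok v qx qT endo1 T1.
Proof.
apply: endo_ok_of => //.
- case=> [|[|[|i]]] /=; rewrite /qT /= ?mulr1 ?mul1r ?expr1.
  + exact: i1_B0 I.
  + exact: i1_B1 I.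
  + exact: i1_B2 I.
  + by rewrite nth_nil rmorph0.
- by rewrite (i1_K0 I) /qT /= !expr1.
- by rewrite (i1_K1 I) /qT /= !mul1r expr1.
- by rewrite (i1_K2 I) /qT /= !mul1r mulr1 expr1.
Qed.

Lemma qendos_ok : endos_ok v qx qT qf 0 qendos.
Proof. by rewrite qendosE; split; [exact: endo0_ok | split=> //; exact: endo1_ok]. Qed.

Definition qeval : expr -> A := eval v qx qT qf.

Lemma qfact e1 e2 : decide qwt qrules fuel qendos e1 e2 -> qeval e1 = qeval e2.
Proof. exact: (decideE vtr qT0 qTD qTx qrules_ok qendos_ok). Qed.

Variables (T : {lrmorphism A -> A}) (a b : int -> A).
Hypothesis TE : forall x, T x = T0 (T1 x).
Hypothesis Tinj : injective T.
Hypotheses (a0 : a 0 = B1) (b0 : b 0 = B2).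
Hypothesis Ta : forall k, T (a k) = a (k - 1).
Hypothesis Tb : forall k, T (b k) = - b (k - 1).

(** The unit u accounts for the signs and for the factor - C^-1 by which T
    rescales K_1 and K_2. *)
Lemma T_shift (f g : int -> A) (u w : A) k0 : w * u = 1 ->
  (forall k, T (f (k + 1)) = u * f k) -> (forall k, T (g (k + 1)) = u * g k) ->
  f k0 = g k0 -> forall k, f k = g k.
Proof.
move=> wu Tf Tg; apply: shift_ind => k; split=> [e|/(congr1 T)].
  by apply: Tinj; rewrite Tf Tg e.
by rewrite Tf Tg => /(congr1 ( *%R w)); rewrite !mulrA wu !mul1r.
Qed.

Lemma K_shift (C Ci K : A) (c : int -> A) (eps s : F) :
  C * Ci = 1 -> Ci * C = 1 -> C * T K = - K -> eps * eps = 1 ->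
  (forall k, T (c (k + 1)) = eps *: c k) -> (forall k, Ci * c k = c k * Ci) ->
  K * c 0 = s *: (c 0 * K) -> forall k, K * c k = s *: (c k * K).
Proof.
move=> CCi CiC TK e1 Tc Cc; have {}TK : T K = - Ci * K.
  by rewrite -[LHS]mul1r -CiC -mulrA TK mulrN mulNr.
apply: (T_shift (u := - eps *: Ci) (w := - eps *: C)) => [|k|k].
- by rewrite -scalerAl -scalerAr scalerA mulrNN e1 scale1r CCi.
- by rewrite rmorphM /= TK Tc -scalerAr !mulNr scalerN -scalerAl scaleNr mulrA.
rewrite linearZ rmorphM /= TK Tc -!scalerAl -!scalerAr.
rewrite !mulNr mulrN !scalerN scaleNr; congr (- _); rewrite !scalerA mulrC.
by congr (_ *: _); rewrite mulrA -Cc mulrA.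
Qed.

Let Ta1 k : T (a (k + 1)) = a k. Proof. by rewrite Ta addrK. Qed.
Let Tb1 k : T (b (k + 1)) = - b k. Proof. by rewrite Tb addrK. Qed.

Local Notation val := qeval.

Ltac by_rewriting e1 e2 := refine (@qfact e1 e2 _); vm_compute; reflexivity.

Let a_1 : a (-1) = val ea_1.
Proof. by rewrite -[-1]add0r -Ta a0 TE. Qed.
Let b_1 : b (-1) = val eb_1.
Proof. by rewrite -[-1]add0r -[LHS]opprK -Tb b0 TE. Qed.
Let a_2 : a (-2) = val ea_2.
Proof. by rewrite -[-2]/(-1 - 1 : int) -Ta a_1 TE. Qed.
Let b_2 : b (-2) = val eb_2.
Proof. by rewrite -[-2]/(-1 - 1 : int) -[LHS]opprK -Tb b_1 TE. Qed.
Let a1 : a 1 = val ea1.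
Proof.
apply: Tinj; rewrite (Ta1 0) a0 TE; apply: esym.
by_rewriting (eTw ea1) eB1.
Qed.
Let b1 : b 1 = val eb1.
Proof.
apply: Tinj; rewrite (Tb1 0) b0 TE; apply: esym.
by_rewriting (eTw eb1) (- eB2)%X.
Qed.

Let Ea : mixed v a b 0 0 = val eEa.
Proof.
by rewrite /mixed -[0 + 1]/(1 : int) -[0 - 1]/(-1 : int) a0 b0 a1 b_1.
Qed.
Let Eb : mixed v b a 0 0 = val eEb.
Proof.
by rewrite /mixed -[0 + 1]/(1 : int) -[0 - 1]/(-1 : int) a0 b0 b1 a_1.
Qed.

Local Notation C := (val eC).
Local Notation Ci := (val eCi).
Local Notation X := (val eX).
Local Notation Y := (val eY).
Local Notation k1 := (val eK1).
Local Notation k2 := (val eK2).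

Let TC : T C = C. Proof. rewrite TE; by_rewriting (eTw eC) eC. Qed.
Let TX : T X = X. Proof. rewrite TE; by_rewriting (eTw eX) eX. Qed.
Let TY : T Y = Y. Proof. rewrite TE; by_rewriting (eTw eY) eY. Qed.
Let CCi : C * Ci = 1. Proof. by_rewriting (eC * eCi)%X E1. Qed.
Let CiC : Ci * C = 1. Proof. by_rewriting (eCi * eC)%X E1. Qed.
Let TK1 : C * T k1 = - k1.
Proof. rewrite TE; by_rewriting (eC * eTw eK1)%X (- eK1)%X. Qed.
Let TK2 : C * T k2 = - k2.
Proof. rewrite TE; by_rewriting (eC * eTw eK2)%X (- eK2)%X. Qed.

Let m1 : (- 1) * (- 1) = 1 :> A. Proof. by rewrite mulrNN mulr1. Qed.
Let one1 : 1 * 1 = 1 :> A. Proof. by rewrite mulr1. Qed.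

Ltac push_T := move=> k; rewrite !(linearD, linearN, linearZ, rmorphM) /=
  ?addrK ?subrK ?Ta1 ?Tb1 ?TX ?TY ?TC ?Ta ?Tb ?mul1r ?mulN1r
  ?(mulrN, mulNr, mulrNN, scalerN, opprD, opprK).

Let Ca k : C * a k = a k * C.
Proof.
move: k; apply: (T_shift (k0 := 0) one1); [by push_T | by push_T | rewrite a0].
by_rewriting (eC * eB1)%X (eB1 * eC)%X.
Qed.
Let Cb k : C * b k = b k * C.
Proof.
move: k; apply: (T_shift (k0 := 0) m1); [by push_T | by push_T | rewrite b0].
by_rewriting (eC * eB2)%X (eB2 * eC)%X.
Qed.
Let Cia k : Ci * a k = a k * Ci. Proof. exact: comm_inv CCi CiC (Ca k). Qed.
Let Cib k : Ci * b k = b k * Ci. Proof. exact: comm_inv CCi CiC (Cb k). Qed.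

Let Xa k : X * a k = a k * X + (v + v^-1) *: a (k + 1) + C * a (k - 1).
Proof.
move: k; apply: (T_shift (k0 := -1) one1); [by push_T | by push_T | ].
rewrite -[-1 + 1]/(0 : int) -[-1 - 1]/(-2 : int) a0 a_1 a_2.
by_rewriting (eX * ea_1)%X (ea_1 * eX + two *: eB1 + eC * ea_2)%X.
Qed.
Let Ya k : Y * a k = a k * Y - a (k + 1) - (v + v^-1) *: (C * a (k - 1)).
Proof.
move: k; apply: (T_shift (k0 := -1) one1); [by push_T | by push_T | ].
rewrite -[-1 + 1]/(0 : int) -[-1 - 1]/(-2 : int) a0 a_1 a_2.
by_rewriting (eY * ea_1)%X (ea_1 * eY - eB1 - two *: (eC * ea_2))%X.
Qed.
Let Xb k : X * b k = b k * X - b (k + 1) - (v + v^-1) *: (C * b (k - 1)).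
Proof.
move: k; apply: (T_shift (k0 := -1) m1); [by push_T | by push_T | ].
rewrite -[-1 + 1]/(0 : int) -[-1 - 1]/(-2 : int) b0 b_1 b_2.
by_rewriting (eX * eb_1)%X (eb_1 * eX - eB2 - two *: (eC * eb_2))%X.
Qed.
Let Yb k : Y * b k = b k * Y + (v + v^-1) *: b (k + 1) + C * b (k - 1).
Proof.
move: k; apply: (T_shift (k0 := -1) m1); [by push_T | by push_T | ].
rewrite -[-1 + 1]/(0 : int) -[-1 - 1]/(-2 : int) b0 b_1 b_2.
by_rewriting (eY * eb_1)%X (eb_1 * eY + two *: eB2 + eC * eb_2)%X.
Qed.
Let aa k : a k * a (k + 1) = v ^- 2 *: (a (k + 1) * a k).
Proof.
move: k; apply: (T_shift (k0 := -1) one1); [by push_T | by push_T | ].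
rewrite -[-1 + 1]/(0 : int) a0 a_1.
by_rewriting (ea_1 * eB1)%X (SInvPow 2 *: (eB1 * ea_1))%X.
Qed.
Let bb k : b k * b (k + 1) = v ^- 2 *: (b (k + 1) * b k).
Proof.
move: k; apply: (T_shift (k0 := -1) one1); [by push_T | by push_T | ].
rewrite -[-1 + 1]/(0 : int) b0 b_1.
by_rewriting (eb_1 * eB2)%X (SInvPow 2 *: (eB2 * eb_1))%X.
Qed.

Let Ta' k : T (a (k + 1)) = 1 *: a k. Proof. by rewrite Ta1 scale1r. Qed.
Let Tb' k : T (b (k + 1)) = (-1) *: b k. Proof. by rewrite Tb1 scaleN1r. Qed.
Let e11 : 1 * 1 = 1 :> F. Proof. by rewrite mulr1. Qed.
Let emm : (-1) * (-1) = 1 :> F. Proof. by rewrite mulrNN mulr1. Qed.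

Let half1 : loop_half v a b C Ci k1 k2 (val eL1) X Y.
Proof.
split; [exact: Ca | | | | | | | | | | exact: Xa | exact: Xb | exact: aa | rewrite Ea].
- by_rewriting (eC * eK1)%X (eK1 * eC)%X.
- by_rewriting (eC * eX)%X (eX * eC)%X.
- by_rewriting (eK1 * eL1)%X E1.
- by_rewriting (eL1 * eK1)%X E1.
- by_rewriting (eK1 * eK2)%X (eK2 * eK1)%X.
- apply: (K_shift CCi CiC TK1 e11 Ta' Cia); rewrite a0.
  by_rewriting (eK1 * eB1)%X (SInvPow 3 *: (eB1 * eK1))%X.
- apply: (K_shift CCi CiC TK1 emm Tb' Cib); rewrite b0.
  by_rewriting (eK1 * eB2)%X (SPow 3 *: (eB2 * eK1))%X.
- by_rewriting (eK1 * eX)%X (eX * eK1)%X.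
- by_rewriting (eK1 * eY)%X (eY * eK1)%X.
by_rewriting (eX * eEa)%X (eEa * eX)%X.
Qed.

Let half2 : loop_half v b a C Ci k2 k1 (val eL2) Y X.
Proof.
split; [exact: Cb | | | | | | | | | | exact: Yb | exact: Ya | exact: bb | rewrite Eb].
- by_rewriting (eC * eK2)%X (eK2 * eC)%X.
- by_rewriting (eC * eY)%X (eY * eC)%X.
- by_rewriting (eK2 * eL2)%X E1.
- by_rewriting (eL2 * eK2)%X E1.
- by_rewriting (eK2 * eK1)%X (eK1 * eK2)%X.
- apply: (K_shift CCi CiC TK2 emm Tb' Cib); rewrite b0.
  by_rewriting (eK2 * eB2)%X (SInvPow 3 *: (eB2 * eK2))%X.
- apply: (K_shift CCi CiC TK2 e11 Ta' Cia); rewrite a0.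
  by_rewriting (eK2 * eB1)%X (SPow 3 *: (eB1 * eK2))%X.
- by_rewriting (eK2 * eY)%X (eY * eK2)%X.
- by_rewriting (eK2 * eX)%X (eX * eK2)%X.
by_rewriting (eY * eEb)%X (eEb * eY)%X.
Qed.

Ltac weight_by_rewriting s t s' t' th2 th1 q q1 q_1 :=
  rewrite /weight_at /imag -[0 + 1]/(1 : int) -[0 - 1]/(-1 : int) ?Ea ?Eb ?a0 ?b0
    ?a1 ?b1 ?a_1 ?b_1;
  let p := constr:(eweight s t s' t' th2 th1 q q1 q_1) in
  refine (@qfact p.1 p.2 _); vm_compute; reflexivity.

Lemma qsp_loop :
  loop_data v T 1 a b C Ci k1 (val eL1) k2 (val eL2) X Y.
Proof.
split; [exact: half1 | exact: half2 | exact: Tinj | exact: CCi | exact: CiC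
  | exact: TC | exact: e11 | by move=> k; rewrite scale1r Ta
  | by move=> k; rewrite scaleN1r Tb | exact: TX | exact: TY | exact: TK1
  | exact: TK2 | | | | | | ].
- by_rewriting (eX * eY)%X (eY * eX)%X.
- rewrite /mixed -[-1 + 1]/(0 : int) -[0 - 1]/(-1 : int) a0 b0 a_1 b_1.
  by_rewriting (SV *: (eC * emixed ea_1 eB1 eB2 eb_1))%X
    (eX * eK2 + eY * eK1)%X.
- weight_by_rewriting (SPow 2) SV (SInvPow 2) SInv (eth2 eK1 eL2 eEa) (eth1 eX)
    eB1 ea1 ea_1.
- weight_by_rewriting SInv (SInvPow 2) SV (SPow 2) (eth2 eK1 eL2 eEa) (eth1 eX)
    eB2 eb1 eb_1.
- weight_by_rewriting (SPow 2) SV (SInvPow 2) SInv (eth2 eK2 eL1 eEb) (eth1 eY)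
    eB2 eb1 eb_1.
weight_by_rewriting SInv (SInvPow 2) SV (SPow 2) (eth2 eK2 eL1 eEb) (eth1 eY)
  eB1 ea1 ea_1.
Qed.

Lemma qsp_loop_data : exists Ci, loop_data v T 1 a b (- (v *: (K0 * K1 * K2)))
  Ci K1 L1 K2 L2 (- (qcomm (v ^+ 2) B1 (qcomm v B2 B0) - v *: (B0 * K1)))
  (qcomm (v ^+ 2) B2 (qcomm v B1 B0) - v *: (B0 * K2)).
Proof.
exists (val eCi); have := qsp_loop.
have -> : val eX = - (qcomm (v ^+ 2) B1 (qcomm v B2 B0) - v *: (B0 * K1)).
  by rewrite /qeval /= /qT /= mulr1 mul1r expr1.
have -> : val eY = qcomm (v ^+ 2) B2 (qcomm v B1 B0) - v *: (B0 * K2).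
  by rewrite /qeval /= /qT /= !mul1r expr1.
have -> : val eK1 = K1 by rewrite /qeval /= /qT /= mulr1 mul1r expr1.
have -> : val eL1 = L1 by rewrite /qeval /= /qT /= mulr1 mul1r expr1.
have -> : val eK2 = K2 by rewrite /qeval /= /qT /= !mul1r expr1.
have -> : val eL2 = L2 by rewrite /qeval /= /qT /= !mul1r expr1.
by have -> : val eC = - (v *: (K0 * K1 * K2)) by rewrite /qeval /= /qT /= !expr1.
Qed.

End Model.

(** * The algebra U and its root vectors *)

(** The value at the indeterminate is the image of the polynomial itself in its
    field of fractions. *)
Lemma vQ_transcendental (p : zpoly) : peval vQ p = 0 -> all (Z.eqb 0) p.
Proof.
pose r (c : Z) : rat := (int_of_Z c)%:~R.
have -> : peval vQ p = tofrac (Poly (map r p)).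
  elim: p => [|c p IH] /=; first by rewrite rmorph0.
  rewrite IH cons_poly_def rmorphD rmorphM /= addrC mulrC vQ.unlock; congr (_ + _).
  by rewrite /zF /r !rmorph_int.
move/eqP; rewrite tofrac_eq0 => /eqP p0; apply/(all_nthP 0%BZ) => i lt_i.
have := congr1 (fun q : {poly rat} => q`_i) p0.
rewrite coef_Poly coef0 (nth_map 0%BZ) // /r => /eqP.
by rewrite intr_eq0 => /eqP /(congr1 Z_of_int); rewrite int_of_ZK => ->.
Qed.

(** Stated for an abstract map f, so that the computation does not unfold the
    multiplication of the quotient algebra. *)
Lemma defrel_image (F : fieldType) (v : F) (P A : algType F) (f : P -> A)
  (B K L : 'I_3 -> P) :
  f 0 = 0 -> f 1 = 1 -> (forall x y, f (x + y) = f x + f y) ->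
  (forall x, f (- x) = - f x) -> (forall x y, f (x * y) = f x * f y) ->
  (forall c x, f (c *: x) = c *: f x) ->
  (forall x y, defrel v B K L x y -> f x = f y) ->
  forall x y, defrel v (f \o B) (f \o K) (f \o L) x y -> x = y.
Proof.
move=> f0 f1 fD fN fM fZ fr x y; have fE := (expr2, f0, f1, fD, fN, fM, fZ).
case=> [i|i|i j|i j|||i ni|i ni] /=.
- by rewrite -fM (fr _ _ (rel_KKV _ _ _ _ i)) f1.
- by rewrite -fM (fr _ _ (rel_KVK _ _ _ _ i)) f1.
- by rewrite -!fM (fr _ _ (rel_KK _ _ _ _ i j)).
- by rewrite -fM (fr _ _ (rel_KB _ _ _ _ i j)) fZ fM.
- by have := fr _ _ (rel_B21 _ _ _ _); rewrite !fE.
- by have := fr _ _ (rel_B12 _ _ _ _); rewrite !fE.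
- by have := fr _ _ (rel_B0i _ _ _ _ ni); rewrite !fE.
by have := fr _ _ (rel_Bi0 _ _ _ _ ni); rewrite !fE.
Qed.

Lemma U_defrel (F : fieldType) (v : F) x y :
  defrel v (genB v) (genK v) (genKV v) x y -> x = y.
Proof.
apply: (defrel_image (f := piU v)) => //.
- by move=> ? ?; apply/esym/piU_add.
- by move=> ?; apply/esym/piU_opp.
- by move=> ? ?; apply/esym/piU_mul.
- by move=> ? ?; apply/esym/piU_scale.
by move=> ? ? r; apply/piUP; apply: relideal_rel.
Qed.

Section Generic.
Variables (F : fieldType) (v : F).
Hypothesis vtr : forall p : zpoly, peval v p = 0 -> all (Z.eqb 0) p.

Lemma gap_neq0 : v - v^-1 != 0.
Proof.
have v0 := v_neq0 vtr; rewrite subr_eq0; apply: contra (v_pow_neq1 vtr 1).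
by move=> /eqP e; rewrite expr2 {2}e mulfV.
Qed.

Lemma qint2 : qint v 2 = v + v^-1.
Proof.
apply: (mulIf gap_neq0); rewrite /qint mulfVK ?gap_neq0 //.
have v0 := v_neq0 vtr.
by rewrite -[v ^ 2]/(v ^+ 2) -[v ^ (- 2)]/(v ^- 2); field.
Qed.

Lemma qsp_of_defrel (A : algType F) (B K L : 'I_3 -> A) :
  (forall x y, defrel v B K L x y -> x = y) ->
  qsp_rel v (B 0) (B 1) (B 2) (K 0) (K 1) (K 2) (L 0) (L 1) (L 2).
Proof.
move=> r; have KB i j := r _ _ (rel_KB v B K L i j).
have solve (x y z w : A) : x - y + z = w -> x = y - z + w.
  by move=> <-; rewrite [RHS]addrC addrACA subrK subrr addr0.
have solve' (x y z w : A) : z - y + x = w -> x = y - z + w.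
  by move=> e; apply: solve; rewrite addrAC (addrC x) addrAC.
split.
- exact: r _ _ (rel_KKV _ _ _ _ _).
- exact: r _ _ (rel_KVK _ _ _ _ _).
- exact: r _ _ (rel_KKV _ _ _ _ _).
- exact: r _ _ (rel_KVK _ _ _ _ _).
- exact: r _ _ (rel_KKV _ _ _ _ _).
- exact: r _ _ (rel_KVK _ _ _ _ _).
- exact: r _ _ (rel_KK _ _ _ _ _ _).
- exact: r _ _ (rel_KK _ _ _ _ _ _).
- exact: r _ _ (rel_KK _ _ _ _ _ _).
- by rewrite KB scale1r.
- by rewrite KB scale1r.
- by rewrite KB scale1r.
- by rewrite KB scale1r.
- by rewrite KB.
- by rewrite KB.
- by rewrite KB scale1r.
- by rewrite KB.
- by rewrite KB.
- have := r _ _ (rel_B21 _ _ _ _); rewrite qint2 !expr2 !mulrA; exact: solve.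
- have := r _ _ (rel_B12 _ _ _ _); rewrite qint2 !expr2 !mulrA; exact: solve'.
- have := r _ _ (rel_B0i v B K L (i := 1) isT); rewrite qint2 !expr2 !mulrA.
  by move/solve'; rewrite addr0.
- have := r _ _ (rel_B0i v B K L (i := 2) isT); rewrite qint2 !expr2 !mulrA.
  by move/solve'; rewrite addr0.
- have := r _ _ (rel_Bi0 v B K L (i := 1) isT); rewrite qint2 !expr2 !mulrA.
  exact: solve.
have := r _ _ (rel_Bi0 v B K L (i := 2) isT); rewrite qint2 !expr2 !mulrA.
exact: solve.
Qed.

Lemma Theta_step (A : algType F) (d : F) (C E L th th' : A) :
  C * E = E * C -> C * th' = th' * C -> d *: th = th' ->
  d *: (v *: (th * C) - v *: (- E * C * L))
    = (d * v) *: (C * E * L) + v *: (C * th').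
Proof.
move=> CE Cth dth; rewrite scalerBr !scalerA !mulNr scalerN opprK addrC CE.
by congr (_ + _); rewrite mulrC -scalerA Cth -dth -scalerAl.
Qed.

Lemma Theta_2 (A : algType F) (d : F) (C E K L : A) : d != 0 ->
  C * E = E * C -> K * L = L * K ->
  d *: (- (v *: (- E * C * L)) + v *: (d^-1 *: 1 * C)
        - d^-1 *: 1 * C * L * K)
    = (d * v) *: (C * E * L) + v *: (C * 1) - C * (K * L).
Proof.
move=> d0 CE KL; rewrite scalerBr [- _ + v *: _]addrC (@Theta_step _ d C E L _ 1).
- by congr (_ - _); rewrite KL -!scalerAl scalerA mulfV // scale1r mul1r mulrA.
- by [].
- by rewrite mulr1 mul1r.
by rewrite scalerA mulfV // scale1r.
Qed.

Section Roots.
Variables (o : 'I_3 -> F) (T : algAut (U v)).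
Local Notation B := (genB v).
Local Notation K := (genK v).
Local Notation KV := (genKV v).
Local Notation C := (Ccentral v).
Local Notation Bk := (rootB o T).
Local Notation th := (Theta o T).

Lemma rootB0 i : Bk i 0 = B i.
Proof. by rewrite /rootB expr0z scale1r oppr0. Qed.

Lemma T_aut_expz k x : T (aut_expz T k x) = aut_expz T (k + 1) x.
Proof.
case: k => n; first by rewrite -PoszD addn1.
rewrite /= aut_invK; case: n => [|n] //.
by have -> : Negz n.+1 + 1 = Negz n by lia.
Qed.

Lemma T_rootB i k : o i != 0 -> T (Bk i k) = o i *: Bk i (k - 1).
Proof.
move=> oi; rewrite /rootB linearZ /= T_aut_expz !scalerA opprB addrC.
congr (_ *: _); by rewrite -[RHS]mulrC -[X in _ * X]expr1z -expfzDr // subrK.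
Qed.

Lemma rootD_mixed i k : rootD o T i k = - mixed v (Bk i) (Bk (tau i)) k 0.
Proof. by rewrite /rootD /mixed /qcomm rootB0 sub0r [RHS]opprD. Qed.

Lemma imag_Theta eps i Ci Y n :
  loop_data v T eps (Bk i) (Bk (tau i)) C Ci (K i) (KV i) (K (tau i))
    (KV (tau i)) (th i 1) Y ->
  (v - v^-1) *: th i n
    = imag v C (K i) (KV (tau i)) (th i 1) (mixed v (Bk i) (Bk (tau i))) n.
Proof.
move=> D; have g0 := gap_neq0.
have KL : K i * KV (tau i) = KV (tau i) * K i.
  apply/esym/(comm_inv (lh_KL (ld_2 D)) (lh_LK (ld_2 D))).
  exact/esym/(lh_KK' (ld_1 D)).
have CE := CE D; have Cth := Cth D.
have th0 : (v - v^-1) *: th i 0 = 1 by rewrite scalerA mulfV // scale1r.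
suff: (v - v^-1) *: th i n = imag v C (K i) (KV (tau i)) (th i 1)
      (mixed v (Bk i) (Bk (tau i))) n
    /\ (v - v^-1) *: th i n.+1 = imag v C (K i) (KV (tau i)) (th i 1)
      (mixed v (Bk i) (Bk (tau i))) n.+1 by case.
elim: n => [|n [IH IH1]]; first by split; [exact: th0 | ].
split=> //; case: n IH {IH1} => [|n] IH.
  by rewrite [th _ 2]/= rootD_mixed; exact: Theta_2.
have thE : th i n.+3 = v *: (th i n.+1 * C)
    - v *: (rootD o T i n.+1 * C * KV (tau i)) by [].
by rewrite thE rootD_mixed (Theta_step _ (CE _ _) (Cth _) IH) /= subr0.
Qed.

(** Theta_{i,n} and theta_n differ by the nonzero factor v - v^-1. *)
Lemma T_Theta eps i Ci Y n :
  loop_data v T eps (Bk i) (Bk (tau i)) C Ci (K i) (KV i) (K (tau i))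
    (KV (tau i)) (th i 1) Y -> T (th i n) = th i n.
Proof.
move=> D; apply: (scalerI gap_neq0).
by have := T_imag vtr D n; rewrite -(imag_Theta n D) linearZ.
Qed.

End Roots.

Lemma braid_swap (A : algType F) (S0 S1 : A -> A) B0 B1 B2 K0 K1 K2 L0 L1 L2 :
  qsp_rel v B0 B1 B2 K0 K1 K2 L0 L1 L2 ->
  braid_images v S0 S1 B0 B1 B2 K0 K1 K2 L0 L1 L2 ->
  braid_images v S0 S1 B0 B2 B1 K0 K2 K1 L0 L2 L1.
Proof.
move=> R I; split; try by case: I.
  rewrite (i1_K0 I) -(mulrA _ (K1 ^+ 2)) -(mulrA _ (K2 ^+ 2)); congr (_ *: (_ * _)).
  by do 2!(apply: commrX; apply: commr_sym); exact: (q_K12 R).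
by rewrite (i1_B0 I) (T1B0_sym vtr R).
Qed.

Section Pair.
Variables (o : 'I_3 -> F) (T0 T1 : algAut (U v)).
Hypotheses (is0 : is_T0 T0) (is1 : is_T1 T1).
Local Notation B := (genB v).
Local Notation K := (genK v).
Local Notation KV := (genKV v).

Let R12 := qsp_of_defrel (@U_defrel F v).

Lemma braid_12 : braid_images v T0 T1 (B 0) (B 1) (B 2) (K 0) (K 1) (K 2)
  (KV 0) (KV 1) (KV 2).
Proof.
case: is0 => e1 e2 e3 e4; case: is1 => [[f1 f2 f3] [f4 f5 f6]].
split; by [exact: e1 | exact: e2 | exact: e3 | exact: e4 | exact: f1 | exact: f2
  | exact: f3 | exact: f4 | exact: f5 | exact: f6].
Qed.

(** The index whose sign is 1 is taken first; [T1B0_sym] allows this to be 2. *)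
Lemma pair_loop i : i != 0 -> o i = 1 -> o (tau i) = -1 ->
  exists Ci, loop_data v (aut_comp T0 T1) 1 (rootB o (aut_comp T0 T1) i)
    (rootB o (aut_comp T0 T1) (tau i)) (Ccentral v) Ci (K i) (KV i)
    (K (tau i)) (KV (tau i)) (Theta o (aut_comp T0 T1) i 1)
    (Theta o (aut_comp T0 T1) (tau i) 1).
Proof.
move=> i0 oi oj.
have [-> tt R I] : [/\ Ccentral v = - (v *: (K 0 * K i * K (tau i))),
    tau (tau i) = i,
    qsp_rel v (B 0) (B i) (B (tau i)) (K 0) (K i) (K (tau i))
      (KV 0) (KV i) (KV (tau i))
  & braid_images v T0 T1 (B 0) (B i) (B (tau i)) (K 0) (K i) (K (tau i))
      (KV 0) (KV i) (KV (tau i))].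
  have [->|->] : i = 1 \/ i = 2.
    by case: i i0 {oi oj} => [[|[|[|m]]] lt_m] // _; [left | right]; apply/val_inj.
    by split=> //; exact: braid_12.
  split=> //; [|exact: qsp_rel_swap R12|exact: braid_swap R12 braid_12].
  by rewrite /Ccentral -mulrA (q_K12 R12) mulrA.
have := @qsp_loop_data F v (U v) vtr _ _ _ _ _ _ _ _ _ R T0 T1 I (aut_comp T0 T1)
  (rootB o (aut_comp T0 T1) i) (rootB o (aut_comp T0 T1) (tau i)).
case=> //.
- exact: can_inj (aut_funK (aut_comp T0 T1)).
- exact: rootB0.
- exact: rootB0.
- by move=> k; rewrite T_rootB oi ?oner_eq0 // scale1r.
- by move=> k; rewrite T_rootB oj ?oppr_eq0 ?oner_eq0 // scaleN1r.
move=> Ci D; exists Ci; rewrite /= tt oi oj scale1r scaleN1r opprK.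
exact: D.
Qed.

End Pair.
End Generic.

Theorem theoremC (T0 T1 : algAut (U vQ)) (o : 'I_3 -> Qv) :
  is_T0 T0 -> is_T1 T1 ->
  (o 1 = 1 \/ o 1 = -1) -> o 1 = - o 2 ->
  forall (i : 'I_3) (n : nat), i != 0 -> (1 <= n)%N ->
  (aut_comp T0 T1) (Theta o (aut_comp T0 T1) i n)
    = Theta o (aut_comp T0 T1) i n.
Proof.
move=> is0 is1 o1 o12 i n i0 _; have vtr := vQ_transcendental.
have [o2 tt t0] : [/\ (o i = 1 /\ o (tau i) = -1) \/ (o i = -1 /\ o (tau i) = 1),
    tau (tau i) = i & tau i != 0].
  have e : o 2 = - o 1 by rewrite o12 opprK.
  have [->|->] : i = 1 \/ i = 2.
  - by case: i i0 => [[|[|[|m]]] lt_m] // _; [left | right]; apply/val_inj.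
  - by split=> //; case: o1 => o1; [left | right]; rewrite /tau /= e o1 ?opprK.
  by split=> //; case: o1 => o1; [right | left]; rewrite /tau /= e o1 ?opprK.
case: o2 => [[oi oj]|[oi oj]].
  have [Ci D] := pair_loop vtr is0 is1 i0 oi oj.
  exact: (T_Theta vtr n D).
have [Ci D] := pair_loop vtr is0 is1 t0 oj (etrans (congr1 o tt) oi).
rewrite tt in D; have := loop_data_swap D; exact: T_Theta.
Qed.
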